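(* Let $m\in\mathbb{N}_0$ and $\alpha>m-1$. Let $T_{0,m}^{\mathrm{II},\alpha}$ be the minimal operator in $L^2((0,\infty);W_m^{\mathrm{II},\alpha})$ generated by the Type II exceptional $X_m$-Laguerre differential expression $\ell_m^{\mathrm{II},\alpha}[\cdot]$. (a) The deficiency index of $T_{0,m}^{\mathrm{II},\alpha}$ is (i) $(1,1)$ when $m=0$ and $-1<\alpha<1$, or when $m=1$ and $0<\alpha<1$; (ii) $(0,0)$ when $m=0$ and $\alpha\ge1$, or when $m=1$ and $\alpha\ge1$, or when $m\ge2$. (b) The operator $T_m^{\mathrm{II},\alpha}$ in $L^2((0,\infty);W_m^{\mathrm{II},\alpha})$ defined by $T_m^{\mathrm{II},\alpha}f=\ell_m^{\mathrm{II},\alpha}[f]$ for $f\in\mathcal{D}(T_m^{\mathrm{II},\alpha})$ is self-adjoint, where the domain is given by (i) $\mathcal{D}(T_m^{\mathrm{II},\alpha}):=\{f\in\Delta_m^{\mathrm{II},\alpha}\;:\;\lim_{x\to0^+}x^{\alpha+1}f'(x)=0\}$ when the deficiency index of $T_{0,m}^{\mathrm{II},\alpha}$ is $(1,1)$, or by (ii) $\mathcal{D}(T_m^{\mathrm{II},\alpha}):=\Delta_m^{\mathrm{II},\alpha}$ when the deficiency index of $T_{0,m}^{\mathrm{II},\alpha}$ is $(0,0)$. Moreover, in either case, $T_m^{\mathrm{II},\alpha}$ has the Type II exceptional $X_m$-Laguerre polynomials $\{L_{m,n}^{\mathrm{II},\alpha}\}_{n=m}^\infty$ as a complete set of eigenfunctions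 in $L^2((0,\infty);W_m^{\mathrm{II},\alpha})$. Lastly, the spectrum of $T_m^{\mathrm{II},\alpha}$ consists only of eigenvalues and is given by $\sigma(T_m^{\mathrm{II},\alpha})=\mathbb{N}_0$.
   Context: $\mathbb{N}_0=\{0,1,2,\dots\}$. For $a\in\mathbb{R}$ and $n\in\mathbb{N}_0$ the classical Laguerre polynomial is $L_n^a(x)=\sum_{j=0}^n\binom{n+a}{n-j}\frac{(-x)^j}{j!}$, with $\binom{r}{i}=r(r-1)\cdots(r-i+1)/i!$; $L_n^a:=0$ for $n<0$. Type II weight: $W_m^{\mathrm{II},\alpha}(x)=\dfrac{x^\alpha e^{-x}}{(L_m^{-\alpha-1}(x))^2}$ on $(0,\infty)$ (for $\alpha>m-1$, $L_m^{-\alpha-1}(x)$ has no zeros in $[0,\infty)$). $L^2((0,\infty);W)$ is the Hilbert space of complex-valued measurable $f$ with $\int_0^\infty|f|^2W\,dx<\infty$ with the usual inner product. Type II exceptional $X_m$-Laguerre differential expression: $$\ell_m^{\mathrm{II},\alpha}[y](x)=-xy''(x)+\left(-1-\alpha+x+2x\frac{(L_m^{-\alpha-1}(x))'}{L_m^{-\alpha-1}(x)}\right)y'(x)+\left(m-2x\frac{(L_m^{-\alpha-1}(x))'}{L_m^{-\alpha-1}(x)}\right)y(x).$$ Type II exceptional $X_m$-Laguerre polynomials: $L_{m,n}^{\mathrm{II},\alpha}(x)=xL_m^{-\alpha-1}(x)L_{n-m-1}^{\alpha+2}(x)+(m-\alpha-1)L_m^{-\alpha-2}(x)L_{n-m}^{\alpha+1}(x)$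 for $n\ge m$. Maximal domain: $\Delta_m^{\mathrm{II},\alpha}=\{f:(0,\infty)\to\mathbb{C}\mid f,f'\in AC_{\mathrm{loc}}(0,\infty);\ f,\ell_m^{\mathrm{II},\alpha}[f]\in L^2((0,\infty);W_m^{\mathrm{II},\alpha})\}$, where $AC_{\mathrm{loc}}(0,\infty)$ denotes the locally absolutely continuous functions. For $f,g\in\Delta_m^{\mathrm{II},\alpha}$ let $$[f,g]_m^{\mathrm{II},\alpha}(x)=\frac{x^{\alpha+1}e^{-x}}{(L_m^{-\alpha-1}(x))^2}\left(f(x)\overline{g}'(x)-f'(x)\overline{g}(x)\right);$$ its limits as $x\to0^+$ and $x\to\infty$ exist and are finite. The minimal operator is $T_{0,m}^{\mathrm{II},\alpha}f=\ell_m^{\mathrm{II},\alpha}[f]$ with domain $\{f\in\Delta_m^{\mathrm{II},\alpha}\mid \lim_{x\to\infty}[f,g]_m^{\mathrm{II},\alpha}(x)-\lim_{x\to0^+}[f,g]_m^{\mathrm{II},\alpha}(x)=0\text{ for all }g\in\Delta_m^{\mathrm{II},\alpha}\}$; it is closed and symmetric, and its adjoint is the maximal operator $f\mapsto\ell_m^{\mathrm{II},\alpha}[f]$ on $\Delta_m^{\mathrm{II},\alpha}$. The deficiency index of a closed symmetric operator $T$ is the pair $(\dim\ker(T^*-i),\dim\ker(T^*+i))$. A set of functions is complete if its linear span is dense. *)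

(* Defs.v *)
From HB Require Import structures.
From mathcomp Require Import all_boot all_order all_algebra.
From mathcomp Require Import complex.
From mathcomp Require Import all_classical all_reals all_analysis.

Set Implicit Arguments.
Unset Strict Implicit.
Unset Printing Implicit Defensive.

Import Order.TTheory GRing.Theory Num.Theory.
Import numFieldNormedType.Exports.

Local Open Scope classical_set_scope.
Local Open Scope ring_scope.
Local Open Scope complex_scope.

(* Functions (0,oo) -> C are represented by total functions R -> R[i]; every
   notion below only looks at their values on the half-line. *)
Notation halfline R := (`]0%R, +oo[%classic : set R).
Notation Refun f := (fun x => complex.Re (f x)).
Notation Imfun f := (fun x => complex.Im (f x)).

(* R[i] is not a normed module over R in the library, so derivatives, limits
   and absolute continuity are taken on real and imaginary parts. *)
Definition cderive (R : realType) (f : R -> R[i]) : R -> R[i] :=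
  fun x => derive1 (Refun f) x +i* derive1 (Imfun f) x.

Definition cderivable (R : realType) (f : R -> R[i]) (x : R) : Prop :=
  derivable (Refun f) x 1 /\ derivable (Imfun f) x 1.

Definition ccvg (R : realType) (F : set_system R) (f : R -> R[i]) (l : R[i]) :
    Prop :=
  complex.Re (f x) @[x --> F] --> complex.Re l /\
  complex.Im (f x) @[x --> F] --> complex.Im l.

Definition abs_cont (R : realType) (a b : R) (g : R -> R) : Prop :=
  forall e : R, 0 < e -> exists2 d : R, 0 < d &
    forall (n : nat) (s t : 'I_n -> R),
      (forall i, [/\ a <= s i, s i <= t i & t i <= b]) ->
      trivIset setT (fun i => `]s i, t i[%classic) ->
      \sum_(i < n) (t i - s i) < d ->
      \sum_(i < n) `|g (t i) - g (s i)| < e.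

Definition AC_loc (R : realType) (f : R -> R[i]) : Prop :=
  forall a b : R, 0 < a -> a <= b ->
    abs_cont a b (Refun f) /\ abs_cont a b (Imfun f).

(* Equality in L^2((0,oo); W): the weights considered are positive on (0,oo),
   so W dx and dx have the same null sets there. *)
Definition aeq (R : realType) (f g : R -> R[i]) : Prop :=
  {ae @lebesgue_measure R, forall x, 0 < x -> f x = g x}.

Definition normsq (R : realType) (W : R -> R) (f : R -> R[i]) : \bar R :=
  (\int[@lebesgue_measure R]_(x in halfline R)
     (((complex.Re (f x)) ^+ 2 + (complex.Im (f x)) ^+ 2) * W x)%:E)%E.

(* Borel representatives of the elements of L^2((0,oo); W). *)
Definition L2 (R : realType) (W : R -> R) (f : R -> R[i]) : Prop :=
  [/\ measurable_fun (halfline R) (Refun f),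
      measurable_fun (halfline R) (Imfun f) &
      (normsq W f < +oo)%E].

(* For functions, like l[f], which are only determined almost everywhere. *)
Definition in_L2 (R : realType) (W : R -> R) (f : R -> R[i]) : Prop :=
  exists2 g, L2 W g & aeq f g.

Definition inner (R : realType) (W : R -> R) (f g : R -> R[i]) : R[i] :=
  (\int[@lebesgue_measure R]_(x in halfline R)
     (complex.Re (f x * conjc (g x)) * W x)) +i*
  (\int[@lebesgue_measure R]_(x in halfline R)
     (complex.Im (f x * conjc (g x)) * W x)).

Definition lincomb (R : realType) (n : nat) (c : 'I_n -> R[i])
    (e : 'I_n -> R -> R[i]) : R -> R[i] :=
  fun x => \sum_(i < n) c i * e i x.

Definition dense_L2 (R : realType) (W : R -> R) (S : set (R -> R[i])) : Prop :=
  forall f, L2 W f -> forall e : R, 0 < e ->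
    exists2 g, S g & (normsq W (fun x => f x - g x)%R < e%:E)%E.

Definition complete_system (R : realType) (W : R -> R)
    (p : nat -> R -> R[i]) : Prop :=
  dense_L2 W [set g | exists (N : nat) (c : 'I_N -> R[i]),
                        g = lincomb c (fun k => p k)].

(* An operator in L^2((0,oo); W) is given by its graph, a relation between
   representatives that is compatible with almost everywhere equality. *)
Notation operator R := ((R -> R[i]) -> (R -> R[i]) -> Prop).

Definition op (R : realType) (W : R -> R) (D : set (R -> R[i]))
    (l : (R -> R[i]) -> (R -> R[i])) : operator R :=
  fun u v => [/\ L2 W u, L2 W v & exists f, [/\ D f, aeq u f & aeq v (l f)]].

Definition op_dom (R : realType) (T : operator R) : set (R -> R[i]) :=
  [set u | exists v, T u v].

Definition adjoint (R : realType) (W : R -> R) (T : operator R) : operator R :=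
  fun g h => [/\ L2 W g, L2 W h &
    forall u v, T u v -> inner W v g = inner W u h].

Definition self_adjoint (R : realType) (W : R -> R) (T : operator R) : Prop :=
  dense_L2 W (op_dom T) /\ (forall u v, adjoint W T u v <-> T u v).

(* ker (T - lam) *)
Definition op_eigenspace (R : realType) (T : operator R) (lam : R[i]) :
    set (R -> R[i]) :=
  [set u | exists2 v, T u v & aeq v (fun x => lam * u x)].

Definition op_eigenfunction (R : realType) (T : operator R) (lam : R[i])
    (u : R -> R[i]) : Prop :=
  op_eigenspace T lam u /\ ~ aeq u (fun=> 0).

Definition op_eigenvalue (R : realType) (T : operator R) (lam : R[i]) : Prop :=
  exists u, op_eigenfunction T lam u.

(* Dimension of a subspace modulo almost everywhere equality. *)
Definition has_dim (R : realType) (S : set (R -> R[i])) (n : nat) : Prop :=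
  exists e : 'I_n -> R -> R[i],
    [/\ forall i, S (e i),
        forall c, aeq (lincomb c e) (fun=> 0) -> forall i, c i = 0 &
        forall u, S u -> exists c, aeq u (lincomb c e)].

Definition deficiency_index (R : realType) (W : R -> R) (T : operator R)
    (pq : nat * nat) : Prop :=
  has_dim (op_eigenspace (adjoint W T) (0 +i* 1)) pq.1 /\
  has_dim (op_eigenspace (adjoint W T) (0 -i* 1)) pq.2.

(* T - lam is a bijection from the domain of T onto L^2((0,oo); W) with bounded
   inverse; injectivity is part of the norm estimate. *)
Definition resolvent_set (R : realType) (W : R -> R) (T : operator R) :
    set R[i] :=
  [set lam |
    (forall h, L2 W h -> exists u v, T u v /\ aeq (fun x => v x - lam * u x) h)
    /\ (exists2 M : R, 0 <= M & forall u v, T u v ->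
          (normsq W u <= M%:E * normsq W (fun x => v x - lam * u x)%R)%E)].

Definition spectrum (R : realType) (W : R -> R) (T : operator R) : set R[i] :=
  ~` resolvent_set W T.

Definition gbinomial (R : realType) (r : R) (i : nat) : R :=
  (\prod_(k < i) (r - k%:R)) / i`!%:R.

Definition laguerre (R : realType) (n : int) (a : R) : {poly R} :=
  if n is Posz k then
    \poly_(j < k.+1) (gbinomial (k%:R + a) (k - j) * (-1) ^+ j / j`!%:R)
  else 0.

Section TypeII.
Context (R : realType) (m : nat) (alpha : R).

Definition xiII : {poly R} := laguerre m (- alpha - 1).
Local Notation xi := xiII.

Definition weightII : R -> R :=
  fun x => x `^ alpha * expR (- x) / xi.[x] ^+ 2.

Definition ellII (y : R -> R[i]) : R -> R[i] := fun x =>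
  - x%:C * cderive (cderive y) x
  + (- 1 - alpha + x + 2 * x * (xi^`()).[x] / xi.[x])%:C * cderive y x
  + (m%:R - 2 * x * (xi^`()).[x] / xi.[x])%:C * y x.

Definition laguerreII (n : nat) : {poly R} :=
  'X * xi * laguerre (n%:Z - m%:Z - 1) (alpha + 2)
  + (m%:R - alpha - 1)
      *: (laguerre m (- alpha - 2) * laguerre (n%:Z - m%:Z) (alpha + 1)).

(* For f' in AC_loc, f'' exists almost everywhere, and derive1 is a junk value
   elsewhere; hence in_L2 rather than L2. *)
Definition DeltaII : set (R -> R[i]) :=
  [set f | [/\ forall x, 0 < x -> cderivable f x,
               AC_loc f, AC_loc (cderive f),
               in_L2 weightII f & in_L2 weightII (ellII f)]].

Definition formII (f g : R -> R[i]) : R -> R[i] := fun x =>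
  (x `^ (alpha + 1) * expR (- x) / xi.[x] ^+ 2)%:C
  * (f x * cderive (fun t => conjc (g t)) x - cderive f x * conjc (g x)).

Definition dom_minII : set (R -> R[i]) :=
  [set f | DeltaII f /\ forall g, DeltaII g ->
     exists l1 l0 : R[i], [/\ ccvg +oo (formII f g) l1,
                              ccvg 0^'+ (formII f g) l0 & l1 - l0 = 0]].

Definition T0II : operator R := op weightII dom_minII ellII.

Definition dom_bcII : set (R -> R[i]) :=
  [set f | DeltaII f /\
     ccvg 0^'+ (fun x => (x `^ (alpha + 1))%:C * cderive f x) 0].

End TypeII.

(* Main.v *)
Require Import Defs.
From HB Require Import structures.
From mathcomp Require Import all_boot all_order all_algebra.
From mathcomp Require Import ring lra.
From mathcomp Require Import complex.
From mathcomp Require Import all_classical all_reals all_analysis.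
From mathcomp Require Import measurable_realfun numfun.
Import Order.TTheory GRing.Theory Num.Theory.
Import numFieldNormedType.Exports.
Local Open Scope classical_set_scope.
Local Open Scope ring_scope.
Local Open Scope complex_scope.
Set Implicit Arguments.
Unset Strict Implicit.
Unset Printing Implicit Defensive.

(** Write W for the weight, xi for L_m^(-alpha-1), p = x W and
    q = m - 2 x xi' / xi. Since alpha > m - 1, all coefficients of xi have the
    same sign, so xi has no zero on [0, oo), q is bounded, and
    l[f] = - (p f')' / W + q f has real coefficients. All the analysis is done
    on real functions; complex ones are pairs.

    The exceptional polynomials are P_k = A(L_k^(alpha+1)), where
    A y = - x xi y' + (x xi' - (alpha + 1) xi) y is a first order operator
    ([laguerreII_darboux]); contiguity and the Laguerre equation give
    l[P_k] = k P_k ([darboux_eigen]). They are complete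
    ([orthogonal_eq0]): if g is orthogonal to every A y, then integrating by
    parts against all polynomials y turns the orthogonality into the vanishing
    of all moments of an exponentially decaying function, hence into a first
    order differential equation whose solutions are g = c e^x, and these are
    not square integrable unless c = 0. That moments determine such functions
    is [moments_zero].

    The core is [Qbc_coefP]: u lies in the domain of the operator with boundary
    condition p f' -> 0 at 0, with image v, if and only if the Fourier
    coefficients satisfy v_k = k u_k. If f is in the domain, the boundary form
    of f with a polynomial vanishes at both ends, since a nonzero limit would
    force f to be too large for L^2 ([wronsk_poly_cvg0], [wronsk_poly_cvgy]),
    and Green's formula gives v_k = k u_k. Conversely the partial sums of the
    expansions of u and v are in the graph, which is closed under L^2 limits
    ([Qbc_closed]) because p f' is the integral from 0 of a density which depends
    continuously on (f, v). So the operator is unitarily equivalent to the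
    multiplication by k: self-adjointness, spectrum and eigenfunctions are read
    off from the coefficients, with Riesz-Fischer and Parseval.

    For every f in the maximal domain p f' has a limit at 0, as constants are
    in L^2. If alpha >= 1 a nonzero limit would make f of the order of x^(-alpha)
    and f^2 W of the order of 1 / x at least, so the boundary condition is automatic
    ([Qmax_Qbc]); the minimal operator is then the self-adjoint one, and its
    deficiency index is (0, 0). If alpha < 1 there is a function phi of the
    maximal domain with a nonzero limit ([boundary_function]); correcting phi
    by a resolvent gives a nonzero psi with l[psi] = lam psi, and psi spans the
    deficiency space for every nonreal lam ([deficiency1_aux]). The two
    cases are exclusive, so the deficiency index determines which domain is meant.

    Green's formula for functions whose quasi-derivative p f' is only
    absolutely continuous rests on Lebesgue's fundamental theorem of calculus
    ([abs_cont_FTC]), obtained from the Radon-Nikodym density of the Stieltjes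
    measure of a nondecreasing absolutely continuous function. *)

(** * Lebesgue's fundamental theorem of calculus *)

Ltac itv_sub := let x := fresh "x" in move=> x; rewrite /= ?in_itv/= ?andbT;
  try (move=> /andP[? ?]); intros; try (apply/andP; split); try done; lra.

Section abs_cont_FTC.
Context {R : realType}.
Notation mu := (@lebesgue_measure R).
Implicit Types (f g : R -> R) (L M : seq (R * R)).

Definition sep (p q : R * R) : bool := (p.2 <= q.1) || (q.2 <= p.1).
Definition osc f L : R := \sum_(p <- L) `|f p.2 - f p.1|.
Definition len L : R := \sum_(p <- L) (p.2 - p.1).
Definition ord L : bool := all (fun p => p.1 <= p.2) L.

(** Absolute continuity on the whole line, for lists of intervals instead of
    families: lists can be refined interval by interval. The bound is not strict
    because it has to survive suprema. *)
Definition abs_cont_seq f : Prop := forall e : R, 0 < e -> exists2 d : R, 0 < d &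
  forall L, ord L -> pairwise sep L -> len L < d -> osc f L <= e.

(** Composing with the retraction onto [a, b] extends a function by constants,
    which turns absolute continuity on [a, b] into absolute continuity on the line. *)
Definition clamp (a b x : R) : R := Num.max a (Num.min b x).

Lemma clamp_id (a b x : R) : a <= x -> x <= b -> clamp a b x = x.
Proof. by move=> ax xb; rewrite /clamp min_r// max_r. Qed.

Lemma clamp_itv (a b x : R) : a <= b -> a <= clamp a b x <= b.
Proof.
move=> ab; rewrite /clamp le_max lexx/= ge_max ab/=.
by rewrite ge_min lexx.
Qed.

Lemma clamp_nd (a b x y : R) : x <= y -> clamp a b x <= clamp a b y.
Proof.
move=> xy; rewrite /clamp ge_max !le_max lexx/=.
by apply/orP; right; rewrite le_min !ge_min lexx xy/= orbT.
Qed.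

Lemma clamp_dist (a b x y : R) : x <= y -> clamp a b y - clamp a b x <= y - x.
Proof.
move=> xy; rewrite /clamp.
case: (leP b x) => bx; case: (leP b y) => by_; last 3 first.
- by case: (leP a b) => ab; case: (leP a y) => ay; lra.
- by case: (leP a b) => ab; case: (leP a x) => ax; lra.
- by case: (leP a x) => ax; case: (leP a y) => ay; lra.
- by case: (leP a b) => ab; lra.
Qed.

Lemma sep_sym p q : sep p q = sep q p.
Proof. by rewrite /sep orbC. Qed.

Lemma abs_cont_clamp (a b : R) f : a <= b -> abs_cont a b f ->
  abs_cont_seq (f \o clamp a b).
Proof.
move=> ab acf e e0; have [d d0 H] := acf e e0; exists d => // L oL sL lL.
pose s (i : 'I_(size L)) := clamp a b (nth (0, 0) L i).1.
pose t (i : 'I_(size L)) := clamp a b (nth (0, 0) L i).2.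
have oLi (i : 'I_(size L)) : (nth (0, 0) L i).1 <= (nth (0, 0) L i).2.
  by move/(all_nthP (0, 0)) : oL; exact.
have /H {}H : forall i, [/\ a <= s i, s i <= t i & t i <= b].
  move=> i; rewrite /s /t clamp_nd//.
  by case/andP: (@clamp_itv a b (nth (0, 0) L i).1 ab) => -> _;
     case/andP: (@clamp_itv a b (nth (0, 0) L i).2 ab) => _ ->.
have /H {}H : trivIset setT (fun i => `]s i, t i[%classic).
  apply/trivIsetP => i j _ _ ij.
  have sij : sep (nth (0, 0) L i) (nth (0, 0) L j).
    move/(pairwiseP (0,0)) : sL => sL.
    move: ij; rewrite neq_ltn => /orP[ij|ji].
      by apply: sL => //; rewrite inE ltn_ord.
    by rewrite sep_sym; apply: sL => //; rewrite inE ltn_ord.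
  rewrite -subset0 => x []/=; rewrite !in_itv/= => /andP[ix xi] /andP[jx xj].
  case/orP: sij => /(@clamp_nd a b); rewrite -/(s _) -/(t _) -/(s _) => h.
    by have := lt_trans (lt_le_trans xi h) jx; rewrite ltxx.
  by have := lt_trans (lt_le_trans xj h) ix; rewrite ltxx.
rewrite /osc (big_nth (0, 0)) big_mkord; apply/ltW/H.
apply: le_lt_trans lL; rewrite /len (big_nth (0, 0)) big_mkord.
by apply: ler_sum => i _; exact: clamp_dist.
Qed.

Fixpoint gaps (x : R) (l : seq R) : seq (R * R) :=
  if l is y :: l' then (x, y) :: gaps y l' else [::].

Lemma gaps_ord x l : path <%O x l -> ord (gaps x l).
Proof. by elim: l x => //= y l IH x /andP[/ltW -> /IH]. Qed.

Lemma gaps_ge x l : path <%O x l -> all (fun p => x <= p.1) (gaps x l).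
Proof.
elim: l x => //= y l IH x /andP[xy /IH]; rewrite lexx/=.
by apply: sub_all => p; apply: le_trans; exact: ltW.
Qed.

Lemma path_last_ge (x : R) l : path <%O x l -> x <= last x l.
Proof. by elim: l x => //= y l IH x /andP[xy /IH]; apply: le_trans; exact: ltW. Qed.

Lemma gaps_le x l : path <%O x l -> all (fun p => p.2 <= last x l) (gaps x l).
Proof. by elim: l x => //= y l IH x /andP[xy pl]; rewrite path_last_ge//= IH. Qed.

Lemma gaps_sep x l : path <%O x l -> pairwise sep (gaps x l).
Proof.
elim: l x => //= y l IH x /andP[xy pl]; rewrite IH// andbT.
by apply: sub_all (gaps_ge pl) => p yp; rewrite /sep/= yp.
Qed.

Lemma gaps_len x l : len (gaps x l) = last x l - x.
Proof.
rewrite /len; elim: l x => [x|y l IH x]/=; first by rewrite big_nil subrr.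
by rewrite big_cons IH/=; lra.
Qed.

Lemma gaps_osc f x b l : osc f (gaps x l) = variation x b f l.
Proof.
rewrite /osc; elim: l x => [x|y l IH x]/=.
  by rewrite big_nil /variation big_nil.
rewrite big_cons IH /variation/= big_nat_recl//=.
Qed.

Lemma all_sep_gaps x l (q : R * R) : path <%O x l ->
  sep (x, last x l) q -> all (sep q) (gaps x l).
Proof.
move=> pl; rewrite /sep/= => /orP[h|h].
  apply: sub_all (gaps_le pl) => p h2.
  by rewrite (le_trans h2 h) orbT.
by apply: sub_all (gaps_ge pl) => p h2; rewrite (le_trans h h2).
Qed.

Lemma osc_ge0 f L : 0 <= osc f L.
Proof. exact: sumr_ge0. Qed.

Lemma osc_cat f L M : osc f (L ++ M) = osc f L + osc f M.
Proof. by rewrite /osc big_cat. Qed.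

Lemma len_cat L M : len (L ++ M) = len L + len M.
Proof. by rewrite /len big_cat. Qed.

(** The intervals of M are treated one at a time: cutting the first one along a
    partition keeps the list separated and its length unchanged, so the induction
    hypothesis bounds the variation along every partition, hence the supremum. *)
Lemma TV_osc f e d : (forall L, ord L -> pairwise sep L -> len L < d -> osc f L <= e) ->
  forall M L, ord (M ++ L) -> pairwise sep (M ++ L) -> len (M ++ L) < d ->
  (\sum_(p <- M) total_variation p.1 p.2 f + (osc f L)%:E <= e%:E)%E.
Proof.
move=> H; elim=> [|[s t] M IH] L.
  by move=> oL sL lL; rewrite big_nil add0e lee_fin H.
rewrite /= => /andP[st oML] /andP[aML sML].
rewrite -cat1s len_cat {1}/len big_seq1/= => lML.
rewrite big_cons/=.
have lML' : len (M ++ L) < d by apply: le_lt_trans lML; rewrite lerDr subr_ge0.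
have IH0 := IH L oML sML lML'.
have TVge0 (N : seq (R * R)) : ord N -> (0 <= \sum_(p <- N) total_variation p.1 p.2 f)%E.
  move=> /allP oN; rewrite big_seq; apply: sume_ge0 => p pN.
  exact/total_variation_ge0/oN.
have oM : ord M by move: oML; rewrite /ord all_cat => /andP[].
set X := (\sum_(p <- M) total_variation p.1 p.2 f)%E in IH0 *.
have X0 : (0 <= X)%E by exact: TVge0.
rewrite -addeA.
have XL0 : (0 <= X + (osc f L)%:E)%E by rewrite adde_ge0// lee_fin osc_ge0.
have XLfin : (X + (osc f L)%:E)%E \is a fin_num.
  by rewrite ge0_fin_numE// (le_lt_trans IH0)// ltry.
rewrite -leeBrDr//.
apply: ge_ereal_sup => _ [_ [l stl] <- <-]/=.
rewrite leeBrDr//.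
case: stl => pl /eqP ll.
have := IH (gaps s l ++ L).
rewrite -(gaps_osc f s t l) osc_cat EFinD addeCA; apply.
- move: oML; rewrite /ord !all_cat => /andP[-> ->]/=; rewrite andbT.
  exact: gaps_ord.
- move: sML; rewrite !pairwise_cat => /and3P[ML -> ->]; rewrite gaps_sep// !andbT.
  rewrite allrel_catr ML andbT; move: aML; rewrite all_cat => /andP[sM sL].
  apply/andP; split.
    apply/allrelP => p q pM.
    have sp : sep (s, last s l) p by rewrite ll; move/allP: sM; exact.
    by have /allP := all_sep_gaps pl sp; exact.
  apply/allrelP => p q pM qL; rewrite sep_sym.
  have sq : sep (s, last s l) q by rewrite ll; move/allP: sL; exact.
  by have /allP := all_sep_gaps pl sq; exact.
- rewrite !len_cat gaps_len ll; move: lML; rewrite len_cat; lra.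
Qed.

(** The total variation inherits absolute continuity; this reduces everything to
    nondecreasing functions. *)
Lemma abs_cont_TV f : abs_cont_seq f -> forall e : R, 0 < e -> exists2 d : R, 0 < d &
  forall L, ord L -> pairwise sep L -> len L < d ->
  (\sum_(p <- L) total_variation p.1 p.2 f <= e%:E)%E.
Proof.
move=> acf e e0; have [d d0 H] := acf e e0; exists d => // L oL sL lL.
have := @TV_osc f e d H L [::]; rewrite cats0 => /(_ oL sL lL).
by rewrite /osc big_nil adde0.
Qed.

(** Walk from a to b in steps of length d / 2, on each of which the variation is
    at most 1. *)
Lemma abs_cont_BV f a b : abs_cont_seq f -> a <= b -> bounded_variation a b f.
Proof.
move=> acf ab; have [d d0 H] := abs_cont_TV acf ltr01.
have Hd x y : x <= y -> y < x + d -> (total_variation x y f <= 1%:E)%E.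
  move=> xy yxd; have := H [:: (x, y)]; rewrite big_seq1/=; apply => //.
    by rewrite /ord/= xy.
  by rewrite /len big_seq1/= ltrBlDl.
have Hk (k : nat) : forall x, a <= x -> x < a + (d / 2) *+ k -> (total_variation a x f <= k%:R%:E)%E.
  elim: k => [|k IH] x ax; first by rewrite mulr0n addr0 => /lt_le_trans/(_ ax); rewrite ltxx.
  move=> xk; have [xk2|xk2] := ltP x (a + (d / 2) *+ k).
    by rewrite (le_trans (IH x ax xk2))// lee_fin ler_nat.
  pose y := Num.max a (x - d / 2).
  have ay : a <= y by rewrite le_max lexx.
  have yx : y <= x by rewrite ge_max ax lerBlDr lerDl divr_ge0// ltW.
  rewrite (total_variationD f ay yx) -addn1 natrD EFinD leeD//.
    have [yk|] := ltP y (a + (d / 2) *+ k); first exact: IH.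
    rewrite /y; case: (leP a (x - d / 2)) => axd yk.
      by move: xk; rewrite mulrS addrCA; move: (a + d / 2 *+ k) yk => u; clear; move=> yk xk; exfalso; lra.
    by rewrite total_variationxx lee_fin.
  apply: Hd => //.
  by rewrite /y; case: (leP a (x - d / 2)); lra.
apply/(bounded_variationP f ab); rewrite ge0_fin_numE ?total_variation_ge0//.
apply: (@le_lt_trans _ _ ((Num.bound ((b - a) / (d / 2)))%:R%:E)); last exact: ltry.
apply: Hk => //.
have := @archi_boundP _ ((b - a) / (d / 2)).
rewrite divr_ge0// ?subr_ge0// ?divr_ge0// ?(ltW d0)// => /(_ isT).
rewrite ltr_pdivrMr// ?divr_gt0// mulr_natl; lra.
Qed.

Lemma abs_cont_seq_continuous f : abs_cont_seq f -> continuous f.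
Proof.
move=> acf x; apply/cvgrPdist_le => /= e e0.
have [d d0 H] := acf e e0.
have Hxy u v : u <= v -> v < u + d -> `|f v - f u| <= e.
  move=> uv vud; have := H [:: (u, v)].
  by rewrite /ord/= uv /len big_seq1/= /osc big_seq1/= ltrBlDl; exact.
exists d => //= y; rewrite /ball/= => xyd.
have [xy|yx] := leP x y.
  rewrite distrC; apply: Hxy => //; rewrite -ltrBlDl.
  by move: xyd; rewrite distrC ger0_norm// subr_ge0.
by apply: Hxy; [exact: ltW|rewrite -ltrBlDl; move: xyd; rewrite gtr0_norm// subr_gt0].
Qed.

Lemma nondecreasing_cumulative f : {homo f : x y / x <= y} -> continuous f ->
  exists F : cumulative R R, F = f :> (R -> R).
Proof.
move=> nf cf.
have rcf : right_continuous f by exact: right_continuousW.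
pose F : cumulative R R := HB.pack f (isCumulative.Build R _ R f nf rcf).
by exists F.
Qed.

Lemma stieltjes_itv_oc (F : cumulative R R) (s t : R) : s <= t ->
  lebesgue_stieltjes_measure F `]s, t]%classic = (F t - F s)%:E.
Proof.
move=> st; rewrite /lebesgue_stieltjes_measure/= /measure_extension/=.
rewrite measurable_mu_extE/=; last exact: is_ocitv.
by rewrite wlength_itv_bnd.
Qed.

(** The endpoints of a component of an open set, where the function on the
    component is compared with its values. *)
Lemma lebesgue_open_itv (I : set R) : open I -> is_interval I -> (mu I < +oo)%E ->
  I !=set0 -> exists s t, [/\ s < t, `]s, t[ `<=` I, I `<=` `]s, t] & mu I = (t - s)%:E].
Proof.
move=> oI iI fI [z Iz].
have mI : measurable I by exact: open_measurable.
have IE : I = [set` Rhull I] by rewrite RhullK// inE.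
have muI0 : (0 < mu I)%E.
  have [e /= e0 H] : nbhs z I by move: oI; rewrite openE; apply.
  have le : (mu (ball z e) <= mu I)%E.
    by apply: le_measure; rewrite ?inE//; exact: measurable_ball.
  apply: lt_le_trans le.
  by rewrite lebesgue_measure_ball ?ltW// lte_fin pmulrn_lgt0.
move: fI muI0; rewrite IE; move: (Rhull I) IE => -[b1 b2] IE.
rewrite lebesgue_measure_itv/=.
case: ifPn => [b12|_ _]; last by rewrite ltxx.
move: b1 b2 b12 IE => [b1 s|[]] [b2 t|[]] //= b12 IE _ _.
rewrite lte_fin in b12.
exists s, t; split => //.
- by move=> x; rewrite /= in_itv/= => /andP[sx xt]; rewrite in_itv;
     apply/andP; split; [case: b1 {IE}|case: b2 {IE}] => //=; rewrite ?ltW.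
- move=> x xI; have xs : x != s.
    apply/eqP => xs; have : nbhs x I by move: oI; rewrite openE; apply; rewrite IE.
    move=> [e /= e0 H].
    have : I (s - e / 2).
      apply: H; rewrite /ball/= xs opprB addrC subrK gtr0_norm; lra.
    rewrite IE /= in_itv => /andP[+ _]; case: (b1) => /=; lra.
  move: xI; rewrite /= !in_itv => /andP[xs1 xs2]; apply/andP; split=> /=.
    by rewrite lt_neqAle eq_sym xs/=; case: b1 xs1 {IE} => //=; exact: ltW.
  by case: b2 xs2 {IE} => //=; exact: ltW.
Qed.

(** By outer regularity a null set lies in an open set of small measure. That set
    is a countable disjoint union of intervals, and absolute continuity bounds the
    Stieltjes measure of every finite part of the union. *)
Lemma stieltjes_dominates (F : cumulative R R) : abs_cont_seq F ->
  lebesgue_stieltjes_measure F `<< mu.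
Proof.
move=> acF; apply/null_content_dominatesP => A mA muA0.
apply/eqP; rewrite eq_le measure_ge0 andbT; apply/lee_addgt0Pr => e e0.
rewrite add0e.
have [d d0 H] := acF e e0.
have d20 : 0 < d / 2 by rewrite divr_gt0.
have [U [oU AU muU]] := @lebesgue_regularity_outer R A (d/2) mA ltac:(by rewrite muA0 ltry) d20.
have mU : measurable U by exact: open_measurable.
have {}muU : (mu U < d%:E)%E.
  rewrite -(setDUK AU) measureU//; last 2 first.
  - exact: measurableD.
  - by rewrite setDE setICA setICr setI0.
  by rewrite muA0 add0e (lt_trans muU)// lte_fin ltr_pdivrMr// ltr_pMr// ltr1n.
pose I := open_disjoint_itv oU.
have mI n : measurable (I n) by apply: open_measurable; exact: open_disjoint_itv_open.
have tI := @open_disjoint_itv_trivIset _ _ oU.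
rewrite -/I in tI.
have UE : U = \bigcup_n I n by exact: open_disjoint_itv_bigcup.
apply: (@le_trans _ _ (lebesgue_stieltjes_measure F U)).
  by apply: le_measure => //; rewrite inE.
rewrite UE measure_semi_bigcup//; last by rewrite -UE.
apply: lime_le; first exact: is_cvg_nneseries.
near=> N.
rewrite big_mkord.
have muN : (\sum_(n < N) mu (I n) < d%:E)%E.
  apply: le_lt_trans muU; rewrite -(measure_semi_additive (s:=mu) I N mI tI)//=.
  - apply: le_measure; rewrite ?inE//; last by rewrite UE; exact: bigsetU_bigcup.
    by apply: bigsetU_measurable => i _; exact: mI.
  - by apply: bigsetU_measurable => i _; exact: mI.
have fI n : (mu (I n) < +oo)%E.
  apply: (@le_lt_trans _ _ (mu U)); last by rewrite (lt_trans muU)// ltry.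
  by apply: le_measure; rewrite ?inE; [exact: mI|exact: mU|rewrite UE; exact: bigcup_sup].
have /choice[st stP] : forall n, exists st : R * R, I n !=set0 ->
    [/\ st.1 < st.2, `]st.1, st.2[ `<=` I n, I n `<=` `]st.1, st.2]
     & mu (I n) = (st.2 - st.1)%:E].
  move=> n.
  have [I0|/set0P/negP/negPn/eqP I0] := pselect (I n !=set0).
    have [s [t stP]] := lebesgue_open_itv (@open_disjoint_itv_open _ _ oU n)
      (@open_disjoint_itv_is_interval _ _ oU n) (fI n) I0.
    by exists (s, t).
  by exists (0, 0) => -[x]; rewrite I0.
pose s := [seq n <- iota 0 N | `[< I n !=set0 >]].
have sumE (nu : {measure set (measurableTypeR R) -> \bar R}) :
  (\sum_(n < N) nu (I n) = \sum_(n <- s) nu (I n))%E.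
  rewrite big_filter -(big_mkord xpredT (fun n => nu (I n))).
  rewrite (bigID (fun n => `[< I n !=set0 >]))/= /index_iota subn0.
  rewrite [X in (_ + X)%E]big1 ?adde0// => n /asboolPn/set0P/negP/negPn/eqP ->.
  exact: measure0.
rewrite (sumE (lebesgue_stieltjes_measure F)).
have s0 n : n \in s -> I n !=set0.
  by rewrite mem_filter => /andP[/asboolP].
apply: (@le_trans _ _ (\sum_(n <- s) (F (st n).2 - F (st n).1)%:E)%E).
  rewrite big_seq [leRHS]big_seq; apply: lee_sum => n ns.
  have [st12 _ Ist _] := stP n (s0 n ns).
  rewrite -stieltjes_itv_oc; last exact: ltW.
  by apply: le_measure; rewrite ?inE//; exact: mI.
rewrite sumEFin lee_fin.
apply: le_trans (H (map st s) _ _ _).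
- rewrite /osc big_map; apply: ler_sum => n _; exact: ler_norm.
- rewrite /ord all_map; apply/allP => n ns /=.
  by have [/ltW] := stP n (s0 n ns).
- rewrite pairwise_map.
  have : uniq s by rewrite filter_uniq// iota_uniq.
  rewrite uniq_pairwise.
  have : {in s &, forall i j : nat, i != j -> relpre st sep i j}.
    move=> i j si sj ij; rewrite /sep/= !leNgt -negb_and; apply/negP => /andP[ij1 ij2].
    have [i1 i2 _ _] := stP i (s0 i si).
    have [j1 j2 _ _] := stP j (s0 j sj).
    move: (tI) => /trivIsetP/(_ i j Logic.I Logic.I ij); apply/eqP/set0P.
    pose u := Num.max (st i).1 (st j).1; pose v := Num.min (st i).2 (st j).2.
    have uv : u < v by rewrite gt_max !lt_min i1 j1 ij1 ij2.
    exists ((u + v) / 2); split; [apply: i2|apply: j2]; rewrite /= in_itv/=.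
      have : (st i).1 <= u by rewrite le_max lexx.
      have : v <= (st i).2 by rewrite ge_min lexx.
      lra.
    have : (st j).1 <= u by rewrite le_max lexx orbT.
    have : v <= (st j).2 by rewrite ge_min lexx orbT.
    lra.
  elim: (s) => //= n s' IH h /andP[ns us]; apply/andP; split; last first.
    by apply: IH => // i j si sj; apply: h; rewrite inE ?si ?sj orbT.
  apply/allP => m ms; apply: h; rewrite ?inE ?eqxx ?ms ?orbT//.
  by move/allP: ns; apply.
- rewrite /len big_map -lte_fin -sumEFin; apply: le_lt_trans muN.
  rewrite (sumE mu) big_seq [leRHS]big_seq le_eqVlt; apply/orP; left; apply/eqP.
  by apply: eq_bigr => n ns; have [_ _ _ <-] := stP n (s0 n ns).
Unshelve. all: by end_near. Qed.

(** The Radon-Nikodym derivative of the Stieltjes measure restricted to ]a, b]. *)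
Lemma nondecreasing_density f (a b : R) : a <= b -> {homo f : x y / x <= y} ->
  abs_cont_seq f -> exists2 rho : R -> R, mu.-integrable setT (EFin \o rho) &
  forall x, a <= x <= b -> f x - f a = \int[mu]_(t in `]a, x]) rho t.
Proof.
move=> ab nf acf.
have [F FE] := nondecreasing_cumulative nf (abs_cont_seq_continuous acf).
have acF : abs_cont_seq F by rewrite FE.
pose nu0 := lebesgue_stieltjes_measure F.
have mab : measurable (`]a, b] : set (measurableTypeR R)) by exact: measurable_itv.
have nuoo : (nu0 `]a, b]%classic < +oo)%E by rewrite /nu0 stieltjes_itv_oc// ltry.
pose nu : {finite_measure set (measurableTypeR R) -> \bar R} := mfrestr mab nuoo.
have numu : nu `<< mu.
  apply/null_content_dominatesP => A mA muA0; rewrite /nu/= /mfrestr/= /mrestr.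
  have /null_content_dominatesP/(_ (A `&` `]a, b]%classic)) := stieltjes_dominates acF.
  apply; first exact: measurableI.
  apply/eqP; rewrite eq_le measure_ge0 andbT -muA0.
  by apply: le_measure; rewrite ?inE//; exact: measurableI.
pose h := Radon_Nikodym_SigmaFinite.f nu mu.
have hfin := Radon_Nikodym_SigmaFinite.f_fin_num numu.
exists (fine \o h).
  have := Radon_Nikodym_SigmaFinite.f_integrable numu.
  by apply: eq_integrable => // x _ /=; rewrite fineK.
move=> x /andP[ax xb].
have := @Radon_Nikodym_SigmaFinite.f_integral _ _ _ nu mu numu `]a, x]%classic (measurable_itv _).
have -> : nu `]a, x]%classic = nu0 (`]a, x]%classic `&` `]a, b]%classic) by [].
rewrite setIidl; last first.
  by apply: subset_itvl; rewrite bnd_simp.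
rewrite /nu0 stieltjes_itv_oc// FE => h1; apply: EFin_inj; rewrite h1.
rewrite /Rintegral fineK; last first.
  rewrite -/h; apply: integrable_fin_num => //.
  apply: (integrableS measurableT) => //.
  have := Radon_Nikodym_SigmaFinite.f_integrable numu.
  by apply: eq_integrable => // t _ /=; rewrite fineK.
by apply: eq_integral => t _ /=; rewrite fineK.
Qed.

(** With V the total variation, f = V - (V - f) is a difference of nondecreasing
    absolutely continuous functions. *)
Lemma abs_cont_density f (a b : R) : a <= b -> abs_cont a b f ->
  exists2 rho : R -> R, mu.-integrable setT (EFin \o rho) &
  forall x, a <= x <= b -> f x - f a = \int[mu]_(t in `]a, x]) rho t.
Proof.
move=> ab acf.
have acfc := abs_cont_clamp ab acf.
set fc := f \o clamp a b in acfc.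
have TVfin x y : x <= y -> total_variation x y fc \is a fin_num.
  by move=> xy; apply/bounded_variationP => //; exact: abs_cont_BV.
pose V x := fine (total_variation a (clamp a b x) fc).
have ca x : a <= clamp a b x by case/andP: (clamp_itv x ab).
have VD x y : x <= y -> V y - V x = fine (total_variation (clamp a b x) (clamp a b y) fc).
  move=> xy; rewrite /V (total_variationD _ (ca x) (clamp_nd a b xy)).
  by rewrite fineD ?TVfin ?clamp_nd// addrC addKr.
have ndV : {homo V : x y / x <= y}.
  move=> x y xy; rewrite -subr_ge0 VD// fine_ge0// total_variation_ge0//.
  exact: clamp_nd.
have fcc x : fc (clamp a b x) = fc x.
  by rewrite /fc/= clamp_id//; case/andP: (clamp_itv x ab).
pose V2 x := V x - fc x.
have ndV2 : {homo V2 : x y / x <= y}.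
  move=> x y xy; rewrite -subr_ge0.
  have := total_variation_ge fc (clamp_nd a b xy).
  rewrite -(fineK (TVfin _ _ (clamp_nd a b xy))) lee_fin -VD// !fcc.
  by rewrite /V2 => /(le_trans (ler_norm _)); lra.
have acV : abs_cont_seq V.
  move=> e e0; have [d d0 H] := abs_cont_TV acfc e0; exists d => // L oL sL lL.
  pose c (p : R * R) := (clamp a b p.1, clamp a b p.2).
  have := H (map c L); rewrite big_map => /(_ _ _ _).
  have -> : (\sum_(p <- L) total_variation (c p).1 (c p).2 fc)%E = (osc V L)%:E.
    rewrite /osc -sumEFin big_seq [RHS]big_seq; apply: eq_bigr => p pL.
    have p12 : p.1 <= p.2 by move/allP : oL; exact.
    rewrite ger0_norm ?subr_ge0 ?ndV// VD// fineK// TVfin//.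
    exact: clamp_nd.
  rewrite lee_fin; apply.
  - rewrite /ord all_map; apply: sub_all oL => p /= p12; exact: clamp_nd.
  - rewrite pairwise_map; apply: sub_pairwise sL => p q /=; rewrite /sep/=.
    by move=> /orP[h|h]; rewrite (clamp_nd a b h) ?orbT.
  - apply: le_lt_trans lL; rewrite /len big_map big_seq [leRHS]big_seq.
    by apply: ler_sum => p pL; apply: clamp_dist; move/allP : oL; exact.
have acV2 : abs_cont_seq V2.
  move=> e e0; have e20 : 0 < e / 2 by rewrite divr_gt0.
  have [d d0 H] := acfc _ e20; have [d' d0' H'] := acV _ e20.
  exists (Num.min d d'); first by rewrite lt_min d0.
  move=> L oL sL; rewrite lt_min => /andP[Ld Ld'].
  have := lerD (H L oL sL Ld) (H' L oL sL Ld'); rewrite -splitr.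
  apply: le_trans; rewrite /osc -big_split/=; apply: ler_sum => p _.
  rewrite /V2.
  have -> : V p.2 - fc p.2 - (V p.1 - fc p.1) = (V p.2 - V p.1) - (fc p.2 - fc p.1) by ring.
  rewrite (le_trans (ler_normB _ _))// addrC; exact: lexx.
have [r1 ir1 r1E] := nondecreasing_density ab ndV acV.
have [r2 ir2 r2E] := nondecreasing_density ab ndV2 acV2.
exists (fun x => r1 x - r2 x).
  have := integrableB measurableT ir1 ir2.
  by apply: eq_integrable => // x _; rewrite /= EFinB.
move=> x /andP[ax xb].
rewrite RintegralB//; [|exact: (integrableS measurableT)..].
rewrite -r1E ?ax// -r2E ?ax// /V2 /fc/= !clamp_id//.
ring.
Qed.

(** Lebesgue's form of the fundamental theorem of calculus; the last clause is
    Lebesgue's differentiation theorem for the density. *)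
Theorem abs_cont_FTC f (a b : R) : a <= b -> abs_cont a b f ->
  exists rho : R -> R, [/\ mu.-integrable `[a, b] (EFin \o rho),
    forall x, a <= x <= b -> f x - f a = \int[mu]_(t in `[a, x]) rho t &
    {ae mu, forall x, a < x < b -> is_derive x 1 f (rho x)}].
Proof.
move=> ab acf; have [rho irho rhoE] := abs_cont_density ab acf.
have irhoS (A : set R) : measurable A -> mu.-integrable A (EFin \o rho).
  by move=> mA; apply: (integrableS measurableT).
have rhoE' x : a <= x <= b -> f x - f a = \int[mu]_(t in `[a, x]) rho t.
  move=> axb; rewrite rhoE// -Rintegral_itv_obnd_cbnd//.
  exact: irhoS.
exists rho; split => //; first exact: irhoS.
have locrho : locally_integrable setT rho by exact: open_integrable_locally openT irho.
have := @FTC1 R rho (BLeft a) (fun y => irhoS _ (measurable_itv _)) locrho.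
apply: filterS; first exact: (ae_filter_ringOfSetsType mu).
move=> x /= H /andP[ax xb].
have {H} [] := H _; first by rewrite lte_fin.
set G := (fun _ => _) => dG GE.
have fG : \forall y \near x, f y = f a + G y.
  near=> y; have : a <= y <= b.
    by apply/andP; split; apply/ltW; near: y; [exact: lt_nbhsr|exact: lt_nbhsl].
  by move=> /rhoE' h; rewrite /G -h addrC subrK.
clearbody G.
have h : is_derive x 1 G (rho x) by split => //; rewrite -derive1E.
have := is_deriveD (is_derive_cst (f a) x 1) h; rewrite add0r.
by apply: near_eq_is_derive; apply: filterS fG => y ->.
Unshelve. all: by end_near. Qed.

(** Where f is not derivable, derive1 f is a default value; hence the guarded
    hypothesis, which is the form in which second derivatives occur below. *)
Corollary abs_cont_FTC_ae f k (a b : R) : a <= b -> abs_cont a b f ->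
  mu.-integrable `[a, b] (EFin \o k) ->
  {ae mu, forall x, a < x < b -> derivable f x 1 -> derive1 f x = k x} ->
  f b - f a = \int[mu]_(t in `[a, b]) k t.
Proof.
move=> ab /(abs_cont_FTC ab)[rho [irho rhoE drho]] ik kE.
have oo h : mu.-integrable `[a, b] (EFin \o h) ->
    \int[mu]_(t in `[a, b]) h t = \int[mu]_(t in `]a, b[) h t.
  move=> ih; rewrite -Rintegral_itv_bndo_bndc; last first.
    by apply: integrableS ih => //; itv_sub.
  rewrite -Rintegral_itv_obnd_cbnd//.
  by apply: integrableS ih => //; itv_sub.
have mm g : mu.-integrable `[a, b] (EFin \o g) -> measurable_fun `]a, b[ (EFin \o g).
  by case/integrableP => + _; apply: measurable_funS => //; itv_sub.
rewrite rhoE ?lexx ?ab// !oo// /Rintegral; congr fine.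
apply: ae_eq_integral => //; [exact: mm|exact: mm|].
move: drho kE; apply: filterS2; first exact: (ae_filter_ringOfSetsType mu).
move=> x h1 h2; rewrite /= in_itv/= => axb; congr EFin.
have d1 := h1 axb; rewrite -(h2 axb); last exact: ex_derive.
by rewrite derive1E derive_val.
Qed.
End abs_cont_FTC.

(** * Integrals and weighted square integrable functions on the half-line *)

Section L2real.
Context {R : realType}.
Notation mu := (@lebesgue_measure R).
Notation D := (`]0%R, +oo[%classic : set R).

Implicit Types f g h : R -> R.

Definition intD (f : R -> R) : Prop := mu.-integrable D (EFin \o f).
Notation "'I' f" := (\int[mu]_(x in D) (f : R -> R) x) (at level 10, f at level 8).

(** Stated over measurableTypeR, the structure for which the Lebesgue measure is
    declared; the unannotated statement is only convertible to it. *)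
Lemma measD : measurable (D : set (measurableTypeR R)). Proof. exact: measurable_itv. Qed.
Hint Resolve measD : core.

Lemma inD (x : R) : D x <-> 0 < x.
Proof. by rewrite /= in_itv/= andbT. Qed.

Lemma intD_meas f : intD f -> measurable_fun D f.
Proof. by case/integrableP => /measurable_EFinP. Qed.

Lemma intD_eq f g : (forall x, 0 < x -> f x = g x) -> intD f -> intD g.
Proof.
move=> fg; apply: eq_integrable => // x; rewrite inE => /inD x0 /=.
by rewrite fg.
Qed.

Lemma I_eq f g : (forall x, 0 < x -> f x = g x) -> I f = I g.
Proof. by move=> fg; apply: eq_Rintegral => x; rewrite inE => /inD/fg. Qed.

Lemma intD_add f g : intD f -> intD g -> intD (fun x => f x + g x).
Proof.
move=> fi gi; have := integrableD measD fi gi.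
by apply: eq_integrable => // x _; rewrite /= EFinD.
Qed.

Lemma intD_sub f g : intD f -> intD g -> intD (fun x => f x - g x).
Proof.
move=> fi gi; have := integrableB measD fi gi.
by apply: eq_integrable => // x _; rewrite /= EFinB.
Qed.

Lemma intD_scale c f : intD f -> intD (fun x => c * f x).
Proof.
move=> fi; have := @integrableZl _ _ _ mu D measD c _ fi.
by apply: eq_integrable => // x _; rewrite /= EFinM.
Qed.

Lemma intD0 : intD (fun=> 0). Proof. exact: integrable0. Qed.

Lemma intD_le f g : measurable_fun D f -> (forall x, 0 < x -> `|f x| <= g x) ->
  intD g -> intD f.
Proof.
move=> mf fg gi; apply: le_integrable gi => //; first exact/measurable_EFinP.
by move=> x /inD x0 /=; rewrite lee_fin (le_trans (fg x x0))// ler_norm.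
Qed.

Lemma I_add f g : intD f -> intD g -> I (fun x => f x + g x) = I f + I g.
Proof. by move=> fi gi; rewrite RintegralD. Qed.

Lemma I_sub f g : intD f -> intD g -> I (fun x => f x - g x) = I f - I g.
Proof. by move=> fi gi; rewrite RintegralB. Qed.

Lemma I_scale c f : intD f -> I (fun x => c * f x) = c * I f.
Proof. by move=> fi; rewrite RintegralZl. Qed.

Lemma I0 : I (fun=> 0) = 0.
Proof. by rewrite /Rintegral integral0. Qed.

Lemma I_ge0 f : (forall x, 0 < x -> 0 <= f x) -> 0 <= I f.
Proof. by move=> f0; apply: Rintegral_ge0 => x /inD/f0. Qed.

Lemma I_le f g : intD f -> intD g -> (forall x, 0 < x -> f x <= g x) -> I f <= I g.
Proof. by move=> fi gi fg; apply: le_Rintegral => // x /inD/fg. Qed.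

Lemma IE f : intD f -> (\int[mu]_(x in D) (f x)%:E)%E = (I f)%:E.
Proof. by move=> fi; rewrite /Rintegral fineK//; exact: integrable_fin_num. Qed.

Lemma intD_ge0 f : measurable_fun D f -> (forall x, 0 < x -> 0 <= f x) ->
  (\int[mu]_(x in D) (f x)%:E < +oo)%E -> intD f.
Proof.
move=> mf f0 fi; apply/integrableP; split; first exact/measurable_EFinP.
move: fi; congr (_ < _)%E; apply: eq_integral => x; rewrite inE => /inD/f0 fx.
by rewrite /= ger0_norm.
Qed.

Definition aeD (P : R -> Prop) : Prop := {ae mu, forall x, 0 < x -> P x}.

Lemma aeD_filter (P Q : R -> Prop) : (forall x, 0 < x -> P x -> Q x) -> aeD P -> aeD Q.
Proof.
move=> PQ; rewrite /aeD; apply: filterS; first exact: (ae_filter_ringOfSetsType mu).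
by move=> x h x0; apply: PQ => //; exact: h.
Qed.

Lemma aeD_filter2 (P Q S : R -> Prop) : (forall x, 0 < x -> P x -> Q x -> S x) ->
  aeD P -> aeD Q -> aeD S.
Proof.
move=> PQ; rewrite /aeD; apply: filterS2; first exact: (ae_filter_ringOfSetsType mu).
by move=> x h h' x0; apply: PQ => //; [exact: h|exact: h'].
Qed.

Lemma aeD_all (P : R -> Prop) : (forall x, 0 < x -> P x) -> aeD P.
Proof. by move=> h; apply: aeW => x x0; exact: h. Qed.

Lemma aeD_ae_eq (F G : R -> \bar R) : aeD (fun x => F x = G x) -> ae_eq mu D F G.
Proof.
move=> [N [mN N0 NH]]; exists N; split=> // x /= h; apply: NH => /= h2.
by apply: h => /inD; exact: h2.
Qed.

Lemma ae_eq_aeD (F G : R -> \bar R) : ae_eq mu D F G -> aeD (fun x => F x = G x).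
Proof.
move=> [N [mN N0 NH]]; exists N; split=> // x /= h; apply: NH => /= h2.
by apply: h => /inD; exact: h2.
Qed.

Lemma I_ae f g : measurable_fun D f -> measurable_fun D g ->
  aeD (fun x => f x = g x) -> I f = I g.
Proof.
move=> mf mg fg; rewrite /Rintegral; congr fine.
apply: ae_eq_integral => //; [exact/measurable_EFinP|exact/measurable_EFinP|].
by apply: aeD_ae_eq; apply: aeD_filter fg => x _ /= ->.
Qed.

Lemma intD_ae f g : measurable_fun D g ->
  aeD (fun x => f x = g x) -> intD f -> intD g.
Proof.
move=> mg fg fi; apply/integrableP; split; first exact/measurable_EFinP.
have /integrableP[mf] := fi; congr (_ < _)%E; apply: ae_eq_integral => //.
- exact: measurableT_comp.
- by apply: measurableT_comp => //; exact/measurable_EFinP.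
- by apply: aeD_ae_eq; apply: aeD_filter fg => x _ /= ->.
Qed.

Lemma I_eq0_ae f : measurable_fun D f -> (forall x, 0 < x -> 0 <= f x) -> intD f ->
  I f = 0 -> aeD (fun x => f x = 0).
Proof.
move=> mf f0 fi If0.
have : ae_eq mu D (EFin \o f) (cst 0%E).
  apply: (ae_eq_integral_abs mu measD _).1; first exact/measurable_EFinP.
  transitivity (\int[mu]_(x in D) (f x)%:E)%E; last by rewrite IE// If0.
  apply: eq_integral => x; rewrite inE => /inD/f0 fx /=.
  by rewrite ger0_norm.
by move=> /ae_eq_aeD; apply: aeD_filter => x _ [].
Qed.

Section weighted.
Variable W : R -> R.
Hypothesis mW : measurable_fun D W.
Hypothesis W0 : forall x, 0 < x -> 0 < W x.

Definition L2r (f : R -> R) : Prop :=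
  measurable_fun D f /\ intD (fun x => f x ^+ 2 * W x).

Definition ip (f g : R -> R) : R := I (fun x => f x * g x * W x).

Lemma W_ge0 x : 0 < x -> 0 <= W x. Proof. by move=> /W0/ltW. Qed.

Lemma L2r_mul f g : L2r f -> L2r g -> intD (fun x => f x * g x * W x).
Proof.
move=> [mf f2] [mg g2].
apply: (@intD_le _ (fun x => f x ^+ 2 * W x + g x ^+ 2 * W x)).
- by apply: measurable_funM => //; exact: measurable_funM.
- move=> x x0; rewrite normrM (ger0_norm (W_ge0 x0)) -mulrDl.
  rewrite ler_wpM2r ?W_ge0// ler_norml.
  have := sqr_ge0 (f x + g x); have := sqr_ge0 (f x - g x).
  rewrite sqrrB sqrrD -mulr_natl => h1 h2; have := sqr_ge0 (f x); have := sqr_ge0 (g x).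
  by move=> h3 h4; apply/andP; split; lra.
- exact: intD_add.
Qed.

Lemma L2r_add f g : L2r f -> L2r g -> L2r (fun x => f x + g x).
Proof.
move=> Lf Lg; have [mf f2] := Lf; have [mg g2] := Lg; split.
  exact: measurable_funD.
have := intD_add (intD_add f2 g2) (intD_scale 2 (L2r_mul Lf Lg)).
by apply: intD_eq => x x0; ring.
Qed.

Lemma L2r_scale c f : L2r f -> L2r (fun x => c * f x).
Proof.
move=> [mf f2]; split; first exact: measurable_funM.
have := intD_scale (c ^+ 2) f2.
by apply: intD_eq => x x0; ring.
Qed.

Lemma L2r_ext f g : (forall x, 0 < x -> f x = g x) -> L2r f -> L2r g.
Proof.
move=> fg [mf f2]; split.
  by apply: eq_measurable_fun mf => x; rewrite inE => /inD/fg.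
by apply: intD_eq f2 => x /fg ->.
Qed.

Lemma L2r_sub f g : L2r f -> L2r g -> L2r (fun x => f x - g x).
Proof.
move=> Lf Lg; have := L2r_add Lf (L2r_scale (-1) Lg).
by apply: L2r_ext => x _; rewrite mulN1r.
Qed.

Lemma L2r0 : L2r (fun=> 0).
Proof. by split => //; apply: intD_eq intD0 => x _; rewrite expr0n mul0r. Qed.

Lemma L2r_sum (s : nat) (F : nat -> R -> R) : (forall n, L2r (F n)) ->
  L2r (fun x => \sum_(n < s) F n x).
Proof.
move=> LF; elim: s => [|s IH].
  by apply: L2r_ext L2r0 => x _; rewrite big_ord0.
by apply: L2r_ext (L2r_add IH (LF s)) => x _; rewrite big_ord_recr.
Qed.

Lemma ipC f g : ip f g = ip g f.
Proof. by apply: I_eq => x _; ring. Qed.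

Lemma ipDl f g h : L2r f -> L2r g -> L2r h ->
  ip (fun x => f x + g x) h = ip f h + ip g h.
Proof.
move=> Lf Lg Lh; rewrite -I_add; [|exact: L2r_mul..].
by apply: I_eq => x _; ring.
Qed.

Lemma ipZl c f g : L2r f -> L2r g -> ip (fun x => c * f x) g = c * ip f g.
Proof.
move=> Lf Lg; rewrite -I_scale; last exact: L2r_mul.
by apply: I_eq => x _; ring.
Qed.

Lemma ipBl f g h : L2r f -> L2r g -> L2r h ->
  ip (fun x => f x - g x) h = ip f h - ip g h.
Proof.
move=> Lf Lg Lh; rewrite -I_sub; [|exact: L2r_mul..].
by apply: I_eq => x _; ring.
Qed.

Lemma ip0l h : ip (fun=> 0) h = 0.
Proof. by rewrite -[RHS]I0; apply: I_eq => x _; ring. Qed.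

Lemma ip_ext f g h k : (forall x, 0 < x -> f x = h x) -> (forall x, 0 < x -> g x = k x) ->
  ip f g = ip h k.
Proof. by move=> fh gk; apply: I_eq => x x0; rewrite fh// gk. Qed.

Lemma ip_ae f g h : L2r f -> L2r g -> L2r h -> aeD (fun x => f x = g x) -> ip f h = ip g h.
Proof.
move=> Lf Lg Lh fg; apply: I_ae.
- by have /intD_meas := L2r_mul Lf Lh.
- by have /intD_meas := L2r_mul Lg Lh.
- by apply: aeD_filter fg => x _ ->.
Qed.

Lemma L2r_ae f g : measurable_fun D g -> aeD (fun x => f x = g x) -> L2r f -> L2r g.
Proof.
move=> mg fg [mf f2]; split => //; apply: intD_ae f2.
  by apply: measurable_funM => //; exact: measurable_funX.
by apply: aeD_filter fg => x _ ->.
Qed.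

Lemma ip_suml (s : nat) (F : nat -> R -> R) h : (forall n, L2r (F n)) -> L2r h ->
  ip (fun x => \sum_(n < s) F n x) h = \sum_(n < s) ip (F n) h.
Proof.
move=> LF Lh; elim: s => [|s IH].
  by rewrite [RHS]big_ord0 -[RHS](ip0l h); apply: ip_ext => x _ //; rewrite big_ord0.
rewrite big_ord_recr/= -IH -ipDl//; last exact: L2r_sum.
by apply: ip_ext => x _ //; rewrite big_ord_recr.
Qed.

Lemma nrm_ge0 f : 0 <= ip f f.
Proof. by apply: I_ge0 => x x0; rewrite -expr2 mulr_ge0 ?sqr_ge0 ?W_ge0. Qed.

Lemma ipE f : ip f f = I (fun x => f x ^+ 2 * W x).
Proof. by apply: I_eq => x _; rewrite expr2. Qed.

Lemma nrm_eq0 f : L2r f -> ip f f = 0 -> aeD (fun x => f x = 0).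
Proof.
move=> Lf; rewrite ipE => /I_eq0_ae h; have [mf f2] := Lf.
have {}h : aeD (fun x => f x ^+ 2 * W x = 0).
  apply: h => //; first by apply: intD_meas f2.
  by move=> x x0; rewrite mulr_ge0 ?sqr_ge0 ?W_ge0.
apply: aeD_filter h => x x0 /eqP; rewrite mulf_eq0 (gt_eqF (W0 x0)) orbF sqrf_eq0.
by move/eqP.
Qed.

Lemma nrmD f g : L2r f -> L2r g ->
  ip (fun x => f x + g x) (fun x => f x + g x) = ip f f + 2 * ip f g + ip g g.
Proof.
move=> Lf Lg; have Lfg := L2r_add Lf Lg.
by rewrite (ipDl Lf Lg Lfg) 2!(ipC _ (fun x => f x + g x)) !ipDl// (ipC g f); ring.
Qed.

Lemma nrmB f g : L2r f -> L2r g ->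
  ip (fun x => f x - g x) (fun x => f x - g x) = ip f f - 2 * ip f g + ip g g.
Proof.
move=> Lf Lg; have Lfg := L2r_sub Lf Lg.
by rewrite (ipBl Lf Lg Lfg) 2!(ipC _ (fun x => f x - g x)) !ipBl// (ipC g f); ring.
Qed.

Lemma cauchy_schwarz f g : L2r f -> L2r g -> ip f g ^+ 2 <= ip f f * ip g g.
Proof.
move=> Lf Lg.
have H t : 0 <= ip f f + 2 * t * ip f g + t ^+ 2 * ip g g.
  have := nrm_ge0 (fun x => f x + t * g x).
  have Ltg := L2r_scale t Lg.
  rewrite (nrmD Lf Ltg) (ipC f (fun x => t * g x)) (ipZl t Lg Ltg) (ipC g (fun x => t * g x)).
  by rewrite !ipZl// (ipC g f); lra.
have [g0|g0] := eqVneq (ip g g) 0.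
  rewrite g0 mulr0 (_ : ip f g = 0) ?expr0n//; apply/eqP/negPn/negP => fg0.
  have := H (- (ip f f + 1) / (2 * ip f g)); rewrite g0 mulr0 addr0.
  have -> : 2 * (- (ip f f + 1) / (2 * ip f g)) * ip f g = - (ip f f + 1) by field.
  by lra.
have gp : 0 < ip g g by rewrite lt_neqAle eq_sym g0 nrm_ge0.
have := H (- ip f g / ip g g).
have -> : ip f f + 2 * (- ip f g / ip g g) * ip f g + (- ip f g / ip g g) ^+ 2 * ip g g =
  (ip f f * ip g g - ip f g ^+ 2) / ip g g by field.
by rewrite pmulr_lge0 ?invr_gt0// subr_ge0.
Qed.

Lemma cauchy_schwarz_sqrt f g : L2r f -> L2r g ->
  `|ip f g| <= Num.sqrt (ip f f) * Num.sqrt (ip g g).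
Proof.
move=> Lf Lg; rewrite -sqrtr_sqr -sqrtrM ?nrm_ge0//.
by rewrite ler_wsqrtr// cauchy_schwarz.
Qed.
End weighted.
End L2real.

(** * Orthonormal systems: the theorems of Riesz-Fischer and Parseval *)

Section riesz_fischer.
Context {R : realType}.
Notation mu := (@lebesgue_measure R).
Notation D := (`]0%R, +oo[%classic : set R).
Variable W : R -> R.
Hypothesis mW : measurable_fun D W.
Hypothesis W0 : forall x, 0 < x -> 0 < W x.
Implicit Types (f g : R -> R) (a : nat -> R).
Let mD := @measD R.

Notation L2 := (L2r W).
Notation "<< f , g >>" := (ip W f g).

Variable e : nat -> R -> R.
Hypothesis Le : forall n, L2 (e n).
Hypothesis orth : forall n k, << e n, e k >> = (n == k)%:R.

Definition psum a (N : nat) (x : R) : R := \sum_(n < N) a n * e n x.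

Lemma psum_L2 a N : L2 (psum a N).
Proof.
by apply: (@L2r_sum _ _ mW W0 N (fun n x => a n * e n x)) => n; exact: L2r_scale.
Qed.

Lemma psumS a N x : psum a N.+1 x = psum a N x + a N * e N x.
Proof. by rewrite /psum big_ord_recr. Qed.

Lemma ip_psum a N f : L2 f -> << psum a N, f >> = \sum_(n < N) a n * << e n, f >>.
Proof.
move=> Lf; rewrite (ip_suml mW W0 N (F := fun n x => a n * e n x))//.
  by apply: eq_bigr => n _; rewrite (ipZl mW W0).
by move=> n; exact: L2r_scale.
Qed.

Lemma ip_psum_e a N k : << psum a N, e k >> = if (k < N)%N then a k else 0.
Proof.
rewrite ip_psum//; under eq_bigr do rewrite orth.
case: ltnP => kN.
  rewrite (bigD1 (Ordinal kN))//= eqxx mulr1 big1 ?addr0// => i /negPf ik.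
  by rewrite (_ : (i == k :> nat) = false) ?mulr0// -ik.
by rewrite big1// => i _; rewrite (ltn_eqF (leq_trans (ltn_ord i) kN)) mulr0.
Qed.

Lemma nrm_psum a N : << psum a N, psum a N >> = \sum_(n < N) a n ^+ 2.
Proof.
rewrite ip_psum; last exact: psum_L2.
by apply: eq_bigr => n _; rewrite ipC ip_psum_e ltn_ord expr2.
Qed.

Lemma nrm_psumB a N M : (N <= M)%N ->
  << (fun x => psum a M x - psum a N x), (fun x => psum a M x - psum a N x) >> =
  \sum_(n < M) a n ^+ 2 - \sum_(n < N) a n ^+ 2.
Proof.
move=> NM; rewrite (nrmB mW W0 (psum_L2 a M) (psum_L2 a N)) !nrm_psum ipC.
rewrite ip_psum; last exact: psum_L2.
have -> : \sum_(n < N) a n * << e n, psum a M >> = \sum_(n < N) a n ^+ 2.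
  apply: eq_bigr => n _; rewrite ipC ip_psum_e (leq_trans (ltn_ord n) NM).
  by rewrite expr2.
ring.
Qed.

Lemma bessel f N : L2 f -> \sum_(n < N) << f, e n >> ^+ 2 <= << f, f >>.
Proof.
move=> Lf; pose a n := << f, e n >>.
have := nrm_ge0 W0 (fun x => f x - psum a N x).
rewrite (nrmB mW W0 Lf (psum_L2 a N)) nrm_psum (ipC _ f) ip_psum//.
have -> : \sum_(n < N) a n * << e n, f >> = \sum_(n < N) a n ^+ 2.
  by apply: eq_bigr => n _; rewrite ipC expr2.
rewrite /a; lra.
Qed.

Lemma sum_sqr_cvg a (M : R) : (forall N, \sum_(n < N) a n ^+ 2 <= M) ->
  exists c, (forall N, \sum_(n < N) a n ^+ 2 <= c) /\
   forall eps, 0 < eps -> exists N0 : nat, forall N, (N0 <= N)%N -> c - \sum_(n < N) a n ^+ 2 <= eps.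
Proof.
move=> aM; pose u N := \sum_(n < N) a n ^+ 2.
have ndu : nondecreasing_seq u.
  by apply/nondecreasing_seqP => n; rewrite /u big_ord_recr/= lerDl sqr_ge0.
have cu : cvgn u.
  by apply: nondecreasing_is_cvgn => //; exists M => _ [n _ <-]; exact: aM.
exists (limn u); split; first by move=> N; exact: (nondecreasing_cvgn_le ndu cu N).
move=> eps eps0; move/cvgrPdist_le : cu => /(_ _ eps0)[N0 _ H]; exists N0 => N N0N.
by rewrite (le_trans (ler_norm _))// H.
Qed.

(** Along K the squared norms of the increments decrease like 16^(-k), so that they
    are still summable after multiplication by 4^k. *)
Lemma riesz_fischer_subseq a (M : R) : (forall N, \sum_(n < N) a n ^+ 2 <= M) ->
  exists2 K : nat -> nat, {homo K : m n / (m <= n)%N} /\ (forall n, (n <= K n)%N) &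
  forall k m, (K k <= m)%N ->
    \sum_(n < m) a n ^+ 2 - \sum_(n < K k) a n ^+ 2 <= (16^-1) ^+ k.
Proof.
move=> /sum_sqr_cvg[c [cub H]].
have /choice[N NP] : forall k, exists N0 : nat, forall N, (N0 <= N)%N ->
    c - \sum_(n < N) a n ^+ 2 <= (16^-1) ^+ k.
  by move=> k; apply: H; rewrite exprn_gt0.
exists (fun k => (\sum_(i < k.+1) (N i).+1)%N).
  split.
    move=> m n mn; apply: leq_trans (_ : (\sum_(0 <= i < n.+1) (N i).+1 <= _)%N); last by rewrite big_mkord.
    rewrite -(big_mkord xpredT (fun i => (N i).+1)) (@big_cat_nat _ _ _ m.+1 0 n.+1)//=.
    exact: leq_addr.
  move=> n; apply: leq_trans (_ : (\sum_(i < n.+1) 1 <= _)%N).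
    by rewrite sum1_card card_ord.
  exact: leq_sum.
move=> k m Km; apply: le_trans (_ : c - \sum_(n < (\sum_(i < k.+1) (N i).+1)%N) a n ^+ 2 <= _).
  by rewrite lerB.
by apply: NP; rewrite big_ord_recr/=; apply: leq_trans (leq_addl _ _).
Qed.

(** Beppo Levi: the sum of the series is integrable, hence finite almost
    everywhere. *)
Lemma intD_series (g : nat -> R -> R) (b : nat -> R) :
  (forall k, intD (g k)) -> (forall k x, 0 < x -> 0 <= g k x) ->
  (forall k, (\int[mu]_(x in D) g k x <= b k)) -> cvgn (series b) ->
  aeD (fun x => exists C : R, forall k, g k x <= C).
Proof.
move=> gi g0 gb cb.
have mg k : measurable_fun D (fun x => (g k x)%:E).
  by apply/measurable_EFinP; exact: intD_meas (gi k).
pose G x := (\sum_(0 <= k <oo) (g k x)%:E)%E.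
have b0 k : 0 <= b k.
  by apply: le_trans (gb k); apply: Rintegral_ge0 => x /inD; exact: g0.
have iG : (\int[mu]_(x in D) G x < +oo)%E.
  rewrite integral_nneseries//; last by move=> k x /inD x0; rewrite lee_fin g0.
  apply: (@le_lt_trans _ _ (\sum_(0 <= k <oo) (b k)%:E)%E).
    apply: lee_nneseries => [k _ _|k _].
      by apply: integral_ge0 => x /inD x0; rewrite lee_fin g0.
    by rewrite (IE (gi k)) lee_fin.
  rewrite (_ : (\sum_(0 <= k <oo) (b k)%:E)%E = (limn (series b))%:E) ?ltry//.
  rewrite -EFin_lim//; congr (limn _); apply/funext => n /=.
  by rewrite /series/= sumEFin.
have mG : measurable_fun D G.
  apply: ge0_emeasurable_sum => //.
  by move=> k x /inD x0 _; rewrite lee_fin g0.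
have G0 x : 0 < x -> (0 <= G x)%E.
  by move=> x0; apply: nneseries_ge0 => k _ _; rewrite lee_fin g0.
have : mu.-integrable D G.
  apply/integrableP; split => //; move: iG; congr (_ < _)%E.
  by apply: eq_integral => x; rewrite inE => /inD x0; rewrite gee0_abs// G0.
move=> /(integrable_ae mD).
have ? := ae_filter_ringOfSetsType mu.
rewrite /aeD; apply: filterS => x h x0; have /h Gfin : D x by apply/inD.
exists (fine (G x)) => k; rewrite -lee_fin fineK//.
apply: le_trans (_ : (\sum_(0 <= i < k.+1) (g i x)%:E <= _)%E).
  rewrite sumEFin lee_fin big_nat_recr//= lerDr sumr_ge0// => i _; exact: g0.
by apply: nneseries_lim_ge => i _; rewrite lee_fin g0.
Qed.

Lemma limn_einf_ub (u : nat -> \bar R) (B : \bar R) :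
  (forall k, (u k <= B)%E) -> (limn_einf u <= B)%E.
Proof.
move=> uB; rewrite limn_einf_lim; apply: lime_le; first exact: is_cvg_einfs.
by apply: nearW => n; rewrite (le_trans _ (uB n))// ereal_inf_lbound//; exists n => /=.
Qed.

(** Along a fast subsequence the series of 4^k d_k^2 W, with d_k the increments, is
    finite almost everywhere, so d_k is dominated by 2^(-k) and the subsequence
    converges pointwise. Fatou's lemma turns this into convergence in L^2. *)
Theorem riesz_fischer a (M : R) : (forall N, \sum_(n < N) a n ^+ 2 <= M) ->
  exists2 f, L2 f & forall eps, 0 < eps -> exists N0 : nat, forall N, (N0 <= N)%N ->
   << (fun x => f x - psum a N x), (fun x => f x - psum a N x) >> <= eps.
Proof.
move=> aM; have [c [cub cH]] := sum_sqr_cvg aM.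
have [K [ndK Kn] KH] := riesz_fischer_subseq aM.
pose v k x := psum a (K k) x.
pose d k x := v k.+1 x - v k x.
have Lv k : L2 (v k) by exact: psum_L2.
have Ld k : L2 (d k) by exact: (L2r_sub mW W0).
have nd k : << d k, d k >> <= (16^-1) ^+ k.
  by rewrite nrm_psumB ?KH// ndK.
have bnd : aeD (fun x => exists C : R, forall k, 4 ^+ k * (d k x ^+ 2 * W x) <= C).
  apply: (@intD_series (fun k x => 4 ^+ k * (d k x ^+ 2 * W x)) (geometric 1 4^-1)).
  - by move=> k; apply: intD_scale; have [] := Ld k.
  - by move=> k x x0; rewrite mulr_ge0 ?exprn_ge0// mulr_ge0 ?sqr_ge0// ltW// W0.
  - move=> k; rewrite I_scale; last by have [] := Ld k.
    rewrite -ipE /geometric/= mul1r.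
    have -> : (4^-1 : R) ^+ k = 4 ^+ k * (16^-1) ^+ k by rewrite -exprMn; congr (_ ^+ k); field.
    by rewrite ler_wpM2l ?exprn_ge0.
  - by apply: is_cvg_geometric_series; rewrite ger0_norm// invf_lt1// ltr1n.
have cvgv : aeD (fun x => cvgn (fun k => v k x)).
  apply: aeD_filter bnd => x x0 [C HC].
  have Wx := W0 x0.
  have dk k : `|d k x| <= Num.sqrt (C / W x) * 2^-1 ^+ k.
    rewrite -ler_sqr ?nnegrE ?mulr_ge0 ?sqrtr_ge0 ?exprn_ge0//.
    rewrite real_normK ?num_real// exprMn.
    have C0 : 0 <= C.
      by apply: le_trans (HC 0%N); rewrite mulr_ge0// mulr_ge0 ?sqr_ge0// ltW.
    rewrite sqr_sqrtr ?divr_ge0// ?(ltW Wx)// -exprM mulnC exprM.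
    rewrite -(ler_pM2r Wx) -(@ler_pM2l _ (4 ^+ k)) ?exprn_gt0//.
    apply: le_trans (HC k) _.
    have -> : 4 ^+ k * (C / W x * 2^-1 ^+ 2 ^+ k * W x) = C * (4 * 2^-1 ^+ 2) ^+ k.
      rewrite [X in _ = _ * X]exprMn; move: ((4 : R) ^+ k) (((2 : R)^-1 ^+ 2) ^+ k) => p q.
      by field; rewrite gt_eqF.
    have -> : 4 * 2^-1 ^+ 2 = 1 :> R by field.
    by rewrite expr1n mulr1.
  have cd : cvgn (series (fun k => d k x)).
    apply: normed_cvg; apply: (@series_le_cvg _ _ (geometric (Num.sqrt (C / W x)) 2^-1)).
    - by move=> k /=.
    - by move=> k; rewrite /geometric/= mulr_ge0 ?sqrtr_ge0 ?exprn_ge0.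
    - exact: dk.
    - by apply: is_cvg_geometric_series; rewrite ger0_norm// invf_lt1// ltr1n.
  have vE : (fun k => v k x) = (fun k => v 0 x + series (fun k => d k x) k).
    by apply/funext => k; rewrite /series/= /d telescope_sumr// addrC subrK.
  by rewrite vE; apply: is_cvgD => //; exact: is_cvg_cst.
pose f x := fine (limn_esup (fun k => (v k x)%:E)).
have fv x : cvgn (fun k => v k x) -> v k x @[k --> \oo] --> f x.
  move=> cv; rewrite /f is_cvg_limn_esupE; last first.
    by apply/cvg_ex; exists (limn (v ^~ x))%:E; apply: cvg_EFin => //; exact: nearW.
  by rewrite EFin_lim.
have mf : measurable_fun D f.
  apply: (measurableT_comp (fine_measurable measurableT)).
  apply: measurable_fun_limn_esup => k; apply/measurable_EFinP.
  by have [] := Lv k.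
have key N : (\int[mu]_(x in D) ((f x - psum a N x) ^+ 2 * W x)%:E <=
    (c - \sum_(n < N) a n ^+ 2)%:E)%E.
  pose h k x := ((v (k + N)%N x - psum a N x) ^+ 2 * W x)%:E.
  have LN k : L2 (fun x => v (k + N)%N x - psum a N x).
    by apply: (L2r_sub mW W0) => //; exact: psum_L2.
  have mh k : measurable_fun D (h k).
    by apply/measurable_EFinP; have [_ /intD_meas] := LN k.
  have h0 k x : D x -> (0 <= h k x)%E.
    by move=> /inD x0; rewrite lee_fin mulr_ge0 ?sqr_ge0// ltW// W0.
  have -> : (\int[mu]_(x in D) ((f x - psum a N x) ^+ 2 * W x)%:E =
     \int[mu]_(x in D) limn_einf (h ^~ x))%E.
    apply: ae_eq_integral => //.
    - apply/measurable_EFinP; apply: measurable_funM => //; apply: measurable_funX.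
      by apply: measurable_funB => //; have [] := psum_L2 a N.
    - rewrite /limn_einf; apply: measurableT_comp => //=.
      apply: measurable_fun_limn_esup => k; apply/measurable_EFinP.
      have /measurable_EFinP mhk := mh k.
      exact: measurable_funN.
    - apply: aeD_ae_eq; apply: aeD_filter cvgv => x x0 /fv cv.
      have ch : h k x @[k --> \oo] --> ((f x - psum a N x) ^+ 2 * W x)%:E.
        apply: cvg_EFin; first exact: nearW.
        apply: cvgMl; rewrite [X in X @ _ --> _](_ : _ =
          (fun k => (v (k + N)%N x - psum a N x) * (v (k + N)%N x - psum a N x))); last first.
          by apply/funext => k; rewrite -expr2.
        have cvN : v (k + N)%N x @[k --> \oo] --> f x by rewrite (cvg_shiftn N (v ^~ x)).
        by rewrite expr2; apply: cvgM; apply: cvgB => //; exact: cvg_cst.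
      rewrite is_cvg_limn_einfE; last by apply/cvg_ex; eexists; exact: ch.
      by apply/esym/cvg_lim.
  apply: le_trans (fatou _ _ _ _) _ => //.
  apply: limn_einf_ub => k.
  rewrite IE; last by have [] := LN k.
  rewrite lee_fin -ipE nrm_psumB; first by rewrite lerB// cub.
  by rewrite (leq_trans _ (Kn _))// leq_addl.
have Lf : L2 f.
  split => //; apply: intD_ge0.
  - by apply: measurable_funM => //; exact: measurable_funX.
  - by move=> x x0; rewrite mulr_ge0 ?sqr_ge0// ltW// W0.
  - apply: le_lt_trans (ltry (c - \sum_(n < 0) a n ^+ 2)).
    apply: le_trans (key 0%N); rewrite le_eqVlt; apply/orP; left; apply/eqP.
    by apply: eq_integral => x _; rewrite /psum big_ord0 subr0.
exists f => // eps eps0; have [N0 HN] := cH _ eps0; exists N0 => N N0N.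
apply: le_trans (HN N N0N); rewrite -lee_fin; apply: le_trans (key N).
rewrite IE -?ipE//.
by have [] := L2r_sub mW W0 Lf (psum_L2 a N).
Qed.

Lemma riesz_fischer_coef a f : L2 f -> (forall eps, 0 < eps -> exists N0 : nat, forall N, (N0 <= N)%N ->
   << (fun x => f x - psum a N x), (fun x => f x - psum a N x) >> <= eps) ->
  forall n, << f, e n >> = a n.
Proof.
move=> Lf H n; apply/eqP; rewrite -subr_eq0 -sqrf_eq0; apply/eqP/le_anti.
rewrite sqr_ge0 andbT; apply/ler_addgt0Pr => eps eps0; rewrite add0r.
have [N0 HN] := H _ eps0.
pose N := maxn N0 n.+1.
apply: le_trans (HN N (leq_maxl _ _)).
have Lp := L2r_sub mW W0 Lf (psum_L2 a N).
have := cauchy_schwarz mW W0 Lp (Le n).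
rewrite orth eqxx mulr1 (ipBl mW W0 Lf (psum_L2 a N) (Le n)) ip_psum_e.
by rewrite leq_maxr.
Qed.

Section complete.
Hypothesis complete : forall f, L2 f -> (forall n, << f, e n >> = 0) -> aeD (fun x => f x = 0).

Lemma coef_inj f g : L2 f -> L2 g -> (forall n, << f, e n >> = << g, e n >>) ->
  aeD (fun x => f x = g x).
Proof.
move=> Lf Lg fg; have /complete : L2 (fun x => f x - g x) by exact: (L2r_sub mW W0).
have H n : << fun x => f x - g x, e n >> = 0 by rewrite (ipBl mW W0)// fg subrr.
by move=> /(_ H); apply: aeD_filter => x _ /eqP; rewrite subr_eq0 => /eqP.
Qed.

(** The Riesz-Fischer limit has the same coefficients as f, so completeness
    identifies it with f. *)
Lemma expansion f : L2 f -> forall eps, 0 < eps -> exists N0 : nat, forall N, (N0 <= N)%N ->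
   << (fun x => f x - psum (fun n => << f, e n >>) N x),
      (fun x => f x - psum (fun n => << f, e n >>) N x) >> <= eps.
Proof.
move=> Lf eps eps0; pose a n := << f, e n >>.
have [g Lg gH] := @riesz_fischer a << f, f >> (fun N => bessel N Lf).
have ga := riesz_fischer_coef Lg gH.
have fg := coef_inj Lf Lg (fun n => esym (ga n)).
have [N0 HN] := gH _ eps0; exists N0 => N N0N; apply: le_trans (HN N N0N).
have Lp := psum_L2 a N; have Lfp := L2r_sub mW W0 Lf Lp; have Lgp := L2r_sub mW W0 Lg Lp.
have h : aeD (fun x => f x - psum a N x = g x - psum a N x).
  by apply: aeD_filter fg => x _ ->.
by rewrite (ip_ae mW W0 Lfp Lgp Lfp h) ipC (ip_ae mW W0 Lfp Lgp Lgp h).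
Qed.

Lemma parseval f g : L2 f -> L2 g ->
  \sum_(n < N) << f, e n >> * << g, e n >> @[N --> \oo] --> << f, g >>.
Proof.
move=> Lf Lg; pose a n := << f, e n >>.
have SE N : \sum_(n < N) << f, e n >> * << g, e n >> = << psum a N, g >>.
  by rewrite ip_psum//; apply: eq_bigr => n _; rewrite (ipC _ g).
under eq_fun do rewrite SE.
apply/cvgrPdist_le => eps eps0.
have g1 : 0 < << g, g >> + 1 by rewrite ltr_wpDl// nrm_ge0.
have [N0 HN] := expansion Lf (divr_gt0 (exprn_gt0 2 eps0) g1).
near=> N.
have N0N : (N0 <= N)%N by near: N; exact: nbhs_infty_ge.
rewrite -(ipBl mW W0 Lf (psum_L2 a N) Lg).
rewrite -ler_sqr ?nnegrE ?(ltW eps0)// real_normK ?num_real//.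
have Lp := L2r_sub mW W0 Lf (psum_L2 a N).
apply: le_trans (cauchy_schwarz mW W0 Lp Lg) _.
apply: (@le_trans _ _ (eps ^+ 2 / (<< g, g >> + 1) * << g, g >>)).
  by rewrite ler_wpM2r ?nrm_ge0// HN.
rewrite mulrAC ler_pdivrMr// ler_wpM2l ?sqr_ge0// lerDl//.
Unshelve. all: by end_near. Qed.
End complete.
End riesz_fischer.

(** * Laguerre polynomials and the Darboux transform *)

Section laguerre_algebra.
Context {R : realType}.
Implicit Types (a r : R) (p y : {poly R}).

Lemma coef_deriv_natr p i : (p^`())`_i = p`_i.+1 * i.+1%:R.
Proof. by rewrite coef_deriv mulr_natr. Qed.

Lemma gbinomial0 r : gbinomial r 0 = 1.
Proof. by rewrite /gbinomial big_ord0 fact0 invr1 mulr1. Qed.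

Lemma fact_neq0 n : n`!%:R != 0 :> R.
Proof. by rewrite pnatr_eq0 -lt0n fact_gt0. Qed.

Lemma gbinomialS r i : i.+1%:R * gbinomial r i.+1 = (r - i%:R) * gbinomial r i.
Proof.
rewrite /gbinomial big_ord_recr/= factS natrM.
have h2 : i.+1%:R != 0 :> R by rewrite pnatr_eq0.
move: (fact_neq0 i) h2; move: (i`!%:R) (i.+1%:R) => u v h h2.
by field; rewrite h h2.
Qed.

Lemma gbinomial_shift r i : (r - i%:R) * gbinomial r i = r * gbinomial (r - 1) i.
Proof.
rewrite /gbinomial !mulrA; congr (_ / _); rewrite mulrC.
transitivity (\prod_(k < i.+1) (r - k%:R)); first by rewrite big_ord_recr.
rewrite big_ord_recl/= subr0; congr (_ * _); apply: eq_bigr => k _.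
by rewrite /bump/= add1n -natr1; ring.
Qed.

Lemma gbinomial_gt0 r i : i%:R - 1 < r -> 0 < gbinomial r i.
Proof.
move=> ri; rewrite divr_gt0 ?ltr0n ?fact_gt0//; apply: prodr_gt0 => k _.
rewrite subr_gt0; apply: le_lt_trans ri.
by rewrite lerBrDr natr1 ler_nat.
Qed.

Lemma gbinomial_lt0 r i : r < 0 -> 0 < (-1) ^+ i * gbinomial r i.
Proof.
move=> r0; rewrite /gbinomial mulrA divr_gt0 ?ltr0n ?fact_gt0//.
rewrite -[i in (-1) ^+ i]card_ord -prodr_const -big_split/=; apply: prodr_gt0 => k _.
by rewrite mulN1r opprB subr_gt0 (lt_le_trans r0).
Qed.

Definition lag (k : nat) a : {poly R} := laguerre (Posz k) a.

Lemma coef_lag k a j : (lag k a)`_j =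
  if (j <= k)%N then gbinomial (k%:R + a) (k - j) * (-1) ^+ j / j`!%:R else 0.
Proof. by rewrite /lag/= coef_poly ltnS. Qed.

Lemma size_lag k a : size (lag k a) = k.+1.
Proof.
apply/eqP; rewrite eqn_leq size_poly/= ltnNge; apply/negP => h.
have : (lag k a)`_k = 0 by rewrite nth_default.
rewrite coef_lag leqnn subnn gbinomial0 mul1r => /eqP.
by rewrite mulf_eq0 invr_eq0 (negPf (fact_neq0 k)) signr_eq0.
Qed.

Lemma deriv_lag k a : (lag k a)^`() = - laguerre (k%:Z - 1) (a + 1).
Proof.
case: k => [|k].
  have -> : (0%:Z - 1) = Negz 0 by [].
  rewrite oppr0; apply/polyP => j; rewrite coef_deriv coef_lag coef0.
  by rewrite mul0rn.
have -> : (k.+1%:Z - 1) = Posz k by rewrite intS addrAC subrr add0r.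
apply/polyP => j; rewrite coef_deriv coefN coef_lag ltnS -/(lag k (a + 1)) coef_lag.
case: ifP => jk; last by rewrite mul0rn oppr0.
rewrite subSS factS natrM -[LHS]mulr_natr exprS -!natr1.
have -> : k%:R + 1 + a = k%:R + (a + 1) by ring.
have h2 : j%:R + 1 != 0 :> R by rewrite natr1 pnatr_eq0.
move: (fact_neq0 j) h2; move: (j`!%:R) => u h h2.
by field; rewrite h h2.
Qed.

Lemma laguerre_ode k a :
  'X * (lag k a)^`()^`() + ((a + 1)%:P - 'X) * (lag k a)^`() + k%:R *: lag k a = 0.
Proof.
apply/polyP => j; rewrite !coefD coefZ coef0 mulrBl coefB coefCM !coefXM.
have E : (lag k a)`_j.+1 * j.+1%:R * (j%:R + a + 1) = (j%:R - k%:R) * (lag k a)`_j.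
  rewrite !coef_lag; case: (ltnP j k) => jk; last first.
    rewrite mul0r mul0r; move: jk; rewrite leq_eqVlt => /orP[/eqP->|kj].
      by rewrite subrr mul0r.
    by rewrite leqNgt kj mulr0.
  rewrite (ltnW jk) (_ : (k - j)%N = (k - j.+1).+1); last by rewrite subnSK.
  have := gbinomialS (k%:R + a) (k - j.+1).
  set g1 := gbinomial _ _; set g := gbinomial _ _.
  have -> : (k - j.+1).+1%:R = k%:R - j%:R :> R by rewrite subnSK// natrB// ltnW.
  have -> : k%:R + a - (k - j.+1)%:R = a + j%:R + 1 :> R.
    by rewrite natrB// -natr1; ring.
  move=> h.
  have -> : (j%:R - k%:R) * (g1 * (-1) ^+ j / j`!%:R) = - ((k%:R - j%:R) * g1) * ((-1) ^+ j / j`!%:R) by ring.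
  rewrite h factS natrM exprS -natr1.
  have h2 : j%:R + 1 != 0 :> R by rewrite natr1 pnatr_eq0.
  move: (fact_neq0 j) h2; move: (j`!%:R) => u h' h2.
  by field; rewrite h' h2.
case: j E => [|j] E /=.
  by rewrite add0r coef_deriv_natr subr0; move: E; rewrite add0r; lra.
rewrite !coef_deriv_natr.
have -> : (lag k a)`_j.+2 * j.+2%:R * j.+1%:R = (lag k a)`_j.+2 * j.+2%:R * (j.+1%:R + a + 1) - (lag k a)`_j.+2 * j.+2%:R * (a + 1) by ring.
rewrite E; ring.
Qed.

Lemma laguerre_contig k a :
  'X * (lag k a)^`() + a%:P * lag k a = (k%:R + a) *: lag k (a - 1).
Proof.
apply/polyP => j; rewrite coefD coefZ coefCM coefXM.
have -> : (if j == 0 then 0 else ((lag k a)^`())`_j.-1) = j%:R * (lag k a)`_j.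
  by case: j => [|j] /=; rewrite ?mul0r// coef_deriv_natr mulrC.
rewrite !coef_lag; case: ifP => jk; last by rewrite !mulr0 addr0.
have := gbinomial_shift (k%:R + a) (k - j).
have -> : k%:R + (a - 1) = k%:R + a - 1 :> R by ring.
have -> : k%:R + a - (k - j)%:R = a + j%:R :> R by rewrite natrB//; ring.
set g := gbinomial (k%:R + a) _; set h := gbinomial (k%:R + a - 1) _ => E.
have -> : j%:R * (g * (-1) ^+ j / j`!%:R) + a * (g * (-1) ^+ j / j`!%:R) =
  ((a + j%:R) * g) * ((-1) ^+ j / j`!%:R) by ring.
by rewrite E; ring.
Qed.

Lemma lag_at0 k a : -1 < a -> 0 < (lag k a).[0].
Proof.
move=> a1; rewrite horner_coef0 coef_lag/= subn0 fact0 expr0 mulr1 divr1.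
by apply: gbinomial_gt0; lra.
Qed.

(** Elimination of the leading coefficient. *)
Lemma poly_basis (b : nat -> {poly R}) : (forall k, size (b k) = k.+1) ->
  forall p, exists (N : nat) (c : nat -> R), p = \sum_(k < N) c k *: b k.
Proof.
move=> sb p.
suff H : forall N p, (size p <= N)%N -> exists c : nat -> R, p = \sum_(k < N) c k *: b k.
  by exists (size p); exact: H.
elim=> [|N IH] {}p; first by rewrite leqn0 size_poly_eq0 => /eqP ->; exists (fun=> 0); rewrite big_ord0.
move=> sp; pose t := p`_N / lead_coef (b N).
have lb : lead_coef (b N) != 0 by rewrite lead_coef_eq0 -size_poly_eq0 sb.
have /IH[c cE] : (size (p - t *: b N)%R <= N)%N.
  apply/leq_sizeP => j; rewrite leq_eqVlt => /orP[/eqP <-|Nj].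
    by rewrite coefB coefZ /t /lead_coef sb/= divfK ?subrr// -[X in _`_X]/(N.+1.-1) -(sb N).
  by rewrite coefB coefZ !nth_default ?mulr0 ?subr0// ?sb// (leq_trans sp).
exists (fun k => if k == N then t else c k).
rewrite big_ord_recr/= eqxx -[p in LHS](subrK (t *: b N)); congr (_ + _).
rewrite cE; apply: eq_bigr => k _.
by rewrite (ltn_eqF (ltn_ord k)).
Qed.

Section exceptional.
Variables (m : nat) (alpha : R).
Hypothesis ham : m%:R - 1 < alpha.
Notation xi := (xiII m alpha).

Lemma alpha_gtN1 : -1 < alpha.
Proof. by apply: le_lt_trans ham; rewrite lerBrDr addNr. Qed.

(** The upper argument m - alpha - 1 of the binomial coefficients is negative, so
    each of their factors is; this is where alpha > m - 1 enters. *)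
Lemma xi_coef_gt0 j : (j <= m)%N -> 0 < (-1) ^+ m * xi`_j.
Proof.
move=> jm; rewrite /xiII -/(lag m _) coef_lag jm.
have -> : (-1) ^+ m = (-1) ^+ (m - j) * (-1) ^+ j :> R by rewrite -exprD subnK.
set g := gbinomial _ _.
have -> : (-1) ^+ (m - j) * (-1) ^+ j * (g * (-1) ^+ j / j`!%:R) =
   ((-1) ^+ (m - j) * g) * ((-1) ^+ j * (-1) ^+ j) / j`!%:R :> R by ring.
rewrite -expr2 sqrr_sign mulr1 divr_gt0 ?ltr0n ?fact_gt0//.
apply: gbinomial_lt0; move: ham; move: (m%:R) => u; lra.
Qed.

(** Coefficients of one sign make the modulus of xi at least its value at 0. *)
Lemma xi_lower : exists2 c : R, 0 < c & forall x, 0 <= x -> c <= `|xi.[x]|.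
Proof.
exists ((-1) ^+ m * xi`_0); first exact: xi_coef_gt0.
move=> x x0; have -> : `|xi.[x]| = `|(-1) ^+ m * xi.[x]| by rewrite normrM normr_sign mul1r.
apply: le_trans (ler_norm _); rewrite horner_coef mulr_sumr.
have sx : size xi = m.+1 by exact: size_lag.
rewrite sx big_ord_recl/= expr0 mulr1 lerDl; apply: sumr_ge0 => j _.
by rewrite mulrA mulr_ge0 ?exprn_ge0// ltW// xi_coef_gt0.
Qed.

Lemma xi_neq0 x : 0 <= x -> xi.[x] != 0.
Proof.
have [c c0 H] := xi_lower; move=> /H h; rewrite -normr_gt0.
exact: lt_le_trans h.
Qed.

(** The Darboux transform that maps the classical Laguerre polynomials of
    parameter alpha + 1 to the exceptional ones. *)
Definition darboux y : {poly R} :=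
  - ('X * xi * y^`()) + ('X * xi^`() - (alpha + 1)%:P * xi) * y.

Definition clag k := lag k (alpha + 1).

(** In the definition of the exceptional polynomials L_m^(-alpha-2) is eliminated by
    contiguity and L_(k-1)^(alpha+2) is a derivative. *)
Lemma laguerreII_darboux k : laguerreII m alpha (m + k) = darboux (clag k).
Proof.
rewrite /laguerreII /darboux /clag deriv_lag.
have -> : (m + k)%:Z - m%:Z = k%:Z by rewrite PoszD addrC addrA addNr add0r.
have -> : alpha + 1 + 1 = alpha + 2 :> R by ring.
rewrite mulrN opprK; congr (_ + _).
have := laguerre_contig m (- alpha - 1).
rewrite -/(xiII m alpha).
have -> : - alpha - 1 - 1 = - alpha - 2 :> R by ring.
have -> : m%:R + (- alpha - 1) = m%:R - alpha - 1 :> R by ring.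
have -> : (- alpha - 1)%:P = - (alpha + 1)%:P :> {poly R} by rewrite -polyCN; congr (_%:P); ring.
by rewrite mulNr => ->; rewrite -scalerAl.
Qed.

(** Evaluation at 0, where A y reduces to - (alpha + 1) xi y, shows that no P_k is the
    zero polynomial. *)
Lemma darboux_at0_neq0 k : (darboux (clag k)).[0] != 0.
Proof.
have a1 := alpha_gtN1.
have -> : (darboux (clag k)).[0] = - ((alpha + 1) * xi.[0] * (clag k).[0]).
  by rewrite /darboux !hornerE; ring.
rewrite oppr_eq0 mulf_neq0 ?mulf_neq0 ?xi_neq0// gt_eqF//; first by lra.
by apply: lag_at0; lra.
Qed.

(** The eigenvalue equation of the transformed polynomials, multiplied by xi so
    that it is an identity of polynomials; second derivatives of both xi and
    L_k^(alpha+1) are eliminated by Laguerre's equation. *)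
Lemma darboux_eigen k : let P := darboux (clag k) in
  - ('X * xi * P^`()^`()) + (('X - (1 + alpha)%:P) * xi + 2 *: ('X * xi^`())) * P^`()
  + (m%:R *: xi - 2 *: ('X * xi^`())) * P = k%:R *: (xi * P).
Proof.
move=> P; pose y := clag k.
have hy : 'X * y^`()^`() = ('X - (alpha + 2)%:P) * y^`() - k%:R%:P * y.
  have := laguerre_ode k (alpha + 1); rewrite -/(clag k) -/y.
  have -> : alpha + 1 + 1 = alpha + 2 :> R by ring.
  rewrite -mul_polyC => /eqP; rewrite -addrA addr_eq0 => /eqP ->; ring.
have hx : 'X * xi^`()^`() = ('X + alpha%:P) * xi^`() - m%:R%:P * xi.
  have := laguerre_ode m (- alpha - 1); rewrite -[lag m _]/xi subrK.
  rewrite -mul_polyC => /eqP; rewrite -addrA addr_eq0 => /eqP ->.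
  by rewrite polyCN; ring.
have hP1 : P^`() = - ('X * xi * y^`()) + (k%:R%:P * xi - m%:R%:P * xi + 'X * xi^`()) * y.
  rewrite /P /darboux -/y !(derivD, derivN, derivM, derivB, derivX, derivC).
  have -> : - ((1 * xi + 'X * xi^`()) * y^`() + 'X * xi * y^`()^`()) +
    ((1 * xi^`() + 'X * xi^`()^`() - (0 * xi + (alpha + 1)%:P * xi^`())) * y +
    ('X * xi^`() - (alpha + 1)%:P * xi) * y^`()) =
    - ((xi + 'X * xi^`()) * y^`() + xi * ('X * y^`()^`())) +
    ((xi^`() + 'X * xi^`()^`() - (alpha + 1)%:P * xi^`()) * y +
    ('X * xi^`() - (alpha + 1)%:P * xi) * y^`()) by ring.
  rewrite hy hx !polyCD; ring.
have hP2 : 'X * P^`()^`() = 'X * (- ((xi + 'X * xi^`()) * y^`() + xi * ('X * y^`()^`()))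
    + ((k%:R%:P * xi^`() - m%:R%:P * xi^`() + xi^`() + 'X * xi^`()^`()) * y +
     (k%:R%:P * xi - m%:R%:P * xi + 'X * xi^`()) * y^`())).
  rewrite hP1 !(derivD, derivN, derivM, derivB, derivX, derivC); ring.
have -> : 'X * xi * P^`()^`() = xi * ('X * P^`()^`()) by ring.
rewrite hP2 hy hx hP1 /P /darboux -/y -!mul_polyC !polyCD !polyC1.
ring.
Qed.
End exceptional.
End laguerre_algebra.

(** * Calculus on the half-line *)

Section derivative_rules.
Context {R : realType}.
Implicit Types (f g : R -> R) (x a b c : R).

Lemma dEq f x a b : is_derive x 1 f a -> a = b -> is_derive x 1 f b.
Proof. by move=> h <-. Qed.

Lemma dC x c : is_derive x 1 (fun=> c : R) 0.
Proof. exact: is_derive_cst. Qed.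

Lemma dId x : is_derive x 1 (fun y : R => y) 1.
Proof. exact: is_derive_id. Qed.

Lemma dD f g x a b : is_derive x 1 f a -> is_derive x 1 g b ->
  is_derive x 1 (fun y => f y + g y) (a + b).
Proof. exact: is_deriveD. Qed.

Lemma dN f x a : is_derive x 1 f a -> is_derive x 1 (fun y => - f y) (- a).
Proof. exact: is_deriveN. Qed.

Lemma dB f g x a b : is_derive x 1 f a -> is_derive x 1 g b ->
  is_derive x 1 (fun y => f y - g y) (a - b).
Proof. by move=> /dD h /dN; exact: h. Qed.

Lemma dM f g x a b : is_derive x 1 f a -> is_derive x 1 g b ->
  is_derive x 1 (fun y => f y * g y) (a * g x + f x * b).
Proof.
move=> h1 h2; have := is_deriveM h1 h2.
by rewrite /GRing.scale/= addrC (mulrC (g x)).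
Qed.

Lemma dZ c f x a : is_derive x 1 f a -> is_derive x 1 (fun y => c * f y) (c * a).
Proof. by move=> h; apply: dEq (dM (dC x c) h) _; rewrite mul0r add0r. Qed.

Lemma dComp f g x a b : is_derive (g x) 1 f a -> is_derive x 1 g b ->
  is_derive x 1 (fun y => f (g y)) (a * b).
Proof. exact: is_derive1_comp. Qed.

Lemma dV f x a : f x != 0 -> is_derive x 1 f a ->
  is_derive x 1 (fun y => (f y)^-1) (- a / f x ^+ 2).
Proof.
move=> fx0 h; apply: dEq (is_deriveV fx0 h) _.
by rewrite /GRing.scale/= !mulNr mulrC.
Qed.

Lemma dExp f x a : is_derive x 1 f a ->
  is_derive x 1 (fun y => expR (f y)) (expR (f x) * a).
Proof. by move=> h; apply: (@dComp expR) => //; exact: is_derive_expR. Qed.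

Lemma dPow c x : 0 < x -> is_derive x 1 (fun y => y `^ c) (c * x `^ (c - 1)).
Proof. exact: is_derive1_powR. Qed.

Lemma dPoly (p : {poly R}) x : is_derive x 1 (fun y => p.[y]) (p^`()).[x].
Proof. exact: is_derive_poly. Qed.

Lemma dLn x : 0 < x -> is_derive x 1 (@ln R) x^-1.
Proof. exact: is_derive1_ln. Qed.

Lemma d_derivable f x a : is_derive x 1 f a -> derivable f x 1.
Proof. by case. Qed.

Lemma d_derive1 f x a : is_derive x 1 f a -> derive1 f x = a.
Proof. by move=> h; rewrite derive1E derive_val. Qed.

Lemma derivable_d f x : derivable f x 1 -> is_derive x 1 f (derive1 f x).
Proof. by move=> h; split => //; rewrite derive1E. Qed.

Lemma d_continuous f x a : is_derive x 1 f a -> {for x, continuous f}.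
Proof. by move=> dF; apply/differentiable_continuous/derivable1_diffP; exact: ex_derive. Qed.

Lemma powRS x a : 0 < x -> x `^ (a + 1) = x * x `^ a.
Proof.
move=> x0; rewrite powRD; last by rewrite (gt_eqF x0) implybT.
by rewrite powRr1 1?mulrC// ltW.
Qed.
End derivative_rules.

Section toolkit.
Context {R : realType}.
Notation mu := (@lebesgue_measure R).
Notation D := (`]0%R, +oo[%classic : set R).
Notation "'I' f" := (\int[mu]_(x in D) (f : R -> R) x) (at level 10, f at level 8).
Implicit Types (f g h : R -> R) (a b s t x y c : R).
Let mD := @measD R.

(** Half-open intervals concatenate without overlap. *)
Definition J h s t : R := \int[mu]_(x in `]s, t]) h x.

Lemma intD_itv h (i : interval R) : [set` i] `<=` D -> intD h ->
  mu.-integrable [set` i] (EFin \o h).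
Proof. by move=> iD; apply: integrableS => //; exact: measurable_itv. Qed.

Lemma oc_D s t : 0 <= s -> `]s, t]%classic `<=` D.
Proof. by move=> s0 x; rewrite /= !in_itv/= andbT => /andP[sx _]; exact: le_lt_trans sx. Qed.

Lemma cc_D s t : 0 < s -> `[s, t]%classic `<=` D.
Proof. by move=> s0 x; rewrite /= !in_itv/= andbT => /andP[sx _]; exact: lt_le_trans sx. Qed.

Lemma J_cat h s t : intD h -> 0 <= s -> s <= t -> J h 0 t = J h 0 s + J h s t.
Proof.
move=> ih s0 st; rewrite /J.
have := @Rintegral_itvB R h (BRight 0) (BRight t) s.
move=> <-; [by rewrite addrC subrK| |by rewrite bnd_simp|by rewrite bnd_simp].
by apply: intD_itv => //; exact: oc_D.
Qed.

Lemma J_cc h s t : intD h -> 0 < s -> J h s t = \int[mu]_(x in `[s, t]) h x.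
Proof.
move=> ih s0; rewrite /J Rintegral_itv_obnd_cbnd//.
by apply: intD_itv => //; apply: oc_D; exact: ltW.
Qed.

Lemma J_indic h t : J h 0 t = I (fun x => if x <= t then h x else 0).
Proof.
rewrite /J Rintegral_mkcond [RHS]Rintegral_mkcond; congr Rintegral.
apply/funext => x; rewrite !patchE; case: ifPn => [|xt].
  by rewrite inE/= in_itv/= => /andP[x0 xt]; rewrite mem_set/= ?in_itv/= ?x0// xt.
case: ifPn => //; rewrite inE => /inD x0; case: ifPn => // xt'.
by move: xt; rewrite notin_setE/= in_itv/= x0 xt'.
Qed.

Lemma measurable_cut t : measurable_fun D (fun x => x <= t).
Proof.
apply: (@measurable_fun_ler _ _ _ _ id (cst t)) => //.
Qed.

Lemma intD_cut h t : intD h -> intD (fun x => if x <= t then h x else 0).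
Proof.
move=> ih; apply: (@intD_le _ _ (fun x => `|h x|)).
- apply: measurable_fun_if => //; first exact: measurable_cut.
  by apply: measurable_funS (intD_meas ih) => // x [].
- by move=> x _; case: ifP; rewrite ?normr0.
- by have := integrable_norm ih.
Qed.

Lemma dct (F : nat -> R -> R) f g : (forall n, measurable_fun D (F n)) ->
  measurable_fun D f -> (forall x, 0 < x -> F n x @[n --> \oo] --> f x) ->
  (forall n x, 0 < x -> `|F n x| <= g x) -> intD g ->
  intD f /\ I (F n) @[n --> \oo] --> I f.
Proof.
move=> mF mf Ff Fg ig.
have [|||||fi _ cv] := @dominated_convergence _ _ _ mu D mD (fun n => EFin \o F n) (EFin \o f) (EFin \o g).
- by move=> n; apply/measurable_EFinP; exact: mF.
- exact/measurable_EFinP.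
- apply: aeW => x /inD x0; apply: cvg_EFin; first exact: nearW.
  exact: Ff.
- exact: ig.
- by apply: aeW => x n /inD x0 /=; rewrite lee_fin Fg.
split=> //; have iF n : intD (F n) by apply: (intD_le (mF n) (Fg n) ig).
move: cv; rewrite (_ : \int[mu]_(x in D) (EFin \o f) x = (I f)%:E)%E; last by rewrite -IE.
by move/fine_cvg.
Qed.

Lemma J_cvg0 h : intD h -> J h 0 x @[x --> 0^'+] --> 0.
Proof.
move=> ih; apply/cvg_at_rightP => u [u0 uc].
have [|||||_] := @dct (fun n x => if x <= u n then h x else 0) (fun=> 0) (fun x => `|h x|).
- by move=> n; apply: intD_meas; exact: intD_cut.
- exact: measurable_cst.
- move=> x x0; apply: cvg_near_cst.
  have : \forall n \near \oo, u n < x by exact: (cvgr_lt _ uc).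
  by apply: filterS => n un; rewrite leNgt un.
- by move=> n x _; case: ifP; rewrite ?normr0.
- by have := integrable_norm ih.
by rewrite I0; under eq_fun do rewrite -J_indic.
Qed.

Lemma J_cvgy h : intD h -> J h 0 x @[x --> +oo] --> I h.
Proof.
move=> ih; apply/cvg_pinftyP => u uc.
have [|||||_] := @dct (fun n x => if x <= u n then h x else 0) h (fun x => `|h x|).
- by move=> n; apply: intD_meas; exact: intD_cut.
- exact: intD_meas.
- move=> x x0; apply: cvg_near_cst.
  have : \forall n \near \oo, x <= u n by exact: (cvgryPge _).1.
  by apply: filterS => n ->.
- by move=> n x _; case: ifP; rewrite ?normr0.
- by have := integrable_norm ih.
by under eq_fun do rewrite -J_indic.
Qed.

Lemma J_le h s t : intD h -> (forall x, 0 < x -> 0 <= h x) -> 0 <= s -> J h s t <= I h.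
Proof.
move=> ih h0 s0.
have ist : mu.-integrable `]s, t] (EFin \o h) by apply: intD_itv => //; exact: oc_D.
rewrite -lee_fin -(IE ih) /J /Rintegral fineK; last exact: integrable_fin_num.
apply: ge0_subset_integral => //.
- by case/integrableP: ih.
- by move=> x /inD x0; rewrite lee_fin h0.
- exact: oc_D.
Qed.

(** Monotone convergence along [1 / (n + 1), n + 1]. *)
Lemma intD_exhaust h (M : R) : measurable_fun D h -> (forall x, 0 < x -> 0 <= h x) ->
  (forall s t, 0 < s -> s <= t -> (\int[mu]_(x in `[s, t]) (h x)%:E <= M%:E)%E) -> intD h.
Proof.
move=> mh h0 H; apply: intD_ge0 => //.
pose F (n : nat) := (`[(n.+1%:R)^-1, n.+1%:R]%classic : set R).
have FD n : F n `<=` D by apply: cc_D; rewrite invr_gt0.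
have DE : D = \bigcup_n F n.
  apply/seteqP; split => [x|x [n _]]; last exact: FD.
  move=> /inD x0; pose n := Num.bound (x + x^-1).
  have xn : x + x^-1 < n%:R.
    by have := archi_boundP (addr_ge0 (ltW x0) (ltW (etrans (invr_gt0 x) x0))).
  exists n => //; rewrite /F/= in_itv/=; have xi : 0 < x^-1 by rewrite invr_gt0.
  have nn : n%:R <= n.+1%:R :> R by rewrite ler_nat.
  apply/andP; split; last by lra.
  by rewrite -[leRHS]invrK lef_pV2 ?posrE//; lra.
have cv : (\int[mu]_(x in F n) (h x)%:E)%E @[n --> \oo] --> (\int[mu]_(x in \bigcup_n F n) (h x)%:E)%E.
  apply: (@ge0_nondecreasing_set_cvg_integral _ (measurableTypeR R) R F (EFin \o h) mu).
  - apply/nondecreasing_seqP => n; apply/subsetPset => x; rewrite /F/= !in_itv/= => /andP[h1 h2].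
    have nn : n.+1%:R <= n.+2%:R :> R by rewrite ler_nat.
    rewrite (le_trans h2 nn) andbT (le_trans _ h1)// lef_pV2 ?posrE ?ltr0n//.
  - by move=> n; exact: measurable_itv.
  - by move=> n; apply/measurable_EFinP; exact: measurable_funS mh.
  - by move=> n x /FD/inD/h0; rewrite lee_fin.
apply: (@le_lt_trans _ _ M%:E); last exact: ltry.
rewrite DE -(cvg_lim _ cv)//; apply: lime_le; first by apply/cvg_ex; eexists; exact: cv.
apply: nearW => n; apply: H; first by rewrite invr_gt0.
by rewrite (@le_trans _ _ 1)// ?invf_le1// ler1n.
Qed.

Lemma continuous_oo_cc f s t : 0 < s -> {in D, continuous f} -> {within `[s, t], continuous f}.
Proof.
move=> s0 cf; apply: continuous_in_subspaceT => x; rewrite inE/= => xst.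
by apply: cf; rewrite inE; exact: (cc_D s0 xst).
Qed.

Lemma continuousD_meas f : {in D, continuous f} -> measurable_fun D f.
Proof. by move=> cf; apply: open_continuous_measurable_fun. Qed.

Lemma intcc_continuous f s t : 0 < s -> {in D, continuous f} ->
  mu.-integrable `[s, t] (EFin \o f).
Proof.
move=> s0 cf; apply: continuous_compact_integrable; first exact: segment_compact.
exact: continuous_oo_cc.
Qed.

Lemma FTC_itv F f s t : 0 < s -> s <= t -> {in D, continuous f} ->
  (forall x, 0 < x -> is_derive x 1 F (f x)) ->
  (\int[mu]_(x in `[s, t]) (f x)%:E)%E = (F t - F s)%:E.
Proof.
move=> s0; rewrite le_eqVlt => /predU1P[<- _ _|st cf dF].
  by rewrite subrr set_itv1 integral_set1.
rewrite (continuous_FTC2 st (continuous_oo_cc s0 cf) (F := F)) ?EFinB//; last first.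
  move=> x; rewrite in_itv/= => /andP[sx _]; have dFx := dF x (lt_trans s0 sx).
  by rewrite derive1E derive_val.
have cF x : 0 < x -> {for x, continuous F} by move=> x0; exact: d_continuous (dF x x0).
split.
- move=> x; rewrite in_itv/= => /andP[sx _]; have dFx := dF x (lt_trans s0 sx); exact: ex_derive.
- by apply: cvg_at_right_filter; exact: cF.
- by apply: cvg_at_left_filter; apply: cF; exact: lt_trans st.
Qed.

Lemma le_itv_integral f h s t : 0 < s -> mu.-integrable `[s, t] (EFin \o f) -> intD h ->
  (forall x, 0 < x -> 0 <= h x) -> (forall x, s <= x <= t -> f x <= h x) ->
  \int[mu]_(x in `[s, t]) f x <= I h.
Proof.
move=> s0 fi ih h0 fh.
apply: (@le_trans _ _ (J h s t)); last by apply: J_le => //; exact: ltW.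
rewrite J_cc//; apply: le_Rintegral => //.
  by apply: intD_itv => //; exact: cc_D.
Qed.

(** For t = d / 2 the integral of c / x over [s, t] is c (ln t - ln s), which exceeds
    the integral of h for small s. *)
Lemma intD_not_inv h (c d : R) : 0 < c -> 0 < d -> intD h -> (forall x, 0 < x -> 0 <= h x) ->
  (forall x, 0 < x < d -> c / x <= h x) -> False.
Proof.
move=> c0 d0 ih h0 H.
have cinv : {in D, continuous (fun x : R => c / x)}.
  move=> x; rewrite inE => /inD x0; apply: cvgM; first exact: cvg_cst.
  by apply: cvgV; rewrite ?gt_eqF//; exact: cvg_id.
pose t := d / 2; have t0 : 0 < t by rewrite divr_gt0.
pose s := t * expR (- ((I h + 1) / c)).
have s0 : 0 < s by rewrite mulr_gt0// expR_gt0.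
have Ih0 : 0 <= I h by exact: I_ge0.
have st : s <= t.
  rewrite /s ler_piMr// ?(ltW t0)// expR_le1 oppr_le0 divr_ge0// ?(ltW c0)//.
  by rewrite addr_ge0.
have dF x : 0 < x -> is_derive x 1 (fun x : R => c * ln x) (c / x).
  by move=> x0; apply: dZ; exact: dLn.
have E := FTC_itv s0 st cinv dF.
have ic := intcc_continuous t s0 cinv.
have := le_itv_integral (f := fun x => c / x) s0 ic ih h0.
rewrite /Rintegral E /= -/(Rintegral _ _ _) => le.
have {le} : c * ln t - c * ln s <= I h.
  apply: le => x /andP[sx xt]; apply: H; apply/andP; split; first exact: lt_le_trans sx.
  by rewrite (le_lt_trans xt)// /t ltr_pdivrMr// ltr_pMr// ltr1n.
rewrite /s lnM ?posrE ?expR_gt0// expRK mulrDr opprD addNKr mulrN opprK.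
rewrite mulrC divfK ?gt_eqF//; lra.
Qed.

Lemma intD_not_cst h (c d : R) : 0 < c -> 0 < d -> intD h -> (forall x, 0 < x -> 0 <= h x) ->
  (forall x, d <= x -> c <= h x) -> False.
Proof.
move=> c0 d0 ih h0 H.
have Ih0 : 0 <= I h by exact: I_ge0.
pose t := d + (I h + 1) / c.
have dt : d <= t by rewrite lerDl divr_ge0 ?addr_ge0// ltW.
have cc : {in D, continuous (fun x : R => c)} by move=> x _; exact: cvg_cst.
have := le_itv_integral (f := fun=> c) d0 (intcc_continuous t d0 cc) ih h0.
rewrite Rintegral_cst//= lebesgue_measure_itv/= lte_fin => le.
have {le} : c * (t - d) <= I h.
  move: dt; rewrite le_eqVlt => /predU1P[<-|dt]; first by rewrite subrr mulr0.
  by move: le; rewrite dt /= => -> // x /andP[dx _]; exact: H.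
rewrite /t addrC addKr mulrC divfK ?gt_eqF//; lra.
Qed.

(** This is, up to a factor, the derivative of the bounded function
    (x / (1 + x)) ^ (a + 1), and it dominates x ^ a e^(- c x). *)
Lemma intD_pow1 a : -1 < a -> intD (fun x => x `^ a * (1 + x) `^ (- a - 2)).
Proof.
move=> a1.
have cpow b : {in D, continuous (fun x : R => x `^ b)}.
  move=> x; rewrite inE => /inD x0; have := is_derive1_powR b x0 => H; exact: d_continuous H.
have dpow1 b x : 0 < x -> is_derive x 1 (fun x : R => (1 + x) `^ b) (b * (1 + x) `^ (b - 1)).
  move=> x0; have x1 : 0 < 1 + x by rewrite addr_gt0.
  apply: dEq (@dComp _ (fun y => y `^ b) (fun x => 1 + x) _ _ _ (dPow b x1) (dD (dC x 1) (dId x))) _.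
  by rewrite add0r mulr1.
have cf : {in D, continuous (fun x : R => x `^ a * (1 + x) `^ (- a - 2))}.
  move=> x Dx; apply: cvgM; first exact: cpow.
  by move: Dx; rewrite inE => /inD x0; exact: d_continuous (dpow1 _ _ x0).
apply: (@intD_exhaust _ ((a + 1)^-1)).
- exact: continuousD_meas.
- by move=> x x0; rewrite mulr_ge0 ?powR_ge0.
move=> s t s0 st.
pose F x := (a + 1)^-1 * (x `^ (a + 1) * (1 + x) `^ (- a - 1)).
have dF x : 0 < x -> is_derive x 1 F (x `^ a * (1 + x) `^ (- a - 2)).
  move=> x0; rewrite /F.
  apply: dEq (dZ _ (dM (dPow (a + 1) x0) (dpow1 (- a - 1) x x0))) _.
  have -> : a + 1 - 1 = a by ring.
  have -> : - a - 1 - 1 = - a - 2 by ring.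
  rewrite (powRS _ x0).
  have x1 : 0 < 1 + x by rewrite addr_gt0.
  have -> : - a - 1 = (- a - 2) + 1 by ring.
  rewrite (powRS _ x1).
  field.
  by rewrite gt_eqF//; lra.
rewrite (FTC_itv s0 st cf dF).
have t0 := lt_le_trans s0 st.
have F0 x : 0 < x -> 0 <= F x.
  by move=> x0; rewrite mulr_ge0 ?mulr_ge0 ?powR_ge0// invr_ge0; lra.
have F1 x : 0 < x -> F x <= (a + 1)^-1.
  move=> x0; rewrite /F ler_piMr// ?invr_ge0; first by lra.
  have -> : - a - 1 = - (a + 1) by ring.
  rewrite powRN ler_pdivrMr ?powR_gt0 ?addr_gt0// mul1r.
  by apply: ge0_ler_powR; rewrite ?nnegrE; lra.
by rewrite lee_fin; have := F0 s s0; have := F1 t t0; lra.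
Qed.

Lemma expR_ge_pow (n : nat) c : 0 < c -> exists2 C, 0 < C & forall x, 0 <= x -> (1 + x) ^+ n <= C * expR (c * x).
Proof.
move=> c0; elim: n c c0 => [|n IH] c c0.
  exists 1 => // x x0; rewrite expr0 mul1r (le_trans _ (expR_ge1Dx _))// lerDl.
  by rewrite mulr_ge0// ltW.
have c20 : 0 < c / 2 by rewrite divr_gt0.
have [C C0 CH] := IH _ c20; pose K := 1 + (c / 2)^-1.
have K0 : 0 < K by rewrite addr_gt0// invr_gt0.
exists (C * K); first by rewrite mulr_gt0.
move=> x x0; rewrite exprSr.
have -> : C * K * expR (c * x) = (C * expR (c / 2 * x)) * (K * expR (c / 2 * x)).
  have -> : c * x = c / 2 * x + c / 2 * x by field.
  by rewrite expRD; ring.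
apply: ler_pM => //.
- by rewrite exprn_ge0// addr_ge0.
- by rewrite addr_ge0.
- exact: CH.
have h := expR_ge1Dx (c / 2 * x).
have -> : K * expR (c / 2 * x) = expR (c / 2 * x) + (c / 2)^-1 * expR (c / 2 * x) by rewrite /K; ring.
apply: lerD; first by rewrite (le_trans _ h)// lerDl mulr_ge0// ltW.
rewrite -ler_pdivrMl ?invr_gt0// invrK (le_trans _ h)//; lra.
Qed.

Lemma intD_pow_exp a c : -1 < a -> 0 < c -> intD (fun x => x `^ a * expR (- (c * x))).
Proof.
move=> a1 c0.
have [C C0 CH] := expR_ge_pow (Num.bound (`|a| + 2)) c0.
apply: (@intD_le _ _ (fun x => C * (x `^ a * (1 + x) `^ (- a - 2)))).
- apply: continuousD_meas => x; rewrite inE => /inD x0; apply: cvgM.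
    by have := is_derive1_powR a x0 => H; exact: d_continuous H.
  have H : is_derive x 1 (fun x : R => expR (- (c * x))) (- c * expR (- (c * x))).
    by apply: dEq (dExp (dN (dZ c (dId x)))) _; ring.
  exact: d_continuous H.
- move=> x x0; rewrite ger0_norm ?mulr_ge0 ?powR_ge0 ?expR_ge0//.
  rewrite mulrCA ler_wpM2l ?powR_ge0//.
  have x1 : 0 < 1 + x by rewrite addr_gt0.
  have -> : - a - 2 = - (a + 2) by ring.
  rewrite expRN powRN ler_pdivlMr ?powR_gt0// mulrC ler_pdivrMr ?expR_gt0//.
  apply: le_trans (CH x (ltW x0)); rewrite -powR_mulrn ?(ltW x1)//.
  apply: ler_powR; first by lra.
  have := @archi_boundP _ (`|a| + 2); rewrite addr_ge0// => /(_ isT).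
  have := ler_norm a; lra.
- by apply: intD_scale; exact: intD_pow1.
Qed.
End toolkit.

(** * Absolutely continuous functions and growth bounds *)

Section toolkit2.
Context {R : realType}.
Notation mu := (@lebesgue_measure R).
Notation D := (`]0%R, +oo[%classic : set R).
Notation "'I' f" := (\int[mu]_(x in D) (f : R -> R) x) (at level 10, f at level 8).
Implicit Types (f g h F : R -> R) (a b s t x y c : R).
Let mD := @measD R.

Lemma mvt F f s t : s < t -> (forall x, s <= x <= t -> is_derive x 1 F (f x)) ->
  exists2 c, s < c < t & F t - F s = f c * (t - s).
Proof.
move=> st dF; have [||c] := @MVT R F f s t st.
- move=> x; rewrite in_itv/= => /andP[sx xt]; apply: dF.
  by rewrite (ltW sx) (ltW xt).
- apply: derivable_within_continuous => x; rewrite in_itv/= => /dF d.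
  exact: d_derivable d.
by rewrite in_itv/= => cst E; exists c.
Qed.

Lemma lipschitz_abs_cont f df a b (K : R) :
  (forall x, a <= x <= b -> is_derive x 1 f (df x)) ->
  (forall x, a <= x <= b -> `|df x| <= K) -> abs_cont a b f.
Proof.
move=> dfE dfK e e0; pose L := `|K| + 1.
have L0 : 0 < L by rewrite ltr_wpDl.
exists (e / L); first by rewrite divr_gt0.
move=> n s t st _ lt.
apply: (@le_lt_trans _ _ (L * \sum_(i < n) (t i - s i))); last first.
  by rewrite mulrC -ltr_pdivlMr.
rewrite mulr_sumr; apply: ler_sum => i _.
have [asi sti tib] := st i.
move: sti; rewrite le_eqVlt => /predU1P[->|sti]; first by rewrite !subrr normr0 mulr0.
have [x /andP[sx xt] ->] : exists2 c, s i < c < t i & f (t i) - f (s i) = df c * (t i - s i).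
  apply: mvt => // x /andP[sx xt]; apply: dfE.
  by rewrite (le_trans asi sx) (le_trans xt tib).
rewrite normrM [X in _ * X]gtr0_norm ?subr_gt0// ler_wpM2r ?subr_ge0 ?(ltW sti)//.
apply: (@le_trans _ _ K).
  by apply: dfK; rewrite (le_trans asi (ltW sx)) (le_trans (ltW xt) tib).
by rewrite (le_trans (ler_norm _))// lerDl.
Qed.

Lemma continuous_bounded f a b : a <= b -> {within `[a, b], continuous f} ->
  exists K, forall x, a <= x <= b -> `|f x| <= K.
Proof.
move=> ab cf.
have cn : {within `[a, b], continuous (fun x => `|f x|)}.
  by move=> x; apply: continuous_comp; [exact: cf|exact: norm_continuous].
have [c _ H] := EVT_max ab cn; exists `|f c| => x axb; apply: H.
by rewrite in_itv.
Qed.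

Lemma C1_abs_cont f df a b : 0 < a -> a <= b -> {in D, continuous df} ->
  (forall x, 0 < x -> is_derive x 1 f (df x)) -> abs_cont a b f.
Proof.
move=> a0 ab cdf dfE.
have [K HK] := continuous_bounded ab (continuous_oo_cc a0 cdf).
apply: (lipschitz_abs_cont (df := df) (K := K)) => // x /andP[ax _].
by apply: dfE; exact: lt_le_trans ax.
Qed.

Lemma abs_cont_bounded f a b : a <= b -> abs_cont a b f ->
  exists K, forall x, a <= x <= b -> `|f x| <= K.
Proof.
move=> ab acf; have cf := abs_cont_seq_continuous (abs_cont_clamp ab acf).
have [K HK] := @continuous_bounded (f \o clamp a b) a b ab (continuous_subspaceT cf).
by exists K => x axb; have := HK x axb; rewrite /= clamp_id//; case/andP: axb.
Qed.

Lemma abs_cont_add f g a b : abs_cont a b f -> abs_cont a b g ->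
  abs_cont a b (fun x => f x + g x).
Proof.
move=> acf acg e e0; have e20 : 0 < e / 2 by rewrite divr_gt0.
have [d d0 H] := acf _ e20; have [d' d0' H'] := acg _ e20.
exists (Num.min d d'); first by rewrite lt_min d0.
move=> n s t st tI; rewrite lt_min => /andP[Ld Ld'].
have := ltrD (H n s t st tI Ld) (H' n s t st tI Ld'); rewrite -splitr.
apply: le_lt_trans; rewrite -big_split/=; apply: ler_sum => i _.
have -> : f (t i) + g (t i) - (f (s i) + g (s i)) = (f (t i) - f (s i)) + (g (t i) - g (s i)) by ring.
exact: ler_normD.
Qed.

Lemma abs_cont_mul f g a b : a <= b -> abs_cont a b f -> abs_cont a b g ->
  abs_cont a b (fun x => f x * g x).
Proof.
move=> ab acf acg e e0.
have [K HK] := abs_cont_bounded ab acf; have [L HL] := abs_cont_bounded ab acg.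
pose M := `|K| + `|L| + 1; have M0 : 0 < M by rewrite ltr_wpDl// addr_ge0.
have e20 : 0 < e / 2 / M by rewrite !divr_gt0.
have [d d0 H] := acf _ e20; have [d' d0' H'] := acg _ e20.
exists (Num.min d d'); first by rewrite lt_min d0.
move=> n s t st tI; rewrite lt_min => /andP[Ld Ld'].
have := ltrD (H n s t st tI Ld) (H' n s t st tI Ld').
rewrite -mulrDl -splitr ltr_pdivlMr// mulrDl => h; apply: le_lt_trans h.
rewrite mulrC [X in _ + X]mulrC !mulr_sumr -big_split/=; apply: ler_sum => i _.
have [asi sti tib] := st i.
have -> : f (t i) * g (t i) - f (s i) * g (s i) =
  g (t i) * (f (t i) - f (s i)) + f (s i) * (g (t i) - g (s i)) by ring.
rewrite (le_trans (ler_normD _ _))// !normrM; apply: lerD; apply: ler_wpM2r => //.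
  have := HL (t i); rewrite (le_trans asi sti) tib => /(_ isT).
  by have := ler_norm L; have := normr_ge0 K; rewrite /M; lra.
have := HK (s i); rewrite asi (le_trans sti tib) => /(_ isT).
by have := ler_norm K; have := normr_ge0 L; rewrite /M; lra.
Qed.

Lemma abs_cont_cst a b c : abs_cont a b (fun=> c).
Proof.
move=> e e0; exists 1 => // n s t _ _ _.
by rewrite big1// => i _; rewrite subrr normr0.
Qed.

Lemma abs_cont_scale f a b c : a <= b -> abs_cont a b f -> abs_cont a b (fun x => c * f x).
Proof. by move=> ab; apply: abs_cont_mul => //; exact: abs_cont_cst. Qed.

Lemma abs_cont_sub f g a b : a <= b -> abs_cont a b f -> abs_cont a b g ->
  abs_cont a b (fun x => f x - g x).
Proof.
move=> ab acf /(abs_cont_scale (-1) ab) acg; have := abs_cont_add acf acg.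
by congr abs_cont; apply/funext => x; rewrite mulN1r.
Qed.

Lemma abs_cont_ext f g a b : (forall x, a <= x <= b -> f x = g x) ->
  abs_cont a b f -> abs_cont a b g.
Proof.
move=> fg acf e e0; have [d d0 H] := acf e e0; exists d => // n s t st tI L.
apply: le_lt_trans (H n s t st tI L); apply: ler_sum => i _.
have [asi sti tib] := st i.
by rewrite -!fg// ?asi ?tib ?(le_trans sti tib) ?(le_trans asi sti).
Qed.

Lemma sum_J_le h n (s t : 'I_n -> R) : intD h -> (forall x, 0 < x -> 0 <= h x) ->
  (forall i, 0 <= s i) -> trivIset setT (fun i => `]s i, t i[%classic) ->
  \sum_(i < n) J h (s i) (t i) <= I h.
Proof.
move=> ih h0 s0 tI.
have sD i : `]s i, t i[%classic `<=` D.
  by apply: subset_trans (@oc_D R (s i) (t i) (s0 i)); exact: subset_itv_oo_oc.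
have JE i : (J h (s i) (t i))%:E = (\int[mu]_(x in `]s i, t i[) (h x)%:E)%E.
  rewrite /J -Rintegral_itv_bndo_bndc ?/Rintegral ?fineK//.
    by apply: integrable_fin_num => //; exact: intD_itv.
  by apply: intD_itv => //.
have UD : \big[setU/set0]_(i <- enum 'I_n) `]s i, t i[%classic `<=` D.
  by rewrite -bigcup_seq; apply: bigcup_sub => i _; exact: sD.
rewrite -lee_fin -sumEFin -(IE ih) (eq_bigr _ (fun i _ => JE i)) -big_enum/=.
rewrite -(@ge0_integral_bigsetU _ (measurableTypeR R) R mu 'I_n (fun i => `]s i, t i[%classic) (EFin \o h)).
- apply: ge0_subset_integral => //.
  + apply: bigsetU_measurable => i _; exact: measurable_itv.
  + by case/integrableP: ih.
  + by move=> x /inD x0; rewrite lee_fin h0.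
- by move=> i; exact: measurable_itv.
- exact: enum_uniq.
- exact: sub_trivIset tI.
- case/integrableP: ih => + _; apply: measurable_funS => //.
- move=> x xU; rewrite lee_fin h0//; exact/inD/UD.
Qed.

Lemma J_norm h s t : intD h -> 0 <= s -> `|J h s t| <= J (fun x => `|h x|) s t.
Proof.
move=> ih s0; apply: le_normr_Rintegral => //.
by apply: intD_itv => //; exact: oc_D.
Qed.

Lemma intD_norm h : intD h -> intD (fun x => `|h x|).
Proof. by move=> ih; have := integrable_norm ih. Qed.

(** An integrable function is bounded up to a part of small integral: the source
    of the absolute continuity of indefinite integrals. *)
Lemma intD_tail h e : intD h -> 0 < e -> exists2 K : R, 0 < K &
  exists2 g, intD g & [/\ forall x, 0 < x -> 0 <= g x,
     forall x, 0 < x -> `|h x| <= K + g x & I g <= e].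
Proof.
move=> ih e0; have iH := intD_norm ih.
pose F (n : nat) x := if `|h x| <= n%:R then 0 else `|h x|.
have mF n : measurable_fun D (F n).
  apply: measurable_fun_if => //.
    by apply: (@measurable_fun_ler _ _ _ _ (fun x => `|h x|) (cst n%:R)) => //; exact: intD_meas.
  by apply: measurable_funS (intD_meas iH) => // x [].
have FH n x : 0 < x -> `|F n x| <= `|h x|.
  by move=> _; rewrite /F; case: ifP; rewrite ?normr0// normr_id.
have iF n : intD (F n) by exact: intD_le (mF n) (FH n) iH.
have [|||||_] := @dct _ F (fun=> 0) (fun x => `|h x|) => //.
  move=> x x0; apply: cvg_near_cst; exists (Num.bound `|h x|) => // n /= bn.
  rewrite /F ifT//; apply: ltW; apply: lt_le_trans (archi_boundP (normr_ge0 _)) _.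
  by rewrite ler_nat.
rewrite I0 => /cvgrPdist_le/(_ _ e0)[N _ HN].
exists (N%:R + 1); first by rewrite ltr_wpDl.
exists (F N) => //; split.
- by move=> x _; rewrite /F; case: ifP.
- move=> x _; rewrite /F; case: ifP => hN; last by rewrite lerDr addr_ge0.
  by rewrite addr0 (le_trans hN)// lerDl.
- by have := HN N (leqnn N); rewrite sub0r normrN; apply: le_trans; exact: ler_norm.
Qed.

Lemma abs_cont_J h a b : intD h -> 0 <= a -> abs_cont a b (J h 0).
Proof.
move=> ih a0 e e0; have e20 : 0 < e / 2 by rewrite divr_gt0.
have [K K0 [g ig [g0 hK gE]]] := intD_tail ih e20.
exists (e / 2 / K); first by rewrite divr_gt0.
move=> n s t st tI L.
have H i : `|J h 0 (t i) - J h 0 (s i)| <= K * (t i - s i) + J g (s i) (t i).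
  have [asi sti _] := st i; have si0 := le_trans a0 asi.
  rewrite (J_cat ih si0 sti) addrC addKr (le_trans (J_norm _ ih si0))//.
  have igi : mu.-integrable `]s i, t i] (EFin \o g) by apply: intD_itv => //; exact: oc_D.
  have iK : mu.-integrable `]s i, t i] (EFin \o (fun=> K : R)).
    apply: (@integrableS _ _ _ mu `[s i, t i]%classic) => //; first exact: subset_itv_oc_cc.
    apply: continuous_compact_integrable; first exact: segment_compact.
    by apply: continuous_subspaceT => x; exact: cvg_cst.
  have -> : K * (t i - s i) = \int[mu]_(x in `]s i, t i]) K.
    rewrite Rintegral_cst//= lebesgue_measure_itv/=; case: ifPn => //.
    rewrite lte_fin -leNgt => ts; have -> : t i = s i by apply: le_anti; rewrite ts sti.
    by rewrite subrr.
  rewrite /J -RintegralD//; apply: le_Rintegral => //.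
  - by apply: intD_itv; [exact: oc_D|exact: intD_norm].
  - have mst : measurable (`]s i, t i]%classic : set (measurableTypeR R)) by exact: measurable_itv.
    by have := integrableD mst iK igi; apply: eq_integrable.
  - by move=> x /(oc_D si0)/inD; exact: hK.
apply: le_lt_trans (ler_sum _ (fun i _ => H i)) _.
rewrite big_split/= -mulr_sumr [ltRHS](splitr e); apply: ltr_leD.
  by rewrite mulrC -ltr_pdivlMr.
apply: le_trans gE; apply: sum_J_le => // i.
by have [asi _ _] := st i; exact: le_trans asi.
Qed.

Lemma J_derive_ae h : intD h -> aeD (fun x => is_derive x 1 (J h 0) (h x)).
Proof.
move=> ih; pose h' := h \_ D.
have loch : locally_integrable setT h' by exact: integrable_locally.
have ih' : mu.-integrable setT (EFin \o h').
  by rewrite -restrict_EFin; apply/(integrable_mkcond _ mD).1.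
have JE : (fun y => \int[mu]_(t in [set` Interval (BRight 0) (BRight y)]) h' t) = J h 0.
  apply/funext => y; apply: eq_Rintegral => t; rewrite inE => /(@oc_D R 0 y (lexx _)) tD.
  by rewrite /h' patchE mem_set.
have := @FTC1 R h' (BRight 0) (fun y => _) loch; rewrite JE => H.
rewrite /aeD; have ? := ae_filter_ringOfSetsType mu.
apply: filterS (H _) => [x {}H x0|y]; last first.
  by apply: (integrableS measurableT) => //; exact: measurable_itv.
have [dJ JE'] := H ltac:(by rewrite lte_fin).
split => //; rewrite -derive1E JE' /h' patchE mem_set//; exact/inD.
Qed.

Lemma J_derive h x : intD h -> 0 < x -> {for x, continuous h} -> is_derive x 1 (J h 0) (h x).
Proof.
move=> ih x0 ch; have xu : x < x + 1 by rewrite ltrDl.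
have ihu : mu.-integrable [set` Interval (BRight 0) (BRight (x + 1))] (EFin \o h).
  by apply: intD_itv => //; exact: oc_D.
have [] := @continuous_FTC1 R h (BRight 0) x (x + 1) xu ihu _ ch; first by rewrite lte_fin.
by move=> d1 d2; split; [exact: d1|rewrite -derive1E; exact: d2].
Qed.

Lemma antiderivative g : {in D, continuous g} ->
  exists F, forall x, 0 < x -> is_derive x 1 F (g x).
Proof.
move=> cg.
have ig c y : 0 < c -> mu.-integrable `]c, y] (EFin \o g).
  move=> c0; apply: (@integrableS _ _ _ mu `[c, y]%classic) => //; first exact: subset_itv_oc_cc.
  exact: intcc_continuous.
have Jc c c' y : 0 < c -> c <= c' -> c' <= y -> J g c y = J g c c' + J g c' y.
  move=> c0 cc' c'y; rewrite /J.
  have := @Rintegral_itvB R g (BRight c) (BRight y) c' (ig c y c0).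
  by rewrite !bnd_simp => /(_ cc' c'y) <-; rewrite addrC subrK.
pose c x := Num.min x 1 / 2.
pose F x := J g (c x) x - J g (c x) 1.
have FE d x : 0 < d -> d <= x -> d <= 1 -> 0 < x -> F x = J g d x - J g d 1.
  move=> d0 dx d1 x0; have c0 : 0 < c x by rewrite divr_gt0// lt_min x0 ltr01.
  have cm : c x <= Num.min x 1 by rewrite ler_pdivrMr// ler_peMr ?ler1n// ?le_min ?(ltW x0) ?ler01.
  have /andP[cx c1] : (c x <= x) && (c x <= 1) by move: cm; rewrite le_min.
  rewrite /F; have [cd|dc] := leP (c x) d.
    by rewrite (Jc _ _ _ c0 cd dx) (Jc _ _ _ c0 cd d1); ring.
  by rewrite (Jc _ _ _ d0 (ltW dc) cx) (Jc _ _ _ d0 (ltW dc) c1); ring.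
exists F => x x0.
pose d := c x; have d0 : 0 < d by rewrite divr_gt0// lt_min x0 ltr01.
have dm : d < Num.min x 1 by rewrite ltr_pdivrMr// ltr_pMr ?ltr1n// lt_min x0 ltr01.
have /andP[dx d1] : (d < x) && (d < 1) by move: dm; rewrite lt_min.
have ixu : mu.-integrable [set` Interval (BRight d) (BRight (x + 1))] (EFin \o g) by exact: ig.
have xu : x < x + 1 by rewrite ltrDl.
have cgx : {for x, continuous g} by apply: cg; rewrite inE; exact/inD.
have [] := @continuous_FTC1 R g (BRight d) x (x + 1) xu ixu _ cgx; first by rewrite lte_fin.
rewrite -[X in derivable X]/(J g d) -[X in derive1 X]/(J g d) => dJ JE.
have dJ' : is_derive x 1 (J g d) (g x) by split; [exact: dJ|rewrite -derive1E; exact: JE].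
have := dB dJ' (dC x (J g d 1)); rewrite subr0.
apply: near_eq_is_derive; near=> y.
rewrite (FE d y) ?(ltW d1)//.
  by apply: ltW; near: y; exact: lt_nbhsr.
by near: y; exact: lt_nbhsr.
Unshelve. all: by end_near. Qed.

Lemma poly_pow_bound (p : {poly R}) : exists2 C : R, 0 < C &
  forall x, 0 <= x -> `|p.[x]| <= C * (1 + x) ^+ (size p).
Proof.
exists (1 + \sum_(i < size p) `|p`_i|); first by rewrite ltr_wpDr// sumr_ge0.
move=> x x0; rewrite horner_coef (le_trans (ler_norm_sum _ _ _))//.
have x1 : 1 <= 1 + x by rewrite lerDl.
apply: (@le_trans _ _ ((\sum_(i < size p) `|p`_i|) * (1 + x) ^+ size p)); last first.
  by rewrite ler_wpM2r ?exprn_ge0 ?lerDr ?addr_ge0.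
rewrite mulr_suml; apply: ler_sum => i _; rewrite normrM ler_wpM2l//.
rewrite normrX ger0_norm//; apply: (@le_trans _ _ ((1 + x) ^+ i)).
  by rewrite lerXn2r ?nnegrE ?addr_ge0 ?lerDr.
by rewrite ler_weXn2l// ltnW.
Qed.

Lemma poly_exp_bound (p : {poly R}) c : 0 < c -> exists2 C : R, 0 < C &
  forall x, 0 <= x -> `|p.[x]| <= C * expR (c * x).
Proof.
move=> c0; have [C C0 HC] := poly_pow_bound p; have [K K0 HK] := expR_ge_pow (size p) c0.
exists (C * K); first by rewrite mulr_gt0.
move=> x x0; apply: le_trans (HC x x0) _; rewrite -mulrA ler_wpM2l ?(ltW C0)//.
exact: HK.
Qed.

Lemma poly_lower (p : {poly R}) : p != 0 -> exists X c, [/\ 0 < X, 0 < c &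
  forall x, X <= x -> c <= `|p.[x]|].
Proof.
elim/poly_ind: p => [|p r IH]; first by rewrite eqxx.
have [->|p0 _] := eqVneq p 0.
  rewrite mul0r add0r polyC_eq0 => r0; exists 1, `|r|; split => //.
    by rewrite normr_gt0.
  by move=> x _; rewrite hornerC.
have [X [c [X0 c0 H]]] := IH p0.
exists (X + (1 + `|r| / c)), c; split => //.
  by rewrite addr_gt0// ltr_pwDl// divr_ge0// ltW.
move=> x xX; have rc : 0 <= `|r| / c by rewrite divr_ge0// ltW.
have Xx : X <= x by lra.
rewrite !hornerE; apply: le_trans (lerB_normD _ _).
rewrite normrM (ger0_norm (le_trans (ltW X0) Xx)) lerBrDr.
apply: (@le_trans _ _ (c * x)); last first.
  by rewrite ler_wpM2r ?H// (le_trans (ltW X0)).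
have -> : c + `|r| = c * (1 + `|r| / c) by rewrite mulrDr mulr1 mulrCA divff ?mulr1// gt_eqF.
by rewrite ler_wpM2l ?(ltW c0)//; lra.
Qed.

Lemma poly_continuous (p : {poly R}) : {in D, continuous (fun x => p.[x])}.
Proof. by move=> x _; exact: d_continuous (dPoly p x). Qed.

Lemma pow_continuous a : {in D, continuous (fun x => x `^ a)}.
Proof. by move=> x; rewrite inE => /inD x0; exact: d_continuous (dPow a x0). Qed.

Lemma intD_bound h a c (C : R) : -1 < a -> 0 < c -> measurable_fun D h ->
  (forall x, 0 < x -> `|h x| <= C * (x `^ a * expR (- (c * x)))) -> intD h.
Proof. by move=> a1 c0 mh H; apply: intD_le mh H _; apply: intD_scale; exact: intD_pow_exp. Qed.

(** The set where two continuous functions differ is open, hence not null unless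
    empty. *)
Lemma aeD_eq_continuous f g : {in D, continuous f} -> {in D, continuous g} ->
  aeD (fun x => f x = g x) -> forall x, 0 < x -> f x = g x.
Proof.
move=> cf cg [N [mN N0 HN]] x x0; apply/eqP/negPn/negP => fg.
have Dx : x \in (D : set R) by rewrite inE; exact/inD.
have cfg : {for x, continuous (fun y => f y - g y)} by apply: cvgB; [exact: cf|exact: cg].
have n0 : \forall y \near x, f y - g y != 0.
  by apply: cvgr_neq0 cfg _; rewrite subr_eq0.
have [e /= e0 He] : \forall y \near x, f y - g y != 0 /\ 0 < y.
  by apply: filterI => //; exact: lt_nbhsr.
have le : (mu (ball x e) <= mu N)%E.
  apply: le_measure; rewrite ?inE//; first exact: measurable_ball.
  move=> y /He[fgy y0]; apply: HN => /= /(_ y0) E.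
  by move: fgy; rewrite E subrr eqxx.
have {le} : ((e *+ 2)%:E <= mu N)%E by rewrite -(lebesgue_measure_ball x (ltW e0)).
by rewrite N0 lee_fin leNgt pmulrn_lgt0// e0.
Qed.
End toolkit2.

(** * Determinacy of the moment problem *)

Section moments.
Context {R : realType}.
Notation mu := (@lebesgue_measure R).
Notation D := (`]0%R, +oo[%classic : set R).
Notation "'I' f" := (\int[mu]_(x in D) (f : R -> R) x) (at level 10, f at level 8).
Implicit Types (x y b c d s u : R) (p : {poly R}).
Let mD := @measD R.

Lemma bernoulli_le u (N : nat) : 0 <= u <= 1 -> 1 - N%:R * u <= (1 - u) ^+ N.
Proof.
move=> /andP[u0 u1]; elim: N => [|N IH]; first by rewrite mul0r subr0 expr0.
rewrite exprSr; apply: (@le_trans _ _ ((1 - N%:R * u) * (1 - u))); last first.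
  by rewrite ler_wpM2r// subr_ge0.
have -> : (1 - N%:R * u) * (1 - u) = 1 - N.+1%:R * u + N%:R * u ^+ 2 by rewrite -natr1; ring.
by rewrite lerDl mulr_ge0 ?sqr_ge0.
Qed.

Lemma bernoulli_ge u (N : nat) : 0 <= u <= 1 -> (1 - u) ^+ N * (1 + N%:R * u) <= 1.
Proof.
move=> /andP[u0 u1].
have B : 1 + N%:R * u <= (1 + u) ^+ N.
  elim: N => [|N IH]; first by rewrite mul0r addr0 expr0.
  rewrite exprSr; apply: (@le_trans _ _ ((1 + N%:R * u) * (1 + u))); last first.
    by rewrite ler_wpM2r// addr_ge0.
  have -> : (1 + N%:R * u) * (1 + u) = 1 + N.+1%:R * u + N%:R * u ^+ 2 by rewrite -natr1; ring.
  by rewrite lerDl mulr_ge0 ?sqr_ge0.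
apply: (@le_trans _ _ ((1 - u) ^+ N * (1 + u) ^+ N)).
  by rewrite ler_wpM2l// exprn_ge0// subr_ge0.
by rewrite -exprMn exprn_ile1//; nra.
Qed.

(** With Bernoulli's inequality, the polynomials (1 - y^n)^(2^n) tend to 1 below
    1/2 and to 0 above. In y = e^(- s x) they approximate indicators of
    half-lines, boundedly on [0, 1]. *)
Lemma cvg_threshold_lt y : 0 < y < 2^-1 -> (1 - y ^+ n) ^+ (2 ^ n) @[n --> \oo] --> (1 : R).
Proof.
move=> /andP[y0 y2].
have c : 1 - (2 * y) ^+ n @[n --> \oo] --> (1 : R).
  rewrite -[X in _ --> X]subr0; apply: cvgB; first exact: cvg_cst.
  by apply: cvg_expr; rewrite gtr0_norm ?mulr_gt0//; lra.
apply: (@squeeze_cvgr _ _ _ _ (fun n => 1 - (2 * y) ^+ n) (fun=> 1)) => //; last exact: cvg_cst.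
apply: nearW => n.
have yn : 0 <= y ^+ n <= 1 by rewrite exprn_ge0 ?(ltW y0)// exprn_ile1 ?(ltW y0)//; lra.
have := bernoulli_le (2 ^ n) yn; rewrite natrX exprMn => ->/=.
have /andP[y1 y3] := yn; rewrite exprn_ile1 ?subr_ge0//; lra.
Qed.

Lemma cvg_threshold_gt y : 2^-1 < y < 1 -> (1 - y ^+ n) ^+ (2 ^ n) @[n --> \oo] --> (0 : R).
Proof.
move=> /andP[y0 y2].
have y1 : 0 < y by apply: lt_trans y0.
have c : (2 * y)^-1 ^+ n @[n --> \oo] --> (0 : R).
  apply: cvg_expr; rewrite gtr0_norm ?invr_gt0 ?mulr_gt0//.
  by rewrite invf_lt1 ?mulr_gt0//; lra.
apply: (@squeeze_cvgr _ _ _ _ (fun=> 0) (fun n => (2 * y)^-1 ^+ n)) => //; last exact: cvg_cst.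
apply: nearW => n.
have yn : 0 <= y ^+ n <= 1 by rewrite exprn_ge0 ?(ltW y1)// exprn_ile1 ?(ltW y1)// ltW.
have := bernoulli_ge (2 ^ n) yn; rewrite natrX => H.
have /andP[yn0 yn1] := yn; rewrite exprn_ge0 ?subr_ge0//=.
have p0 : 0 < (2 * y) ^+ n by rewrite exprn_gt0// mulr_gt0.
rewrite exprVn -[leRHS]mul1r ler_pdivlMr//; apply: le_trans H; rewrite ler_wpM2l ?exprn_ge0 ?subr_ge0// exprMn lerDr//.
Qed.

Lemma aeD_neq b : aeD (fun x => x != b).
Proof.
exists [set b]; split.
- exact: measurable_set1.
- exact: lebesgue_measure_set1.
- by move=> x /= h; apply: contrapT => xb; apply: h => _; apply/eqP.
Qed.

Variable h : R -> R.
Variable delta : R.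
Hypothesis mh : measurable_fun D h.
Hypothesis d0 : 0 < delta.
Hypothesis ih : intD (fun x => `|h x| * expR (delta * x)).
Hypothesis mom : forall p, I (fun x => h x * p.[x]) = 0.

Let mexp c : measurable_fun D (fun x => expR (c * x)).
Proof. by apply: continuousD_meas => x _; exact: d_continuous (dExp (dZ c (dId x))). Qed.

Let mpoly p : measurable_fun D (fun x => p.[x]).
Proof. by apply: continuousD_meas; exact: poly_continuous. Qed.

(** The exponential moments of h times a polynomial; they are shown to vanish for
    all s, although only s = 0 is given. *)
Definition exp_moment s : Prop := forall p, I (fun x => h x * p.[x] * expR (- s * x)) = 0.

Lemma exp_moment_intD s p : 0 <= s -> intD (fun x => h x * p.[x] * expR (- s * x)).
Proof.
move=> s0; have [C C0 HC] := poly_exp_bound p d0.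
apply: intD_le (intD_scale C ih).
- by apply: measurable_funM => //; exact: measurable_funM.
- move=> x x0; rewrite !normrM [X in _ * X]ger0_norm ?expR_ge0//.
  rewrite mulrCA -mulrA ler_wpM2l//.
  apply: (@le_trans _ _ `|p.[x]|); last by apply: HC; exact: ltW.
  by rewrite ler_piMr// expR_le1 mulNr oppr_le0 mulr_ge0// ltW.
Qed.

Lemma exp_moment0 : exp_moment 0.
Proof.
move=> p; rewrite -[RHS](mom p); apply: I_eq => x _.
by rewrite oppr0 mul0r expR0 mulr1.
Qed.

Definition taylor_exp d (N : nat) : {poly R} := \poly_(i < N) ((- d) ^+ i / i`!%:R).

Lemma taylor_expE d N x : (taylor_exp d N).[x] = series (exp_coeff (- d * x)) N.
Proof.
rewrite horner_poly /series/= big_mkord; apply: eq_bigr => i _.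
by rewrite /exp_coeff/= exprMn; ring.
Qed.

Lemma taylor_exp_bound d N x : 0 <= d -> 0 <= x -> `|(taylor_exp d N).[x]| <= expR (d * x).
Proof.
move=> d0' x0; have dx0 : 0 <= d * x by rewrite mulr_ge0.
apply: (@le_trans _ _ (series (exp_coeff (d * x)) N)).
  rewrite taylor_expE /series/= (le_trans (ler_norm_sum _ _ _))// ler_sum// => i _.
  by rewrite /exp_coeff/= mulNr normrM normrX normrN (ger0_norm dx0) ger0_norm// invr_ge0.
apply: nondecreasing_cvgn_le; last exact: is_cvg_series_exp_coeff.
by apply: nondecreasing_series => i _ _; rewrite /exp_coeff/= divr_ge0// exprn_ge0.
Qed.

(** The Taylor polynomials of e^(- d x) are bounded by e^(d x), which the decay of h
    absorbs when d <= delta / 2; so s can be increased in steps of fixed size. *)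
Lemma exp_moment_step s d : 0 <= s -> 0 <= d <= delta / 2 -> exp_moment s -> exp_moment (s + d).
Proof.
move=> s0 /andP[d0' dd] Hs p.
have [C C0 HC] := poly_exp_bound p (divr_gt0 d0 (ltr0Sn R 1)).
have [|||||_] := @dct R (fun N x => h x * (p * taylor_exp d N).[x] * expR (- s * x))
   (fun x => h x * p.[x] * expR (- (s + d) * x)) (fun x => C * (`|h x| * expR (delta * x))).
- by move=> N; apply: measurable_funM => //; exact: measurable_funM.
- by apply: measurable_funM => //; exact: measurable_funM.
- move=> x x0; have -> : - (s + d) * x = - d * x + - s * x by ring.
  rewrite expRD mulrA; apply: cvgMl.
  under eq_fun do rewrite hornerM mulrA.
  apply: cvgMr; under eq_fun do rewrite taylor_expE.
  exact: is_cvg_series_exp_coeff.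
- move=> N x x0; rewrite hornerM !normrM [X in _ * X]ger0_norm ?expR_ge0//.
  rewrite -mulrA [leRHS]mulrCA ler_wpM2l//.
  have -> : delta * x = delta / 2 * x + delta / 2 * x by field.
  rewrite expRD mulrA -[leLHS]mulrA; apply: ler_pM => //.
    by apply: HC; exact: ltW.
  apply: (@le_trans _ _ (expR (d * x) * 1)).
    apply: ler_pM; rewrite ?expR_ge0//; first by apply: taylor_exp_bound => //; exact: ltW.
    by rewrite expR_le1 mulNr oppr_le0 mulr_ge0// ltW.
  by rewrite mulr1 ler_expR ler_wpM2r// ltW.
- exact: intD_scale.
rewrite (_ : (fun n => _) = fun=> 0); last by apply/funext => N; exact: Hs.
by move=> c; rewrite (cvg_unique _ c (cvg_cst 0)).
Qed.

Lemma exp_moment_all s : 0 <= s -> exp_moment s.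
Proof.
have H (k : nat) : forall s, 0 <= s -> s <= k%:R * (delta / 2) -> exp_moment s.
  elim: k => [|k IH] {}s s0 sk.
    have -> : s = 0 by apply: le_anti; rewrite s0 andbT; move: sk; rewrite mul0r.
    exact: exp_moment0.
  have [sd|ds] := leP s (delta / 2).
    by rewrite -[s]add0r; apply: exp_moment_step => //; rewrite ?s0//; exact: exp_moment0.
  rewrite -[s](subrK (delta / 2)); apply: exp_moment_step.
  - by rewrite subr_ge0 ltW.
  - by rewrite lexx andbT divr_ge0// ltW.
  - apply: IH; first by rewrite subr_ge0 ltW.
    by move: sk; rewrite -natr1 mulrDl mul1r; lra.
move=> s0; apply: (H (Num.bound (s / (delta / 2)))) => //.
rewrite -ler_pdivrMr ?divr_gt0//; apply/ltW/archi_boundP.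
by rewrite divr_ge0// divr_ge0// ltW.
Qed.

Lemma exp_poly_moment s p : 0 <= s -> I (fun x => h x * p.[expR (- s * x)]) = 0.
Proof.
move=> s0.
have E (i : nat) x : h x * expR (- s * x) ^+ i = h x * 1.[x] * expR (- (i%:R * s) * x).
  by rewrite hornerC mulr1 -expRM_natl; congr (_ * expR _); ring.
have iE i : intD (fun x => h x * expR (- s * x) ^+ i).
  apply: intD_eq (exp_moment_intD 1 (mulr_ge0 (ler0n R i) s0)) => x _.
  by rewrite E.
have IEi i : I (fun x => h x * expR (- s * x) ^+ i) = 0.
  rewrite -[RHS](exp_moment_all (mulr_ge0 (ler0n R i) s0) 1).
  by apply: I_eq => x _; rewrite E.
have [i0 I00] : intD (fun x => h x * p.[expR (- s * x)]) /\ I (fun x => h x * p.[expR (- s * x)]) = 0.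
  suff H N : intD (fun x => \sum_(i < N) p`_i * (h x * expR (- s * x) ^+ i)) /\
     I (fun x => \sum_(i < N) p`_i * (h x * expR (- s * x) ^+ i)) = 0.
    have HE x : \sum_(i < size p) p`_i * (h x * expR (- s * x) ^+ i) = h x * p.[expR (- s * x)].
      by rewrite horner_coef mulr_sumr; apply: eq_bigr => i _; ring.
    have [H1 H2] := H (size p); split.
      by apply: intD_eq H1 => x _; rewrite HE.
    by rewrite -[RHS]H2; apply: I_eq => x _; rewrite HE.
  elim: N => [|N [IH1 IH2]].
    split; first by apply: intD_eq (intD0 (R := R)) => x _; rewrite big_ord0.
    by rewrite -[RHS](I0 (R := R)); apply: I_eq => x _; rewrite big_ord0.
  have H3 := intD_scale p`_N (iE N).
  split; first by apply: intD_eq (intD_add IH1 H3) => x _; rewrite big_ord_recr.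
  rewrite (I_eq (g := fun x => \sum_(i < N) p`_i * (h x * expR (- s * x) ^+ i) + p`_N * (h x * expR (- s * x) ^+ N))).
    by rewrite I_add// IH2 I_scale// IEi mulr0 addr0.
  by move=> x _; rewrite big_ord_recr.
exact: I00.
Qed.

Lemma intD_h : intD h.
Proof.
apply: intD_le mh _ ih => x x0; rewrite ler_peMr// (le_trans _ (expR_ge1Dx _))// lerDl.
by rewrite mulr_ge0// ltW.
Qed.

(** The thresholds at y = 1/2 become thresholds at x = b for s = ln 2 / b. The
    value at b itself, where the limit is neither 0 nor 1, is changed to 0. *)
Lemma J_moment0 b : 0 < b -> J h 0 b = 0.
Proof.
move=> b0; have ihh := intD_h.
pose s := ln 2 / b; have ln2 : 0 < ln (2 : R) by rewrite ln_gt0 ?ltr1n.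
have s0 : 0 < s by rewrite divr_gt0.
pose q n : {poly R} := (1 - 'X ^+ n) ^+ (2 ^ n).
have qE n y : (q n).[y] = (1 - y ^+ n) ^+ (2 ^ n) by rewrite /q !hornerE.
have e01 x : 0 < x -> 0 < expR (- s * x) < 1.
  by move=> x0; rewrite expR_gt0 expR_lt1 mulNr oppr_lt0 mulr_gt0.
have sb : expR (- s * b) = 2^-1.
  by rewrite mulNr /s divfK ?gt_eqF// expRN lnK// posrE.
pose hb x := if x == b then 0 else h x.
have mhb : measurable_fun D hb.
  apply: measurable_fun_if => //.
    by apply: (measurable_fun_eqr (f := id) (g := cst b)).
  by apply: measurable_funS mh => // x [].
have hhb : aeD (fun x => h x = hb x).
  by apply: aeD_filter (aeD_neq b) => x _ /negPf xb; rewrite /hb xb.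
have [|||||_] := @dct R (fun n x => hb x * (q n).[expR (- s * x)])
   (fun x => if x <= b then 0 else h x) (fun x => `|h x|).
- move=> n; apply: measurable_funM => //.
  apply: (measurableT_comp (f := horner (q n))) => //.
  by apply: continuous_measurable_fun => x; exact: d_continuous (dPoly (q n) x).
- apply: measurable_fun_if => //; first exact: measurable_cut.
  by apply: measurable_funS mh => // x [].
- move=> x x0; rewrite /hb; have /andP[e0 e1] := e01 x x0.
  case: (ltgtP x b) => xb.
  + rewrite -[X in _ --> X](mulr0 (h x)); apply: cvgMr; under eq_fun do rewrite qE.
    apply: cvg_threshold_gt; rewrite e1 andbT -sb ltr_expR.
    by rewrite !mulNr ltrN2 ltr_pM2l.
  + rewrite -[X in _ --> X](mulr1 (h x)); apply: cvgMr; under eq_fun do rewrite qE.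
    apply: cvg_threshold_lt; rewrite e0 -sb ltr_expR.
    by rewrite !mulNr ltrN2 ltr_pM2l.
  + by under eq_fun do rewrite mul0r; exact: cvg_cst.
- move=> n x x0; have /andP[e0 e1] := e01 x x0.
  rewrite normrM /hb; case: ifP => _; first by rewrite normr0 mul0r.
  rewrite ler_piMr// qE normrX exprn_ile1//.
  have en1 : expR (- s * x) ^+ n <= 1 by rewrite exprn_ile1// ltW.
  have en0 : 0 <= expR (- s * x) ^+ n by rewrite exprn_ge0// ltW.
  by rewrite ger0_norm ?subr_ge0//; lra.
- exact: intD_norm.
rewrite (_ : (fun n => _) = fun=> 0); last first.
  apply/funext => n; rewrite -[RHS](exp_poly_moment (q n) (ltW s0)).
  apply: I_ae.
  - apply: measurable_funM => //.
    apply: (measurableT_comp (f := horner (q n))) => //.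
    by apply: continuous_measurable_fun => x; exact: d_continuous (dPoly (q n) x).
  - apply: measurable_funM => //.
    apply: (measurableT_comp (f := horner (q n))) => //.
    by apply: continuous_measurable_fun => x; exact: d_continuous (dPoly (q n) x).
  - by apply: aeD_filter hhb => x _ ->.
move=> c0; have E := cvg_unique (@Rhausdorff R) c0 (cvg_cst 0).
have I_h : I h = 0.
  by rewrite -[RHS](mom 1); apply: I_eq => x _; rewrite hornerC mulr1.
rewrite J_indic; have ic := intD_cut b ihh.
have := I_sub ihh ic; rewrite I_h sub0r.
rewrite (I_eq (g := fun x => if x <= b then 0 else h x)); last first.
  by move=> x _; case: ifP; rewrite ?subrr ?subr0.
by rewrite E => /esym/eqP; rewrite oppr_eq0 => /eqP.
Qed.

(** A function with exponential decay is determined almost everywhere by its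
    polynomial moments: all its integrals over ]0, b] vanish. *)
Theorem moments_zero : aeD (fun x => h x = 0).
Proof.
apply: aeD_filter (J_derive_ae intD_h) => x x0 dJ.
rewrite -(d_derive1 dJ); have : is_derive x 1 (J h 0) 0.
  have := dC x (0 : R); apply: near_eq_is_derive.
  near=> y; rewrite J_moment0//; near: y; exact: lt_nbhsr.
exact: d_derive1.
Unshelve. all: by end_near. Qed.
End moments.

(** * Sturm-Liouville operators in divergence form *)

Section sturm_liouville.
Context {R : realType}.
Notation mu := (@lebesgue_measure R).
Notation D := (`]0%R, +oo[%classic : set R).
Notation "'I' f" := (\int[mu]_(x in D) (f : R -> R) x) (at level 10, f at level 8).
Implicit Types (f g u v w : R -> R) (a b c s t x y : R).
Let mD := @measD R.

Lemma abs_cont_continuous f a b x : a < x < b -> abs_cont a b f -> {for x, continuous f}.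
Proof.
move=> /andP[ax xb] acf; have ab := ltW (lt_trans ax xb).
have cf : {for x, continuous (f \o clamp a b)}.
  exact: (abs_cont_seq_continuous (abs_cont_clamp ab acf)).
have E y : a < y < b -> (f \o clamp a b) y = f y.
  by move=> /andP[ay yb]; rewrite /= clamp_id// ltW.
have nE : \forall y \near x, (f \o clamp a b) y = f y.
  near=> y; apply: E; apply/andP; split; near: y; [exact: lt_nbhsr|exact: lt_nbhsl].
have : (f \o clamp a b) y @[y --> x] --> f x by rewrite -E ?ax//; exact: cf.
apply: cvg_trans; apply: near_eq_cvg; exact: nE.
Unshelve. all: by end_near. Qed.

Lemma J_sub f g s t : intD f -> intD g -> 0 <= s -> J (fun x => f x - g x) s t = J f s t - J g s t.
Proof.
move=> fi gi s0; rewrite /J RintegralB//; apply: intD_itv => //; exact: oc_D.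
Qed.

Lemma J_add f g s t : intD f -> intD g -> 0 <= s -> J (fun x => f x + g x) s t = J f s t + J g s t.
Proof.
move=> fi gi s0; rewrite /J RintegralD//; apply: intD_itv => //; exact: oc_D.
Qed.

Lemma J_scale c f s t : intD f -> 0 <= s -> J (fun x => c * f x) s t = c * J f s t.
Proof. by move=> fi s0; rewrite /J RintegralZl//; apply: intD_itv => //; exact: oc_D. Qed.

Lemma J_ext f g s t : 0 <= s -> (forall x, 0 < x -> f x = g x) -> J f s t = J g s t.
Proof. by move=> s0 fg; apply: eq_Rintegral => x; rewrite inE => /(oc_D s0)/inD/fg. Qed.

Lemma J_ae f g t : intD f -> intD g -> aeD (fun x => f x = g x) -> J f 0 t = J g 0 t.
Proof.
move=> fi gi fg; rewrite !J_indic; apply: I_ae.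
- exact: intD_meas (intD_cut t fi).
- exact: intD_meas (intD_cut t gi).
- by apply: aeD_filter fg => x _ ->.
Qed.

Variables W p q dp : R -> R.
Variable Kq : R.
Hypothesis cW : {in D, continuous W}.
Hypothesis W0 : forall x, 0 < x -> 0 < W x.
Hypothesis p0 : forall x, 0 < x -> 0 < p x.
Hypothesis dpE : forall x, 0 < x -> is_derive x 1 p (dp x).
Hypothesis cdp : {in D, continuous dp}.
Hypothesis cq : {in D, continuous q}.
Hypothesis qK : forall x, 0 < x -> `|q x| <= Kq.
Hypothesis iW : intD W.

Let mW : measurable_fun D W. Proof. exact: continuousD_meas. Qed.
Let mq : measurable_fun D q. Proof. exact: continuousD_meas. Qed.
Notation L2 := (L2r W).
Notation "<< f , g >>" := (ip W f g).

Let Kq0 : 0 <= Kq. Proof. by apply: le_trans (qK ltr01). Qed.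

Lemma L2_cst c : L2 (fun=> c).
Proof. by split => //; exact: intD_scale. Qed.

Lemma L2_intD f : L2 f -> intD (fun x => f x * W x).
Proof.
by move=> Lf; apply: intD_eq (L2r_mul mW W0 Lf (L2_cst 1)) => x _; rewrite mulr1.
Qed.

Lemma L2_bounded (k : R -> R) (C : R) f : measurable_fun D k ->
  (forall x, 0 < x -> `|k x| <= C) -> L2 f -> L2 (fun x => k x * f x).
Proof.
move=> mk kC [mf f2]; split; first exact: measurable_funM.
apply: intD_le (intD_scale (C ^+ 2) f2).
- by apply: measurable_funM => //; apply: measurable_funX; exact: measurable_funM.
- move=> x x0; rewrite exprMn -mulrA normrM ger0_norm ?sqr_ge0//.
  rewrite [X in _ * X]ger0_norm; last by rewrite mulr_ge0 ?sqr_ge0// ltW// W0.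
  rewrite ler_wpM2r//; first by rewrite mulr_ge0 ?sqr_ge0// ltW// W0.
  by rewrite -real_normK ?num_real// lerXn2r ?nnegrE// ?(le_trans _ (kC x x0))// kC.
Qed.

Lemma L2_q f : L2 f -> L2 (fun x => q x * f x).
Proof. exact: (@L2_bounded q Kq f mq qK). Qed.

(** The density of the quasi-derivative p f' when - (p f')' / W + q f = v. *)
Definition qdens f v x : R := W x * (q x * f x - v x).

Lemma qdens_intD f v : L2 f -> L2 v -> intD (qdens f v).
Proof.
move=> Lf Lv; apply: intD_eq (L2_intD (L2r_sub mW W0 (L2_q Lf) Lv)) => x _.
by rewrite /qdens mulrC.
Qed.

Definition qd f x : R := p x * derive1 f x.

(** The graph of the maximal operator. The second derivative of f is replaced by
    that of the quasi-derivative, which is the absolutely continuous object here;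
    as before, derive1 is only trusted where it is a derivative. *)
Definition Qmax f v : Prop := [/\ L2 f, L2 v, forall x, 0 < x -> derivable f x 1,
  forall a b, 0 < a -> a <= b -> abs_cont a b (qd f) &
  aeD (fun x => derivable (qd f) x 1 -> derive1 (qd f) x = qdens f v x)].

Lemma Qmax_d f v x : Qmax f v -> 0 < x -> is_derive x 1 f (qd f x / p x).
Proof.
move=> [_ _ df _ _] x0; have := derivable_d (df x x0); move/dEq; apply.
by rewrite /qd mulrC mulKf// gt_eqF// p0.
Qed.

Lemma Qmax_qd_continuous f v : Qmax f v -> {in D, continuous (qd f)}.
Proof.
move=> [_ _ _ acf _] x; rewrite inE => /inD x0.
have x20 : 0 < x / 2 by rewrite divr_gt0.
apply: (@abs_cont_continuous _ (x / 2) (x * 2)); last by apply: acf => //; lra.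
by apply/andP; split; lra.
Qed.

Lemma p_continuous : {in D, continuous p}.
Proof. by move=> x; rewrite inE => /inD x0; exact: d_continuous (dpE x0). Qed.

Lemma pV_continuous : {in D, continuous (fun x => (p x)^-1)}.
Proof.
move=> x Dx; apply: cvgV; last exact: p_continuous.
by move: Dx; rewrite inE => /inD x0; rewrite gt_eqF// p0.
Qed.

Lemma Qmax_abs_cont f v a b : Qmax f v -> 0 < a -> a <= b -> abs_cont a b f.
Proof.
move=> Qf a0 ab; apply: (C1_abs_cont (df := fun x => qd f x / p x)) => //.
  by move=> x Dx; apply: cvgM; [exact: (Qmax_qd_continuous Qf)|exact: pV_continuous].
by move=> x x0; exact: Qmax_d Qf x0.
Qed.

Lemma ae_itv (P : R -> Prop) a b : 0 < a -> aeD P -> {ae mu, forall x, a < x < b -> P x}.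
Proof.
move=> a0; have ? := ae_filter_ringOfSetsType mu; rewrite /aeD.
by apply: filterS => x h /andP[ax _]; apply: h; exact: lt_trans ax.
Qed.

Lemma J_of_itv F (k : R -> R) : intD k ->
  (forall a b, 0 < a -> a <= b -> F b - F a = \int[mu]_(x in `[a, b]) k x) ->
  exists c, forall x, 0 < x -> F x = c + J k 0 x.
Proof.
move=> ik H; exists (F 1 - J k 0 1) => x x0.
have E a b : 0 < a -> a <= b -> F b - F a = J k 0 b - J k 0 a.
  move=> a0 ab; rewrite H// -J_cc//.
  by rewrite (J_cat ik (ltW a0) ab); ring.
by have [x1|/ltW x1] := leP x 1; [have := E x 1 x0 x1|have := E 1 x ltr01 x1]; lra.
Qed.

(** As constants are in L^2, the density is integrable up to 0. *)
Lemma qd_J f v : Qmax f v -> exists c, forall x, 0 < x -> qd f x = c + J (qdens f v) 0 x.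
Proof.
move=> Qf; have [Lf Lv df acf aef] := Qf.
have iqd := qdens_intD Lf Lv.
apply: J_of_itv => // a b a0 ab.
apply: abs_cont_FTC_ae => //; first exact: acf.
  by apply: intD_itv => //; exact: cc_D.
exact: ae_itv.
Qed.

Definition wronsk f g x : R := f x * qd g x - qd f x * g x.

Definition gdens f v g w x : R := W x * (v x * g x - f x * w x).

Lemma gdens_intD f v g w : L2 f -> L2 v -> L2 g -> L2 w -> intD (gdens f v g w).
Proof.
move=> Lf Lv Lg Lw; have := intD_sub (L2r_mul mW W0 Lv Lg) (L2r_mul mW W0 Lf Lw).
by apply: intD_eq => x _; rewrite /gdens; ring.
Qed.

Lemma I_gdens f v g w : L2 f -> L2 v -> L2 g -> L2 w ->
  I (gdens f v g w) = << v, g >> - << f, w >>.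
Proof.
move=> Lf Lv Lg Lw; rewrite /ip -I_sub; [|exact: (L2r_mul mW W0)..].
by apply: I_eq => x _; rewrite /gdens; ring.
Qed.

(** Lagrange's identity: almost everywhere the derivative of the boundary form is
    W (v g - f w). *)
Lemma green f v g w : Qmax f v -> Qmax g w ->
  exists l0, forall x, 0 < x -> wronsk f g x = l0 + J (gdens f v g w) 0 x.
Proof.
move=> Qf Qg; have [Lf Lv df acf aef] := Qf; have [Lg Lw dg acg aeg] := Qg.
have ig := gdens_intD Lf Lv Lg Lw.
apply: J_of_itv => // a b a0 ab.
apply: abs_cont_FTC_ae => //.
- by apply: abs_cont_sub => //; apply: abs_cont_mul => //;
     [exact: Qmax_abs_cont Qf _ _|exact: acg|exact: acf|exact: Qmax_abs_cont Qg _ _].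
- by apply: intD_itv => //; exact: cc_D.
have [rf [_ _ drf]] := abs_cont_FTC ab (acf a b a0 ab).
have [rg [_ _ drg]] := abs_cont_FTC ab (acg a b a0 ab).
have ? := ae_filter_ringOfSetsType mu.
have aeI A B : almost_everywhere mu A -> almost_everywhere mu B -> almost_everywhere mu (A `&` B).
  exact: filterI.
apply: filterS (aeI _ _ (aeI _ _ (ae_itv b a0 aef) (ae_itv b a0 aeg)) (aeI _ _ drf drg)) => x [[hf hg] [hrf hrg]] axb _.
have x0 : 0 < x by case/andP: axb => ax _; exact: lt_trans ax.
have {hrf}d1 := hrf axb; have {hrg}d2 := hrg axb.
have E1 := hf axb (d_derivable d1); have E2 := hg axb (d_derivable d2).
rewrite (d_derive1 d1) in E1; rewrite (d_derive1 d2) in E2.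
have d := dB (dM (Qmax_d Qf x0) d2) (dM d1 (Qmax_d Qg x0)).
rewrite (d_derive1 d) E1 E2 /gdens /qdens.
by have := p0 x0; move=> /gt_eqF pn; field; rewrite pn.
Qed.

Lemma cvgD_J (F : R -> R) (k : R -> R) c : intD k -> (forall x, 0 < x -> F x = c + J k 0 x) ->
  F x @[x --> 0^'+] --> c /\ F x @[x --> +oo] --> c + I k.
Proof.
move=> ik FE; split.
  have h : c + J k 0 x @[x --> 0^'+] --> c + 0.
    by apply: cvgD; [exact: cvg_cst|exact: J_cvg0].
  rewrite addr0 in h; apply: cvg_trans h.
  by apply: near_eq_cvg; near=> x; rewrite FE//; near: x; exact: nbhs_right_gt.
apply: (@cvg_trans _ ((c + J k 0 x) @[x --> +oo])).
  by apply: near_eq_cvg; near=> x; rewrite FE//; near: x; exact: nbhs_pinfty_gt.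
by apply: cvgD; [exact: cvg_cst|exact: J_cvgy].
Unshelve. all: by end_near. Qed.

Lemma qd_cvg f v : Qmax f v -> exists c, (forall x, 0 < x -> qd f x = c + J (qdens f v) 0 x) /\
  qd f x @[x --> 0^'+] --> c.
Proof.
move=> Qf; have [c H] := qd_J Qf; exists c; split => //.
have [Lf Lv _ _ _] := Qf.
by have [] := cvgD_J (qdens_intD Lf Lv) H.
Qed.

Lemma green_cvg f v g w : Qmax f v -> Qmax g w -> exists l0 l1,
  [/\ wronsk f g x @[x --> 0^'+] --> l0, wronsk f g x @[x --> +oo] --> l1 &
      l1 - l0 = << v, g >> - << f, w >>].
Proof.
move=> Qf Qg; have [l0 H] := green Qf Qg.
have [Lf Lv _ _ _] := Qf; have [Lg Lw _ _ _] := Qg.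
have [c0 c1] := cvgD_J (gdens_intD Lf Lv Lg Lw) H.
exists l0, (l0 + I (gdens f v g w)); split => //.
by rewrite I_gdens//; ring.
Qed.

(** The part of the graph that satisfies the boundary condition at 0. *)
Definition Qbc f v : Prop := Qmax f v /\ qd f x @[x --> 0^'+] --> 0.

Lemma Qbc_qd f v x : Qbc f v -> 0 < x -> qd f x = J (qdens f v) 0 x.
Proof.
move=> [Qf f0]; have [c [H cc]] := qd_cvg Qf => x0.
by rewrite H// (cvg_unique (@Rhausdorff R) cc f0) add0r.
Qed.

Lemma I_abs_le g : L2 g -> I (fun x => `|g x| * W x) <= Num.sqrt << g, g >> * Num.sqrt (I W).
Proof.
move=> Lg; have Lag : L2 (fun x => `|g x|).
  have [mg g2] := Lg; split; first exact: measurableT_comp.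
  by apply: intD_eq g2 => x _; rewrite real_normK ?num_real.
have := cauchy_schwarz_sqrt mW W0 Lag (L2_cst 1).
have -> : << fun x => `|g x|, fun=> 1 >> = I (fun x => `|g x| * W x).
  by apply: I_eq => x _; rewrite mulr1.
have -> : << fun x => `|g x|, fun x => `|g x| >> = << g, g >>.
  by apply: I_eq => x _; rewrite -!expr2 real_normK ?num_real.
have -> : << fun=> 1, fun=> 1 >> = I W by apply: I_eq => x _; rewrite !mul1r.
by apply: le_trans; exact: ler_norm.
Qed.

(** By Fatou's lemma an L^2 limit and a pointwise limit of the same sequence
    coincide. *)
Lemma L2_pointwise (S : nat -> R -> R) u f : L2 u -> (forall n, L2 (S n)) -> measurable_fun D f ->
  << (fun x => u x - S n x), (fun x => u x - S n x) >> @[n --> \oo] --> 0 ->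
  (forall x, 0 < x -> S n x @[n --> \oo] --> f x) -> aeD (fun x => u x = f x).
Proof.
move=> Lu LS mf cS Sf.
have [mu_ _] := Lu.
have Ln n : L2 (fun x => u x - S n x) by exact: (L2r_sub mW W0).
pose h n x := ((u x - S n x) ^+ 2 * W x)%:E.
have h0 n x : D x -> (0 <= h n x)%E.
  by move=> /inD x0; rewrite lee_fin mulr_ge0 ?sqr_ge0// ltW// W0.
have mh n : measurable_fun D (h n) by apply/measurable_EFinP; have [_ /intD_meas] := Ln n.
have key : (\int[mu]_(x in D) ((u x - f x) ^+ 2 * W x)%:E <= 0)%E.
  have -> : (\int[mu]_(x in D) ((u x - f x) ^+ 2 * W x)%:E =
     \int[mu]_(x in D) limn_einf (h ^~ x))%E.
    apply: eq_integral => x; rewrite inE => /inD x0.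
    have ch : h n x @[n --> \oo] --> ((u x - f x) ^+ 2 * W x)%:E.
      apply: cvg_EFin; first exact: nearW.
      apply: cvgMl; rewrite expr2; under eq_fun do rewrite expr2.
      by apply: cvgM; apply: cvgB; [exact: cvg_cst|exact: Sf|exact: cvg_cst|exact: Sf].
    rewrite is_cvg_limn_einfE; last by apply/cvg_ex; eexists; exact: ch.
    by apply/esym/cvg_lim.
  apply: le_trans (fatou _ _ _ _) _ => //.
  have E n : (\int[mu]_(x in D) h n x)%E = (<< (fun x => u x - S n x), (fun x => u x - S n x) >>)%:E.
    by rewrite ipE -IE//; have [] := Ln n.
  under eq_fun do rewrite E.
  have ce : (<< (fun x => u x - S n x), (fun x => u x - S n x) >>)%:E @[n --> \oo] --> 0%:E.
    by apply: cvg_EFin => //; exact: nearW.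
  by rewrite is_cvg_limn_einfE; [rewrite (cvg_lim _ ce)|apply/cvg_ex; eexists; exact: ce].
have Luf : L2 (fun x => u x - f x).
  split; first exact: measurable_funB.
  apply: intD_ge0.
  - by apply: measurable_funM => //; apply: measurable_funX; exact: measurable_funB.
  - by move=> x x0; rewrite mulr_ge0 ?sqr_ge0// ltW// W0.
  - exact: le_lt_trans key (ltry 0).
have : << (fun x => u x - f x), (fun x => u x - f x) >> = 0.
  apply: le_anti; rewrite nrm_ge0// andbT -lee_fin ipE -IE//.
  by have [] := Luf.
move/(nrm_eq0 W0 Luf); apply: aeD_filter => x _ /eqP.
by rewrite subr_eq0 => /eqP.
Qed.

(** Converse of [qd_J]: the graph can be described by an integral
    equation, which unlike the differential one passes to limits. *)
Lemma Qmax_J f v c : L2 f -> L2 v -> (forall x, 0 < x -> derivable f x 1) ->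
  (forall x, 0 < x -> qd f x = c + J (qdens f v) 0 x) -> Qmax f v.
Proof.
move=> Lf Lv df H; have iq := qdens_intD Lf Lv; split => //.
  move=> a b a0 ab.
  apply: (@abs_cont_ext _ (fun x => c + J (qdens f v) 0 x)).
    by move=> x /andP[ax _]; rewrite H// (lt_le_trans a0).
  by apply: abs_cont_add; [exact: abs_cont_cst|apply: abs_cont_J => //; exact: ltW].
apply: aeD_filter (J_derive_ae iq) => x x0 dJ _.
have nE : \forall y \near x, c + J (qdens f v) 0 y = qd f y.
  by near=> y; rewrite H//; near: y; exact: lt_nbhsr.
have d := dD (dC x c) dJ.
by rewrite (d_derive1 (near_eq_is_derive nE d)) add0r.
Unshelve. all: by end_near. Qed.

Lemma Qmax_lin a b f v g w : Qmax f v -> Qmax g w ->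
  Qmax (fun x => a * f x + b * g x) (fun x => a * v x + b * w x).
Proof.
move=> Qf Qg; have [Lf Lv df _ _] := Qf; have [Lg Lw dg _ _] := Qg.
have [k Hk] := qd_J Qf; have [l Hl] := qd_J Qg.
have d x : 0 < x -> is_derive x 1 (fun x => a * f x + b * g x) (a * (qd f x / p x) + b * (qd g x / p x)).
  by move=> x0; apply: dD; apply: dZ; [exact: Qmax_d Qf x0|exact: Qmax_d Qg x0].
have iqf := qdens_intD Lf Lv; have iqg := qdens_intD Lg Lw.
apply: (@Qmax_J _ _ (a * k + b * l)).
- by apply: L2r_add => //; exact: L2r_scale.
- by apply: L2r_add => //; exact: L2r_scale.
- by move=> x x0; exact: d_derivable (d x x0).
move=> x x0; rewrite /qd (d_derive1 (d x x0)).
have -> : J (qdens (fun x => a * f x + b * g x) (fun x => a * v x + b * w x)) 0 x =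
  J (fun x => a * qdens f v x + b * qdens g w x) 0 x.
  by apply: J_ext => // y _; rewrite /qdens; ring.
rewrite (J_add _ (intD_scale a iqf) (intD_scale b iqg))// !J_scale//.
transitivity (a * qd f x + b * qd g x); first by field; rewrite gt_eqF// p0.
by rewrite Hk// Hl//; ring.
Qed.

Lemma qd_lin a b f v g w x : Qmax f v -> Qmax g w -> 0 < x ->
  qd (fun x => a * f x + b * g x) x = a * qd f x + b * qd g x.
Proof.
move=> Qf Qg x0; rewrite /qd (d_derive1 (dD (dZ a (Qmax_d Qf x0)) (dZ b (Qmax_d Qg x0)))).
by rewrite (d_derive1 (Qmax_d Qf x0)) (d_derive1 (Qmax_d Qg x0)); ring.
Qed.

Lemma qd_lin_cvg a b f v g w k l : Qmax f v -> Qmax g w ->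
  qd f x @[x --> 0^'+] --> k -> qd g x @[x --> 0^'+] --> l ->
  qd (fun x => a * f x + b * g x) x @[x --> 0^'+] --> a * k + b * l.
Proof.
move=> Qf Qg ck cl.
have h : a * qd f x + b * qd g x @[x --> 0^'+] --> a * k + b * l.
  by apply: cvgD; apply: cvgMr.
apply: cvg_trans h; apply: near_eq_cvg; near=> x.
by rewrite (qd_lin _ _ Qf Qg)//; near: x; exact: nbhs_right_gt.
Unshelve. all: by end_near. Qed.

Lemma Qbc_lin a b f v g w : Qbc f v -> Qbc g w ->
  Qbc (fun x => a * f x + b * g x) (fun x => a * v x + b * w x).
Proof.
move=> [Qf f0] [Qg g0]; split; first exact: Qmax_lin.
have := @qd_lin_cvg a b _ _ _ _ _ _ Qf Qg f0 g0.
by rewrite !mulr0 addr0.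
Qed.

Lemma Qbc_ext f v g w : (forall x, f x = g x) -> (forall x, v x = w x) -> Qbc f v -> Qbc g w.
Proof. by move=> /funext -> /funext ->. Qed.

Lemma Qbc0 : Qbc (fun=> 0) (fun=> 0).
Proof.
have E x : qd (fun=> 0 : R) x = 0 by rewrite /qd (d_derive1 (dC x 0)) mulr0.
split; last first.
  by rewrite (_ : qd _ = fun=> 0); [exact: cvg_cst|apply/funext => x; exact: E].
apply: (@Qmax_J _ _ 0); [exact: L2r0|exact: L2r0|move=> x _; exact: d_derivable (dC x 0)|].
move=> x x0; rewrite E add0r (_ : qdens _ _ = fun x => 0 * W x); first by rewrite J_scale// mul0r.
by apply/funext => y; rewrite /qdens; ring.
Qed.

Lemma Qbc_psum (e : nat -> R -> R) (l a : nat -> R) N :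
  (forall n, Qbc (e n) (fun x => l n * e n x)) ->
  Qbc (psum e a N) (psum e (fun n => l n * a n) N).
Proof.
move=> He; elim: N => [|N IH].
  by apply: Qbc_ext Qbc0 => x; rewrite /psum big_ord0.
apply: Qbc_ext (Qbc_lin 1 (a N) IH (He N)) => x; rewrite psumS; ring.
Qed.

(** The total mass of W is finite, so by Cauchy-Schwarz L^2 convergence gives
    uniform convergence of the quasi-derivatives. *)
Lemma qdens_diff_le f v g w x : L2 f -> L2 v -> L2 g -> L2 w ->
  `|J (qdens f v) 0 x - J (qdens g w) 0 x| <=
   (Kq * Num.sqrt << (fun x => f x - g x), (fun x => f x - g x) >> +
    Num.sqrt << (fun x => v x - w x), (fun x => v x - w x) >>) * Num.sqrt (I W).
Proof.
move=> Lf Lv Lg Lw.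
have Lfg := L2r_sub mW W0 Lf Lg; have Lvw := L2r_sub mW W0 Lv Lw.
have i1 := qdens_intD Lf Lv; have i2 := qdens_intD Lg Lw.
have iab h : L2 h -> intD (fun x => `|h x| * W x).
  move=> Lh; apply: intD_eq (intD_norm (L2_intD Lh)) => y y0.
  by rewrite normrM (gtr0_norm (W0 y0)).
rewrite -J_sub//.
apply: le_trans (J_norm _ (intD_sub i1 i2) _) _ => //.
apply: le_trans (J_le _ (intD_norm (intD_sub i1 i2)) _ _) _ => //.
apply: (@le_trans _ _ (I (fun x => Kq * (`|f x - g x| * W x) + `|v x - w x| * W x))).
  apply: I_le.
  - exact: intD_norm (intD_sub i1 i2).
  - by apply: intD_add; [apply: intD_scale|]; exact: iab.
  move=> y y0; rewrite /qdens -mulrBr normrM (gtr0_norm (W0 y0)).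
  have -> : q y * f y - v y - (q y * g y - w y) = q y * (f y - g y) - (v y - w y) by ring.
  have h1 := ler_normB (q y * (f y - g y)) (v y - w y).
  have h2 : `|q y * (f y - g y)| <= Kq * `|f y - g y|.
    by rewrite normrM ler_wpM2r// qK.
  have := ler_wpM2l (ltW (W0 y0)) (le_trans h1 (lerD h2 (lexx _))); lra.
rewrite I_add; [|by apply: intD_scale; exact: iab|exact: iab].
rewrite I_scale; last exact: iab.
have h1 := I_abs_le Lfg; have h2 := I_abs_le Lvw.
have := ler_wpM2l Kq0 h1; lra.
Qed.

(** The derivative of S - F0 is (qd S - G) / p. *)
Lemma increments_le (S F0 G : R -> R) v del s t x :
  0 < s -> s <= 1 <= t -> (forall y, s <= y <= t -> (p y)^-1 <= del) ->
  Qmax S v -> (forall y, 0 < y -> is_derive y 1 F0 (G y / p y)) ->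
  forall eps, (forall y, 0 < y -> `|qd S y - G y| <= eps) ->
  s <= x <= t -> `|(S x - F0 x) - (S 1 - F0 1)| <= eps * del * (t - s).
Proof.
move=> s0 /andP[s1 t1] pd QS dF eps He sxt.
have d y : 0 < y -> is_derive y 1 (fun y => S y - F0 y) ((qd S y - G y) / p y).
  by move=> y0; apply: dEq (dB (Qmax_d QS y0) (dF y y0)) _; rewrite mulrBl.
have eps0 : 0 <= eps by apply: le_trans (He 1 ltr01).
have del0 : 0 <= del.
  by apply: le_trans (pd 1 _); [rewrite invr_ge0 ltW// p0|rewrite s1].
have B y : s <= y <= t -> `|(qd S y - G y) / p y| <= eps * del.
  move=> /[dup] syt /andP[sy _]; have y0 : 0 < y by exact: lt_le_trans sy.
  rewrite normrM normfV (gtr0_norm (p0 y0)); apply: ler_pM => //; first by rewrite invr_ge0 ltW// p0.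
  - exact: He.
  - exact: pd.
have main a b : s <= a -> a < b -> b <= t ->
   `|(S b - F0 b) - (S a - F0 a)| <= eps * del * (t - s).
  move=> sa ab bt.
  have [|c /andP[ac cb] ->] := @mvt _ (fun y => S y - F0 y) (fun y => (qd S y - G y) / p y) a b ab.
    by move=> y /andP[ay yb]; apply: d; exact: lt_le_trans (lt_le_trans s0 sa) ay.
  rewrite normrM; apply: ler_pM => //; first by apply: B; apply/andP; split; lra.
  by rewrite ger0_norm; lra.
move: sxt => /andP[sx xt].
have [x1|x1|->] := ltgtP x 1.
- by rewrite distrC; exact: main.
- exact: main.
- rewrite subrr normr0; apply: mulr_ge0; [exact: mulr_ge0|lra].
Qed.

Lemma pV_bound s t : 0 < s -> s <= t -> exists C, forall y, s <= y <= t -> (p y)^-1 <= C.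
Proof.
move=> s0 st; have [C H] := continuous_bounded st (continuous_oo_cc s0 pV_continuous).
by exists C => y /H; apply: le_trans; exact: ler_norm.
Qed.

(** The quasi-derivatives converge uniformly to G, the integral of the density of
    (u, v), so up to constants S n converges locally uniformly to an
    antiderivative F0 of G / p. The constants converge because the integrals of
    S n W over [1, 2] do, and the pointwise limit is then u. *)
Theorem Qbc_closed (S V : nat -> R -> R) u v : L2 u -> L2 v ->
  (forall n, Qbc (S n) (V n)) ->
  << (fun x => u x - S n x), (fun x => u x - S n x) >> @[n --> \oo] --> 0 ->
  << (fun x => v x - V n x), (fun x => v x - V n x) >> @[n --> \oo] --> 0 ->
  exists2 f, Qbc f v & aeD (fun x => u x = f x).
Proof.
move=> Lu Lv QS cu cv.
have LS n : L2 (S n) by have [[]] := QS n.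
have LV n : L2 (V n) by have [[]] := QS n.
have iq := qdens_intD Lu Lv.
set G := J (qdens u v) 0.
have cG : {in D, continuous G}.
  move=> x; rewrite inE => /inD x0.
  apply: (@abs_cont_continuous _ (x / 2) (x * 2)); first by apply/andP; split; lra.
  by apply: abs_cont_J => //; lra.
have cGp : {in D, continuous (fun x => G x / p x)}.
  by move=> x Dx; apply: cvgM; [exact: cG|exact: pV_continuous].
have [F0 dF0] := antiderivative cGp.
pose del n : R := (Kq * Num.sqrt << (fun x => u x - S n x), (fun x => u x - S n x) >> +
    Num.sqrt << (fun x => v x - V n x), (fun x => v x - V n x) >>) * Num.sqrt (I W).
have sq0 (a : nat -> R) : a n @[n --> \oo] --> 0 -> Num.sqrt (a n) @[n --> \oo] --> (0 : R).
  move=> ca; have : Num.sqrt (a n) @[n --> \oo] --> Num.sqrt (0 : R).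
    by apply: continuous_cvg => //; exact: sqrt_continuous.
  by rewrite sqrtr0.
have cdel : del n @[n --> \oo] --> (0 : R).
  rewrite (_ : 0 = (Kq * 0 + 0) * Num.sqrt (I W)); last by ring.
  by apply: cvgMl; apply: cvgD; [apply: cvgMr|]; exact: sq0.
have qdG n x : 0 < x -> `|qd (S n) x - G x| <= del n.
  by move=> x0; rewrite (Qbc_qd (QS n) x0) distrC; exact: qdens_diff_le.
pose m n := S n 1 - F0 1.
have incr s t : 0 < s -> s <= 1 <= t -> exists C, forall n x, s <= x <= t ->
    `|S n x - F0 x - m n| <= C * del n.
  move=> s0 /[dup] s1t /andP[s1 t1]; have [C HC] := pV_bound s0 (le_trans s1 t1).
  exists (C * (t - s)) => n x sxt.
  have := increments_le s0 s1t HC (QS n).1 dF0 (qdG n) sxt.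
  by rewrite /m; lra.
(* the constants of integration converge *)
pose chi x : R := if 1 <= x <= 2 then W x else 0.
have chiE x : chi x = (\1_`[1, 2] x) * W x.
  by rewrite /chi indicE mem_setE in_itv/=; case: ifP => _; rewrite ?mul1r ?mul0r.
have m1 : measurable_fun D (\1_`[1, 2] : R -> R) by [].
have chi0 x : 0 < x -> 0 <= chi x.
  by move=> x0; rewrite /chi; case: ifP => // _; rewrite ltW// W0.
have chiW x : 0 < x -> chi x <= W x.
  by move=> x0; rewrite /chi; case: ifP => // _; rewrite ltW// W0.
have mchi : measurable_fun D chi.
  by rewrite (_ : chi = fun x => (\1_`[1, 2] x) * W x); [exact: measurable_funM|apply/funext => x; exact: chiE].
have bchi (F : R -> R) K : measurable_fun D F -> (forall x, 1 <= x <= 2 -> `|F x| <= K) ->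
    intD (fun x => F x * chi x).
  move=> mF FK; apply: intD_le (intD_scale K iW); first exact: measurable_funM.
  move=> x x0; rewrite normrM (ger0_norm (chi0 x x0)) /chi.
  case: ifP => x12; first by rewrite ler_wpM2r ?FK// ltW// W0.
  rewrite mulr0 mulr_ge0 ?(ltW (W0 x0))//.
  apply: le_trans (FK 1 _) => //; apply/andP; split; lra.
have ichi : intD chi.
  apply: intD_le iW => // x x0; rewrite ger0_norm ?chi0//; exact: chiW.
have cF0 : {in D, continuous F0}.
  by move=> x; rewrite inE => /inD x0; exact: d_continuous (dF0 x x0).
have mF0 := continuousD_meas cF0.
have iF0 : intD (fun x => F0 x * chi x).
  have h12 : (1 : R) <= 2 by lra.
  have [K HK] := continuous_bounded h12 (continuous_oo_cc ltr01 cF0).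
  exact: bchi HK.
have iL g : L2 g -> intD (fun x => g x * chi x).
  move=> Lg; have [mg _] := Lg.
  apply: intD_le (intD_norm (L2_intD Lg)); first exact: measurable_funM.
  move=> x x0; rewrite !normrM ler_wpM2l// !ger0_norm ?chi0 ?chiW//.
  by rewrite ltW// W0.
have Ichi : 0 < I chi.
  have h12 : (1 : R) <= 2 by lra.
  have cWV : {in D, continuous (fun x => (W x)^-1)}.
    move=> x Dx; apply: cvgV; last exact: cW.
    by move: Dx; rewrite inE => /inD x0; rewrite gt_eqF// W0.
  have [K HK] := continuous_bounded h12 (continuous_oo_cc ltr01 cWV).
  have K0 : 0 < K.
    by apply: lt_le_trans (HK 1 _); [rewrite normr_gt0 invr_eq0 gt_eqF// W0|rewrite lexx].
  have L : forall x, 1 <= x <= 2 -> K^-1 <= chi x.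
    move=> x x12; rewrite /chi x12; have x0 : 0 < x by case/andP: x12 => + _; exact: lt_le_trans.
    rewrite -[W x]invrK lef_pV2 ?posrE ?invr_gt0 ?W0//.
    by apply: le_trans (HK x x12); exact: ler_norm.
  have cK : mu.-integrable `[1%R, 2%R] (EFin \o (fun=> K^-1)).
    by apply: (@intcc_continuous R) => // x _; exact: cvg_cst.
  have := le_itv_integral ltr01 cK ichi chi0 L.
  have d1 x : 0 < x -> is_derive x 1 (fun y : R => K^-1 * y) K^-1.
    by move=> x0; apply: dEq (dZ _ (dId x)) _; rewrite mulr1.
  have := @FTC_itv R _ (fun=> K^-1) 1 2 ltr01 h12 (fun x _ => cvg_cst _) d1.
  rewrite /Rintegral => -> /=; apply: lt_le_trans.
  have : 0 < K^-1 by rewrite invr_gt0.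
  lra.
have sq (a b : nat -> R) l : (forall n, `|a n - l| <= b n) -> b n @[n --> \oo] --> (0 : R) ->
    a n @[n --> \oo] --> l.
  move=> ab cb; apply/cvgrPdist_le => e e0; move/cvgrPdist_le: cb => /(_ e e0) h.
  near=> n; rewrite distrC; apply: le_trans (ab n) _.
  have : `|0 - b n| <= e by near: n.
  by rewrite sub0r normrN; apply: le_trans; exact: ler_norm.
have sq0' (a b : nat -> R) (C : R) : (forall n, `|a n| <= C * b n) -> b n @[n --> \oo] --> (0 : R) ->
    a n @[n --> \oo] --> (0 : R).
  move=> ab cb; apply: (sq _ (fun n => C * b n)); first by move=> n; rewrite subr0.
  by rewrite -(mulr0 C); exact: cvgMr.
have cI : I (fun x => S n x * chi x) @[n --> \oo] --> I (fun x => u x * chi x).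
  apply: (sq _ (fun n => Num.sqrt << (fun x => u x - S n x), (fun x => u x - S n x) >> * Num.sqrt (I W))).
    move=> n; have Lus := L2r_sub mW W0 Lu (LS n).
    rewrite distrC -I_sub; [|exact: iL|exact: iL].
    have := I_abs_le Lus; apply: le_trans.
    apply: le_trans (le_normr_integral mD _) _ => //.
      by apply: intD_sub; exact: iL.
    apply: I_le.
    - by apply: intD_norm; apply: intD_sub; exact: iL.
    - apply: intD_eq (intD_norm (L2_intD Lus)) => y y0.
      by rewrite normrM (gtr0_norm (W0 y0)).
    - move=> x x0; rewrite -mulrBl normrM (ger0_norm (chi0 x x0)).
      by rewrite ler_wpM2l// chiW.
  apply: (sq0' _ (fun n => Num.sqrt << (fun x => u x - S n x), (fun x => u x - S n x) >>) (Num.sqrt (I W))).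
    by move=> n; rewrite ger0_norm ?mulr_ge0 ?sqrtr_ge0// mulrC.
  exact: (sq0 _ cu).
have cm : m n @[n --> \oo] --> (I (fun x => u x * chi x) - I (fun x => F0 x * chi x)) / I chi.
  have [||C HC] := incr 1 2; [by []|by apply/andP; split; lra|].
  have ik n : intD (fun x => (S n x - F0 x - m n) * chi x).
    apply: intD_eq (intD_sub (intD_sub (iL _ (LS n)) iF0) (intD_scale (m n) ichi)) => x _; ring.
  have e0 n : m n = (I (fun x => S n x * chi x) - I (fun x => F0 x * chi x)) / I chi -
     (I (fun x => (S n x - F0 x - m n) * chi x)) / I chi.
    have -> : I (fun x => (S n x - F0 x - m n) * chi x) =
      I (fun x => S n x * chi x) - I (fun x => F0 x * chi x) - m n * I chi.
      have h1 := iL _ (LS n); have h2 := intD_sub h1 iF0; have h3 := intD_scale (m n) ichi.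
      rewrite -(I_scale (m n) ichi) -(I_sub h1 iF0) -(I_sub h2 h3).
      by apply: I_eq => x _; ring.
    by field; rewrite gt_eqF.
  rewrite (funext e0) -[X in _ --> X]subr0.
  apply: cvgB.
    by apply: cvgMl; apply: cvgB => //; exact: cvg_cst.
  apply: (sq0' _ del C) cdel => n.
  rewrite normrM normfV (gtr0_norm Ichi) ler_pdivrMr//.
  apply: le_trans (le_normr_integral mD (ik n)) _.
  rewrite -(I_scale (C * del n) ichi); apply: I_le.
  - exact: intD_norm.
  - exact: intD_scale.
  move=> x x0; rewrite normrM (ger0_norm (chi0 x x0)) /chi.
  case: ifP => [x12|_]; last by rewrite !mulr0.
  by rewrite ler_wpM2r ?HC// ltW// W0.
set ka := (_ / _) in cm.
pose f x := F0 x + ka.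
have Sf x : 0 < x -> S n x @[n --> \oo] --> f x.
  move=> x0.
  have [||C HC] := incr (Num.min x 1) (Num.max x 1).
  - by rewrite lt_min x0 ltr01.
  - by rewrite ge_min lexx orbT le_max lexx orbT.
  have hd : S n x - F0 x - m n @[n --> \oo] --> (0 : R).
    by apply: (sq0' _ del C) cdel => n; apply: HC; rewrite ge_min lexx le_max lexx.
  have : F0 x + (m n + (S n x - F0 x - m n)) @[n --> \oo] --> F0 x + (ka + 0).
    by apply: cvgD; [exact: cvg_cst|exact: cvgD].
  rewrite addr0 => h; apply: cvg_trans h; apply: near_eq_cvg.
  by apply: nearW => n; ring.
have mf : measurable_fun D f by exact: measurable_funD.
have uf : aeD (fun x => u x = f x) by exact: L2_pointwise cu Sf.
have Lf : L2 f by exact: L2r_ae Lu.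
have df x : 0 < x -> is_derive x 1 f (G x / p x).
  by move=> x0; apply: dEq (dD (dF0 x x0) (dC x ka)) _; rewrite addr0.
have qf x : 0 < x -> qd f x = 0 + J (qdens f v) 0 x.
  move=> x0; rewrite /qd (d_derive1 (df x x0)) add0r mulrC divfK ?gt_eqF ?p0//.
  apply: J_ae => //; first exact: qdens_intD.
  by apply: aeD_filter uf => y _ E; rewrite /qdens E.
exists f => //; split.
  by apply: Qmax_J qf => // x x0; exact: d_derivable (df x x0).
by have [] := cvgD_J (qdens_intD Lf Lv) qf.
Unshelve. all: by end_near. Qed.
End sturm_liouville.

(** * The exceptional weight and its boundary forms *)

Section exceptional_weight.
Context {R : realType}.
Notation D := (`]0%R, +oo[%classic : set R).
Implicit Types (f g u v w : R -> R) (a b c s t x y : R).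
Variables (m : nat) (alpha : R).
Hypothesis ham : m%:R - 1 < alpha.
Notation xi := (xiII m alpha).
Notation W := (weightII m alpha).

Lemma powRDx x a b : 0 < x -> x `^ (a + b) = x `^ a * x `^ b.
Proof. by move=> x0; rewrite powRD// (gt_eqF x0) implybT. Qed.

Lemma powR_le01 x a b : 0 < x -> x <= 1 -> a <= b -> x `^ b <= x `^ a.
Proof.
move=> x0 x1 ab; rewrite /powR gt_eqF// ler_expR ler_wnM2r//.
by rewrite ln_le0.
Qed.

Lemma xi_gt0_neq0 x : 0 < x -> xi.[x] != 0.
Proof. by move=> /ltW x0; exact: xi_neq0. Qed.

(** The leading coefficient of the divergence form - (p f')' / W + q f. *)
Definition pII x : R := x `^ (alpha + 1) * expR (- x) / xi.[x] ^+ 2.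
(** In divergence form the expression is - (p f')' / W + q f. *)
Definition qII x : R := m%:R - 2 * x * (xi^`()).[x] / xi.[x].
Definition dpII x : R := W x * (alpha + 1 - x - 2 * x * (xi^`()).[x] / xi.[x]).

Lemma pII_W x : 0 < x -> pII x = x * W x.
Proof. by move=> x0; rewrite /pII /weightII powRS// !mulrA. Qed.

Lemma W_gt0 x : 0 < x -> 0 < W x.
Proof.
move=> x0; have n0 : 0 < xi.[x] ^+ 2 by rewrite exprn_even_gt0//= xi_gt0_neq0.
by rewrite /weightII; apply: divr_gt0 => //; rewrite mulr_gt0 ?powR_gt0 ?expR_gt0.
Qed.

Lemma pII_gt0 x : 0 < x -> 0 < pII x.
Proof. by move=> x0; rewrite pII_W// mulr_gt0// W_gt0. Qed.

Lemma xiV_continuous : {in D, continuous (fun x => (xi.[x])^-1)}.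
Proof.
move=> x Dx; apply: cvgV; last exact: poly_continuous.
by move: Dx; rewrite inE => /inD; exact: xi_gt0_neq0.
Qed.

Lemma dxi_continuous : {in D, continuous (fun x => (xi^`()).[x] / xi.[x])}.
Proof.
by move=> x Dx; apply: cvgM; [exact: poly_continuous|exact: xiV_continuous].
Qed.

Lemma W_continuous : {in D, continuous W}.
Proof.
move=> x Dx.
have x0 : 0 < x by move: Dx; rewrite inE => /inD.
apply: cvgM; first apply: cvgM.
- exact: pow_continuous.
- exact: d_continuous (dExp (dN (dId x))).
- apply: cvgV; first by rewrite expf_neq0// xi_gt0_neq0.
  under eq_fun do rewrite expr2.
  by rewrite expr2; apply: cvgM; exact: poly_continuous.
Qed.

Let mW : measurable_fun D W.
Proof. exact: continuousD_meas W_continuous. Qed.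

Lemma qII_continuous : {in D, continuous qII}.
Proof.
move=> x Dx; apply: cvgB; first exact: cvg_cst.
apply: cvgM; last exact: xiV_continuous.
apply: cvgM; last exact: poly_continuous.
by apply: cvgM; [exact: cvg_cst|exact: cvg_id].
Qed.

Lemma dpII_continuous : {in D, continuous dpII}.
Proof.
move=> x Dx; apply: cvgM; first exact: W_continuous.
apply: cvgB; first by apply: cvgB; [exact: cvg_cst|exact: cvg_id].
apply: cvgM; last exact: xiV_continuous.
apply: cvgM; last exact: poly_continuous.
by apply: cvgM; [exact: cvg_cst|exact: cvg_id].
Qed.

Lemma pII_d x : 0 < x -> is_derive x 1 pII (dpII x).
Proof.
move=> x0; have n0 := xi_gt0_neq0 x0.
have d1 := dM (dPow (alpha + 1) x0) (dExp (dN (dId x))).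
have d2 := dV (f := fun y => xi.[y] ^+ 2) (expf_neq0 _ n0).
have dxi := dPoly xi x.
have d3 : is_derive x 1 (fun y => xi.[y] ^+ 2) (xi^`().[x] * xi.[x] + xi.[x] * xi^`().[x]).
  by under eq_fun do rewrite expr2; exact: dM.
apply: dEq (dM d1 (d2 _ d3)) _.
rewrite addrK powRS// /dpII /weightII.
by field.
Qed.

(** Compare coefficients: those of x xi' are j times those of xi, 0 <= j <= m, and
    all have the same sign. *)
Lemma xdxi_bound x : 0 < x -> 0 <= x * xi^`().[x] / xi.[x] <= m%:R.
Proof.
move=> x0; have n0 := xi_gt0_neq0 x0.
have sz : (size xi <= m.+1)%N by rewrite size_lag.
have sz' : leq (size ('X * xi^`() : {poly R})) m.+1.
  apply/leq_sizeP => j mj; rewrite coefXM; case: j mj => //= j mj.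
  by rewrite coef_deriv_natr (leq_sizeP _ _ sz)// mul0r.
have E1 : (-1) ^+ m * xi.[x] = \sum_(j < m.+1) ((-1) ^+ m * xi`_j) * x ^+ j.
  by rewrite (horner_coef_wide _ sz) big_distrr/=; apply: eq_bigr => j _; rewrite mulrA.
have E2 : (-1) ^+ m * (x * xi^`().[x]) = \sum_(j < m.+1) ((-1) ^+ m * xi`_j) * x ^+ j * j%:R.
  have -> : x * xi^`().[x] = ('X * xi^`()).[x] by rewrite hornerM hornerX.
  rewrite (horner_coef_wide _ sz') big_distrr/=; apply: eq_bigr => j _.
  rewrite coefXM; case: (val j) => [|i]/=; first by rewrite mul0r !mulr0.
  by rewrite coef_deriv_natr; ring.
have pos (j : 'I_m.+1) : 0 <= ((-1) ^+ m * xi`_j) * x ^+ j.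
  by rewrite mulr_ge0 ?exprn_ge0 ?(ltW x0)// ltW// (xi_coef_gt0 ham)// -ltnS.
have P : 0 < (-1) ^+ m * xi.[x].
  rewrite lt_neqAle eq_sym mulf_neq0 ?signr_eq0//= E1; apply: sumr_ge0 => j _; exact: pos.
have -> : x * xi^`().[x] / xi.[x] = ((-1) ^+ m * (x * xi^`().[x])) / ((-1) ^+ m * xi.[x]).
  by field; rewrite n0 signr_eq0.
rewrite divr_ge0 ?(ltW P)//=; last by rewrite E2; apply: sumr_ge0 => j _; rewrite mulr_ge0// pos.
rewrite ler_pdivrMr// E1 E2 big_distrr/=; apply: ler_sum => j _.
by rewrite mulrC ler_wpM2r// ler_nat -ltnS.
Qed.

Lemma qII_bound x : 0 < x -> `|qII x| <= m%:R.
Proof.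
move=> x0; have := xdxi_bound x0; rewrite /qII.
have -> : 2 * x * xi^`().[x] / xi.[x] = 2 * (x * xi^`().[x] / xi.[x]) by rewrite !mulrA.
move: (_ / _) (m%:R : R) => r M /andP[r0 rM]; rewrite ler_norml; lra.
Qed.

Lemma W_upper : exists2 C, 0 < C & forall x, 0 < x -> W x <= C * (x `^ alpha * expR (- x)).
Proof.
have [c c0 H] := xi_lower ham; exists (c ^- 2); first by rewrite invr_gt0 exprn_gt0.
move=> x x0; rewrite mulrC /weightII ler_wpM2l ?mulr_ge0 ?powR_ge0 ?expR_ge0//.
have n0 : 0 < xi.[x] ^+ 2 by rewrite exprn_even_gt0//= xi_gt0_neq0.
rewrite lef_pV2 ?posrE ?(exprn_gt0 _ c0)//.
by rewrite -[X in _ <= X]real_normK ?num_real// lerXn2r ?nnegrE ?(ltW c0)// H// ltW.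
Qed.

Lemma intD_W_pow_poly a (P : {poly R}) : -1 < alpha + a ->
  intD (fun x => x `^ a * P.[x] * W x).
Proof.
move=> aa; have [C C0 HW] := W_upper.
have h2 : (0 : R) < 2^-1 by lra.
have [K K0 HP] := poly_exp_bound P h2.
apply: (@intD_bound R _ (alpha + a) 2^-1 (C * K)) => //.
  apply: continuousD_meas => x Dx; apply: cvgM; last exact: W_continuous.
  by apply: cvgM; [exact: pow_continuous|exact: poly_continuous].
move=> x x0; rewrite normrM (gtr0_norm (W_gt0 x0)) normrM (gtr0_norm (powR_gt0 _ x0)).
have pa := powR_ge0 x a.
apply: le_trans (ler_pM _ _ (ler_wpM2l pa (HP x (ltW x0))) (HW x x0)) _.
- by rewrite mulr_ge0.
- by rewrite ltW// W_gt0.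
rewrite powRDx//.
have -> : - x = - (2^-1 * x) + - (2^-1 * x) by field.
rewrite expRD; set E := expR (- _).
have -> : expR (2^-1 * x) = E^-1 by rewrite /E expRN invrK.
have E0 : E != 0 by rewrite gt_eqF// expR_gt0.
by rewrite le_eqVlt; apply/orP; left; apply/eqP; field.
Qed.

Lemma intD_W_pow a : -1 < alpha + a -> intD (fun x => x `^ a * W x).
Proof.
move=> aa; apply: intD_eq (intD_W_pow_poly 1 aa) => x _; rewrite hornerC; ring.
Qed.

Lemma intD_W_poly (P : {poly R}) : intD (fun x => P.[x] * W x).
Proof.
apply: intD_eq (@intD_W_pow_poly 0 P _); last by rewrite addr0 (alpha_gtN1 ham).
by move=> x x0; rewrite powRr0 mul1r.
Qed.

Lemma intD_WII : intD W.
Proof. by apply: intD_eq (intD_W_poly 1) => x _; rewrite hornerC mul1r. Qed.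

Lemma L2_poly (P : {poly R}) : L2r W (fun x => P.[x]).
Proof.
split; first by apply: continuousD_meas => x; exact: poly_continuous.
by apply: intD_eq (intD_W_poly (P ^+ 2)) => x _; rewrite horner_exp.
Qed.

Lemma L2_pow a : -1 < alpha + 2 * a -> L2r W (fun x => x `^ a).
Proof.
move=> aa; split; first by apply: continuousD_meas => x; exact: pow_continuous.
apply: intD_eq (intD_W_pow aa) => x x0; rewrite -powR_mulrn ?powR_ge0//.
by rewrite -powRrM (mulrC a).
Qed.

Notation QmaxII := (Qmax W pII qII).
Notation QbcII := (Qbc W pII qII).
Notation qdII := (qd pII).
Notation qdensII := (qdens W qII).
Notation wronskII := (wronsk pII).
Notation L2 := (L2r W).
Notation "<< f , g >>" := (ip W f g).

(** The differential expression has real coefficients; this is its action on real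
    and imaginary parts. *)
Definition ellr f x : R := - x * derive1 (derive1 f) x
  + (- 1 - alpha + x + 2 * x * (xi^`()).[x] / xi.[x]) * derive1 f x
  + (m%:R - 2 * x * (xi^`()).[x] / xi.[x]) * f x.

Lemma pII_abs_cont a b : 0 < a -> a <= b -> abs_cont a b pII.
Proof. by move=> a0 ab; apply: C1_abs_cont a0 ab dpII_continuous pII_d. Qed.

Lemma pIIV_d x : 0 < x -> is_derive x 1 (fun y => (pII y)^-1) (- dpII x / pII x ^+ 2).
Proof. by move=> x0; apply: dV (pII_d x0); rewrite gt_eqF// pII_gt0. Qed.

Lemma pIIV_abs_cont a b : 0 < a -> a <= b -> abs_cont a b (fun x => (pII x)^-1).
Proof.
move=> a0 ab; apply: C1_abs_cont a0 ab _ pIIV_d => x Dx.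
have x0 : 0 < x by move: Dx; rewrite inE => /inD.
have cp : pII y @[y --> x] --> pII x by exact: d_continuous (pII_d x0).
apply: cvgM; first by apply: cvgN; exact: dpII_continuous.
apply: cvgV; first by rewrite expf_neq0// gt_eqF// pII_gt0.
by under eq_fun do rewrite expr2; rewrite expr2; exact: cvgM.
Qed.

(* the divergence form of the expression, where the second derivative exists *)
Lemma derive1_qd f x : 0 < x -> derivable (derive1 f) x 1 ->
  is_derive x 1 (qdII f) (W x * (qII x * f x - ellr f x)).
Proof.
move=> x0 /derivable_d d; apply: dEq (dM (pII_d x0) d) _.
rewrite /qII /ellr /dpII pII_W//; ring.
Qed.

Lemma Qmax_ellr f v : measurable_fun D f -> L2 f -> L2 v -> (forall x, 0 < x -> derivable f x 1) ->
  (forall a b, 0 < a -> a <= b -> abs_cont a b (derive1 f)) ->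
  aeD (fun x => v x = ellr f x) -> QmaxII f v.
Proof.
move=> mf Lf Lv df acf aev; split => //.
  by move=> a b a0 ab; apply: abs_cont_mul => //; [exact: pII_abs_cont|exact: acf].
apply: aeD_filter aev => x x0 E dq.
have d' : derivable (derive1 f) x 1.
  have d := dM (derivable_d dq) (pIIV_d x0).
  have nE : \forall y \near x, qdII f y * (pII y)^-1 = derive1 f y.
    near=> y; have y0 : 0 < y by near: y; exact: lt_nbhsr.
    by rewrite /qd mulrC mulKf// gt_eqF// pII_gt0.
  exact: d_derivable (near_eq_is_derive nE d).
by rewrite (d_derive1 (derive1_qd x0 d')) /qdens E.
Unshelve. all: by end_near. Qed.

(** Almost everywhere p f' is derivable, and then so is f', because p is smooth
    and positive. *)
Lemma Qmax_ellr_inv f v : QmaxII f v ->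
  (forall a b, 0 < a -> a <= b -> abs_cont a b f /\ abs_cont a b (derive1 f)) /\
  aeD (fun x => v x = ellr f x).
Proof.
move=> Qf; have [Lf Lv df acf aef] := Qf.
have E y : 0 < y -> qdII f y * (pII y)^-1 = derive1 f y.
  by move=> y0; rewrite /qd mulrC mulKf// gt_eqF// pII_gt0.
split.
  move=> a b a0 ab; split; first exact: (Qmax_abs_cont pII_gt0 pII_d Qf).
  apply: (@abs_cont_ext _ (fun y => qdII f y * (pII y)^-1)).
    by move=> x /andP[ax _]; rewrite E// (lt_le_trans a0).
  by apply: abs_cont_mul => //; [exact: acf|exact: pIIV_abs_cont].
have [c H] := qd_J W_continuous W_gt0 qII_continuous qII_bound intD_WII Qf.
have iq := qdens_intD W_continuous W_gt0 qII_continuous qII_bound intD_WII Lf Lv.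
apply: aeD_filter2 aef (J_derive_ae iq) => x x0 hx dJ.
have nE : \forall y \near x, c + J (qdensII f v) 0 y = qdII f y.
  by near=> y; rewrite H//; near: y; exact: lt_nbhsr.
have dq := near_eq_is_derive nE (dD (dC x c) dJ).
have nE' : \forall y \near x, qdII f y * (pII y)^-1 = derive1 f y.
  by near=> y; rewrite E//; near: y; exact: lt_nbhsr.
have d' := near_eq_is_derive nE' (dM dq (pIIV_d x0)).
have := hx (d_derivable dq); rewrite (d_derive1 (derive1_qd x0 (d_derivable d'))) /qdens.
move/(mulfI (lt0r_neq0 (W_gt0 x0)))/subrI; exact.
Unshelve. all: by end_near. Qed.

Lemma derive1_poly (P : {poly R}) : derive1 (fun x => P.[x]) = (fun x => P^`().[x]).
Proof. by apply/funext => x; rewrite (d_derive1 (dPoly P x)). Qed.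

Lemma ellr_darboux k x : 0 < x -> let P := darboux m alpha (clag alpha k) in
  ellr (fun y => P.[y]) x = k%:R * P.[x].
Proof.
move=> x0 P; have n0 := xi_gt0_neq0 x0.
have := congr1 (fun p => p.[x]) (darboux_eigen m alpha k).
rewrite -/P; move: (P) => Q; rewrite !(hornerD, hornerN, hornerM, hornerX, hornerC, hornerZ).
rewrite /ellr !derive1_poly => E.
apply: (mulfI n0); rewrite [RHS]mulrCA -E.
by move: (m%:R : R) => M; field.
Qed.

Notation Pk k := (darboux m alpha (clag alpha k)).

Lemma W_le_pow : exists2 C, 0 < C & forall x, 0 < x -> W x <= C * x `^ alpha /\
  pII x <= C * x `^ (alpha + 1).
Proof.
have [C C0 HC] := W_upper; exists C => // x x0.
have h : W x <= C * x `^ alpha.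
  apply: le_trans (HC x x0) _; rewrite ler_wpM2l ?(ltW C0)// ler_piMr ?powR_ge0//.
  by rewrite -expR0 ler_expR; lra.
split=> //; rewrite pII_W// powRS//.
have := ler_wpM2l (ltW x0) h; lra.
Qed.

Lemma pII_cvg0 : pII x @[x --> 0^'+] --> 0.
Proof.
have [C C0 HC] := W_le_pow.
have a1 : 0 < alpha + 1 by have := alpha_gtN1 ham; lra.
have h : C * x `^ (alpha + 1) @[x --> 0^'+] --> C * 0 by apply: cvgMr; exact: powR_cvg0.
rewrite mulr0 in h.
apply: (@squeeze_cvgr _ _ _ _ (fun=> 0) (fun x => C * x `^ (alpha + 1))) => //; last exact: cvg_cst.
near=> x; have x0 : 0 < x by near: x; exact: nbhs_right_gt.
by have [_ h2] := HC x x0; rewrite (ltW (pII_gt0 x0)).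
Unshelve. all: by end_near. Qed.

Lemma poly_cvg0 (P : {poly R}) : P.[x] @[x --> 0^'+] --> P.[0].
Proof.
have h : P.[x] @[x --> (0 : R)] --> P.[0] by exact: d_continuous (dPoly P 0).
by apply: cvg_at_right_filter h.
Qed.

Lemma Qbc_Pk k : QbcII (fun x => (Pk k).[x]) (fun x => k%:R * (Pk k).[x]).
Proof.
split.
  apply: Qmax_ellr.
  - by apply: continuousD_meas => x; exact: poly_continuous.
  - exact: L2_poly.
  - by apply: L2r_scale; exact: L2_poly.
  - by move=> x _; exact: d_derivable (dPoly _ x).
  - move=> a b a0 ab; rewrite derive1_poly.
    by apply: C1_abs_cont a0 ab _ (fun x _ => dPoly _ x); exact: poly_continuous.
  - by apply: aeD_all => x x0; rewrite ellr_darboux.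
rewrite /qd derive1_poly.
rewrite -[X in _ --> X](mul0r (Pk k)^`().[0]).
by apply: cvgM; [exact: pII_cvg0|exact: poly_cvg0].
Qed.

Lemma near0_ex (P : R -> Prop) : (\forall x \near 0^'+, P x) ->
  exists2 d : R, 0 < d & forall x, 0 < x < d -> P x.
Proof.
move=> [e /= e0 H]; exists e => // x /andP[x0 xe]; apply: H => //=.
by rewrite sub0r normrN gtr0_norm.
Qed.

Lemma neary_ex (P : R -> Prop) : (\forall x \near +oo, P x) ->
  exists2 X : R, 1 <= X & forall x, X <= x -> P x.
Proof.
move=> [M [_ H]]; exists (Num.max 1 (M + 1)); first by rewrite le_max lexx.
move=> x; rewrite ge_max => /andP[_ Mx]; apply: H; lra.
Qed.

Lemma cvg_away (F : set_system R) {FF : Filter F} f c : c != 0 -> f x @[x --> F] --> c ->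
  \forall x \near F, `|c| / 2 <= Num.sg c * f x.
Proof.
move=> c0 cf; have c20 : 0 < `|c| / 2 by rewrite divr_gt0 ?normr_gt0.
move/cvgrPdist_le: cf => /(_ _ c20); apply: filterS => x.
have [cp|cn|E] := ltgtP 0 c; last by rewrite -E eqxx in c0.
- by rewrite (gtr0_norm cp) (gtr0_sg cp) ler_norml; lra.
- by rewrite (ltr0_norm cn) (ltr0_sg cn) ler_norml; lra.
Qed.

Lemma poly_bounded01 (P : {poly R}) : exists2 C, 0 < C & forall x, 0 < x < 1 -> `|P.[x]| <= C.
Proof.
have [C C0 H] := poly_exp_bound P ltr01; exists (C * expR 1); first by rewrite mulr_gt0 ?expR_gt0.
move=> x /andP[x0 x1]; apply: le_trans (H x (ltW x0)) _.
by rewrite ler_wpM2l ?(ltW C0)// ler_expR mul1r ltW.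
Qed.

Lemma pII_bounded01 : exists2 C, 0 < C & forall x, 0 < x < 1 -> pII x <= C.
Proof.
have [C C0 H] := W_le_pow; exists C => // x /andP[x0 x1].
have [_ h] := H x x0; apply: le_trans h _; rewrite ler_piMr ?(ltW C0)//.
have := alpha_gtN1 ham; rewrite -(powRr0 x) => ?; apply: powR_le01; lra.
Qed.

(** If the boundary form with a polynomial did not vanish at 0, then p f P' would be
    bounded below there, and f^2 W would dominate 1 / x. *)
Lemma wronsk_poly_cvg0 f v (P : {poly R}) l : QbcII f v ->
  wronskII f (fun x => P.[x]) x @[x --> 0^'+] --> l -> l = 0.
Proof.
move=> [Qf q0] cw; apply/eqP; apply: contraT => l0; exfalso.
have cf : f x * qdII (fun x => P.[x]) x @[x --> 0^'+] --> l.
  have h : wronskII f (fun x => P.[x]) x + qdII f x * P.[x] @[x --> 0^'+] --> l + 0 * P.[0].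
    by apply: cvgD => //; apply: cvgM => //; exact: poly_cvg0.
  rewrite mul0r addr0 in h; apply: cvg_trans h; apply: near_eq_cvg.
  by apply: nearW => x; rewrite /wronsk; ring.
have [d d0 Hd] := near0_ex (cvg_away l0 cf).
have [K K0 HK] := poly_bounded01 P^`().
have [C C0 HC] := pII_bounded01.
have [Lf _ _ _ _] := Qf; have [mf f2] := Lf.
pose c := (`|l| / 2) ^+ 2 / (C * K ^+ 2).
have l20 : 0 < `|l| / 2 by rewrite divr_gt0 ?normr_gt0.
have K2 := exprn_gt0 2 K0.
have c0 : 0 < c by apply: divr_gt0; [exact: exprn_gt0|exact: mulr_gt0].
apply: (@intD_not_inv R _ c (Num.min d 1) c0 _ f2).
- by rewrite lt_min d0 ltr01.
- by move=> x x0; rewrite mulr_ge0 ?sqr_ge0// ltW// W_gt0.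
move=> x; rewrite lt_min => /andP[x0 /andP[xd x1]].
have h1 := Hd x; rewrite x0 xd in h1; have {h1}h1 := h1 isT.
have h2 : `|l| / 2 <= `|f x| * pII x * K.
  apply: le_trans h1 _; apply: le_trans (ler_norm _) _.
  rewrite 2!normrM normr_sg l0 mul1r /qd derive1_poly normrM (gtr0_norm (pII_gt0 x0)) -mulrA.
  by rewrite ler_wpM2l// ler_wpM2l ?(ltW (pII_gt0 x0))// HK// x0.
have h3 : (`|l| / 2) ^+ 2 <= (`|f x| * pII x * K) ^+ 2.
  by rewrite lerXn2r// nnegrE ?(ltW l20)// (le_trans (ltW l20)).
have p1 := pII_gt0 x0; have w1 := W_gt0 x0.
have h4 := HC x; rewrite x0 x1 in h4; have {h4}h4 := h4 isT.
rewrite /c ler_pdivrMr// ler_pdivrMr ?(mulr_gt0 C0 K2)//.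
apply: le_trans h3 _.
have -> : f x ^+ 2 * W x * x * (C * K ^+ 2) = f x ^+ 2 * (pII x * C) * K ^+ 2.
  by rewrite pII_W//; ring.
move: (pII x) (f x) p1 h4 => q F q1 qC.
rewrite !exprMn real_normK ?num_real// ler_wpM2r ?sqr_ge0// ler_wpM2l ?sqr_ge0//.
by rewrite expr2 ler_wpM2l// ltW.
Qed.

(** Bounds at infinity: p P^2 decays like e^(-3x/4), while W is at least of the order
    of e^(-5x/4); what matters is that twice 3/4 exceeds 5/4. *)
Lemma pII_poly_decay (P : {poly R}) : exists2 C, 0 < C & forall x, 1 <= x ->
  pII x * P.[x] ^+ 2 <= C * expR (- (3 / 4 * x)).
Proof.
have [C C0 HC] := W_upper.
have a0 := alpha_gtN1 ham.
pose n := Num.bound (alpha + 1).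
have h4 : (0 : R) < 4^-1 by lra.
have [K K0 HK] := poly_exp_bound ('X^n * P ^+ 2) h4.
exists (C * K) => [|x x1]; first exact: mulr_gt0.
have x0 : 0 < x by lra.
have h1 : x `^ (alpha + 1) <= x ^+ n.
  rewrite -powR_mulrn ?(ltW x0)//; apply: ler_powR => //.
  by apply/ltW/archi_boundP; lra.
have h2 := HK x (ltW x0); rewrite hornerM hornerXn horner_exp in h2.
have h3 : x ^+ n * P.[x] ^+ 2 <= K * expR (4^-1 * x) by apply: le_trans h2; exact: ler_norm.
have h5 := ler_wpM2l (ltW x0) (HC x x0).
rewrite -pII_W// in h5.
have h6 : pII x <= C * (x ^+ n * expR (- x)).
  apply: le_trans h5 _; rewrite mulrCA ler_wpM2l ?(ltW C0)// mulrA ler_wpM2r ?expR_ge0//.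
  by rewrite -powRS.
have h7 := ler_wpM2r (sqr_ge0 P.[x]) h6; apply: le_trans h7 _.
have h8 := ler_wpM2r (expR_ge0 (- x)) h3.
have -> : expR (- (3 / 4 * x)) = expR (4^-1 * x) * expR (- x) by rewrite -expRD; congr expR; field.
have := ler_wpM2l (ltW C0) h8; lra.
Qed.

Lemma W_lowery : exists2 c, 0 < c & forall x, 1 <= x -> c * expR (- (5 / 4 * x)) <= W x.
Proof.
have a0 := alpha_gtN1 ham.
have h4 : (0 : R) < 4^-1 by lra.
have [K K0 HK] := poly_exp_bound ('X * xi ^+ 2) h4.
exists K^-1; first by rewrite invr_gt0.
move=> x x1; have x0 : 0 < x by lra.
have n0 := xi_gt0_neq0 x0.
have n2 : 0 < xi.[x] ^+ 2 by rewrite exprn_even_gt0.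
have h1 : x^-1 <= x `^ alpha.
  rewrite -powR_inv1 ?(ltW x0)//; apply: ler_powR => //; lra.
have h2 : x * xi.[x] ^+ 2 <= K * expR (4^-1 * x).
  have := HK x (ltW x0); rewrite hornerM hornerX horner_exp; apply: le_trans; exact: ler_norm.
have -> : expR (- (5 / 4 * x)) = expR (- x) / expR (4^-1 * x).
  by rewrite -expRN -expRD; congr expR; field.
have E0 := expR_gt0 (4^-1 * x).
apply: (@le_trans _ _ (x^-1 * expR (- x) / xi.[x] ^+ 2)); last first.
  by rewrite /weightII ler_wpM2r ?invr_ge0 ?(ltW n2)// ler_wpM2r ?expR_ge0.
have -> : x^-1 * expR (- x) / xi.[x] ^+ 2 = expR (- x) * (x * xi.[x] ^+ 2)^-1.
  by field; rewrite n0 gt_eqF.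
rewrite mulrCA -invfM ler_wpM2l ?expR_ge0//.
by rewrite lef_pV2 ?posrE ?(mulr_gt0 K0 E0) ?(mulr_gt0 x0 n2).
Qed.

(** If the boundary form F with P did not vanish at infinity, then
    (f / P)' = - F / (p P^2) would force f / P to grow like e^(3x/4), so that f^2 W
    would stay away from 0. *)
Lemma wronsk_poly_cvgy f v (P : {poly R}) l : P != 0 -> QmaxII f v ->
  wronskII f (fun x => P.[x]) x @[x --> +oo] --> l -> l = 0.
Proof.
move=> P0 Qf cw; apply/eqP; apply: contraT => l0; exfalso.
have [X1 X1_ge1 HX1] := neary_ex (cvg_away l0 cw).
have [X2 [cP [X20 cP0 HP]]] := poly_lower P0.
have [C C0 HC] := pII_poly_decay P.
have [cW cW0 HW] := W_lowery.
have [Lf _ _ _ _] := Qf; have [mf f2] := Lf.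
have l20 : 0 < `|l| / 2 by rewrite divr_gt0 ?normr_gt0.
pose X := Num.max X1 X2.
have X1X : X1 <= X by rewrite le_max lexx.
have X2X : X2 <= X by rewrite le_max lexx orbT.
pose K := `|l| / 2 / C.
have K0 : 0 < K by rewrite /K divr_gt0.
have Pn x : X <= x -> P.[x] != 0.
  by move=> Xx; rewrite -normr_gt0; apply: lt_le_trans (HP x _) => //; lra.
pose g x := - Num.sg l * (f x / P.[x]) - K * expR (3 / 4 * x).
pose dg x := Num.sg l * (wronskII f (fun x => P.[x]) x / (pII x * P.[x] ^+ 2)) - K * (expR (3 / 4 * x) * (3 / 4)).
have dG x : X <= x -> is_derive x 1 g (dg x).
  move=> Xx; have x0 : 0 < x by lra.
  have pn := Pn x Xx; have p1 := pII_gt0 x0.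
  have df := Qmax_d pII_gt0 Qf x0.
  have d1 := dZ (- Num.sg l) (dM df (dV pn (dPoly P x))).
  have d2 := dZ K (dExp (dZ (3 / 4) (dId x))).
  apply: dEq (dB d1 d2) _; rewrite /dg /wronsk [qdII (fun y => P.[y]) x]/qd derive1_poly.
  move: (qdII f x) (pII x) p1 (Num.sg l) (expR _) => z q q0 s E.
  by field; rewrite pn gt_eqF.
have dg0 x : X <= x -> 0 <= dg x.
  move=> Xx; have x1 : 1 <= x by lra.
  have x0 : 0 < x by lra.
  have pn := Pn x Xx; have p1 := pII_gt0 x0.
  have w1 := HX1 x (le_trans X1X Xx); have h1 := HC x x1.
  have q1 : 0 < pII x * P.[x] ^+ 2 by rewrite mulr_gt0// exprn_even_gt0.
  have E0 := expR_gt0 (3 / 4 * x).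
  rewrite expRN in h1.
  rewrite /dg mulrA subr_ge0.
  apply: (@le_trans _ _ (K * expR (3 / 4 * x))); first by have := mulr_gt0 K0 E0; lra.
  apply: (@le_trans _ _ (`|l| / 2 / (pII x * P.[x] ^+ 2))); last first.
    by rewrite ler_wpM2r// invr_ge0 ltW.
  rewrite /K -mulrA ler_wpM2l ?(ltW l20)//.
  have -> : C^-1 * expR (3 / 4 * x) = (C / expR (3 / 4 * x))^-1.
    by field; rewrite !gt_eqF.
  by rewrite lef_pV2 ?posrE ?divr_gt0.
have mono x : X < x -> g X <= g x.
  move=> Xx; have [|c /andP[Xc cx] E] := @mvt _ g dg X x Xx.
    by move=> y /andP[Xy _]; exact: dG.
  by rewrite -subr_ge0 E mulr_ge0 ?dg0 ?(ltW Xc)// subr_ge0 ltW.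
(* beyond B the exponential has absorbed the constant g X *)
pose B := Num.max (X + 1) (2 / K * `|g X| * (4 / 3)).
have low x : B <= x -> K / 2 * expR (3 / 4 * x) <= `|f x / P.[x]|.
  rewrite ge_max => /andP[Xx Bx].
  have XXx : X < x by lra.
  have h1 := mono x XXx; have h2 := expR_ge1Dx (3 / 4 * x).
  have h3 : `|g X| <= K / 2 * expR (3 / 4 * x).
    have : 2 / K * `|g X| <= expR (3 / 4 * x) by lra.
    by move/(ler_wpM2l (ltW K0)); rewrite mulrA mulrCA divff ?gt_eqF// mulr1; lra.
  have h4 : - Num.sg l * (f x / P.[x]) <= `|f x / P.[x]|.
    apply: le_trans (ler_norm _) _.
    by rewrite normrM normrN normr_sg l0 mul1r.
  have h5 : - `|g X| <= g X by rewrite lerNl -normrN ler_norm.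
  move: h1; rewrite [g x]/g; lra.
have B1 : 1 <= B by rewrite le_max; apply/orP; left; lra.
pose c := (K / 2 * cP) ^+ 2 * cW.
apply: (@intD_not_cst R _ c B _ _ f2).
- by rewrite /c mulr_gt0// exprn_gt0// mulr_gt0// divr_gt0.
- lra.
- by move=> x x0; rewrite mulr_ge0 ?sqr_ge0// ltW// W_gt0.
move=> x Bx; have x1 : 1 <= x by lra.
have Xx : X <= x by move: Bx; rewrite ge_max => /andP[? _]; lra.
have h1 := low x Bx; have h2 := HP x (le_trans X2X Xx); have h3 := HW x x1.
have pn := Pn x Xx; have E0 := expR_gt0 (3 / 4 * x).
have h4 : K / 2 * cP * expR (3 / 4 * x) <= `|f x|.
  have -> : `|f x| = `|f x / P.[x]| * `|P.[x]| by rewrite -normrM divfK.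
  have -> : K / 2 * cP * expR (3 / 4 * x) = K / 2 * expR (3 / 4 * x) * cP by ring.
  by apply: ler_pM => //; [rewrite mulr_ge0// ltW// divr_gt0|exact: ltW].
have Kc : 0 < K / 2 * cP by rewrite mulr_gt0// divr_gt0.
have h5 : (K / 2 * cP * expR (3 / 4 * x)) ^+ 2 <= f x ^+ 2.
  rewrite -[X in _ <= X]real_normK ?num_real//.
  by rewrite lerXn2r// nnegrE// mulr_ge0// ltW.
apply: le_trans (ler_pM _ _ h5 h3); [|exact: sqr_ge0|by rewrite mulr_ge0 ?expR_ge0// ltW].
rewrite /c.
have -> : (K / 2 * cP * expR (3 / 4 * x)) ^+ 2 * (cW * expR (- (5 / 4 * x))) =
   (K / 2 * cP) ^+ 2 * cW * (expR (3 / 4 * x) * expR (3 / 4 * x) * expR (- (5 / 4 * x))) by ring.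
rewrite -!expRD ler_peMr//; first by rewrite mulr_ge0 ?sqr_ge0// ltW.
by apply: le_trans (expR_ge1Dx _); lra.
Qed.

Lemma Pk_neq0 k : Pk k != 0.
Proof. by apply/eqP => E; have := darboux_at0_neq0 ham k; rewrite E horner0 eqxx. Qed.

(** Green's formula without boundary terms. *)
Theorem Qbc_Pk_sym f v k : QbcII f v ->
  << v, (fun x => (Pk k).[x]) >> = k%:R * << f, (fun x => (Pk k).[x]) >>.
Proof.
move=> Qf; have [QP _] := Qbc_Pk k; have [Qm _] := Qf; have LP := L2_poly (Pk k).
have [l0 [l1 [c0 c1 E]]] := green_cvg W_continuous W_gt0 pII_gt0 pII_d Qm QP.
move: E; rewrite (wronsk_poly_cvg0 Qf c0) (wronsk_poly_cvgy (Pk_neq0 k) Qm c1) subrr.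
move/esym/eqP; rewrite subr_eq0 => /eqP ->.
by have [Lf _ _ _ _] := Qm; rewrite ipC (ipZl mW W_gt0 k%:R LP Lf) ipC.
Qed.

Lemma W_lower01 : exists2 c, 0 < c & forall x, 0 < x < 1 -> c * x `^ alpha <= W x.
Proof.
have [C C0 HC] := poly_bounded01 xi.
exists (expR (- 1) / C ^+ 2); first by rewrite divr_gt0 ?expR_gt0// exprn_gt0.
move=> x /[dup] x01 /andP[x0 x1]; have n0 := xi_gt0_neq0 x0.
have n2 : 0 < xi.[x] ^+ 2 by rewrite exprn_even_gt0.
have C2 := exprn_gt0 2 C0.
rewrite mulrC /weightII -mulrA ler_wpM2l ?powR_ge0//.
apply: ler_pM; [exact: expR_ge0|by rewrite invr_ge0 ltW| |].
  by rewrite ler_expR; lra.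
rewrite lef_pV2 ?posrE//.
by rewrite -[X in X <= _]real_normK ?num_real// lerXn2r ?nnegrE ?(ltW C0)// HC.
Qed.

(** For alpha >= 1 every function of the maximal domain satisfies the boundary
    condition: otherwise f would grow like x^(-alpha) at 0 and f^2 W like 1 / x. *)
Lemma Qmax_Qbc f v : 1 <= alpha -> QmaxII f v -> QbcII f v.
Proof.
move=> a1 Qf; split=> //.
have [l [_ cl]] := qd_cvg W_continuous W_gt0 qII_continuous qII_bound intD_WII Qf.
suff E : l = 0 by rewrite E in cl.
apply/eqP; apply: contraT => l0; exfalso.
have [d d0 Hd] := near0_ex (cvg_away l0 cl).
have [C C0 HC] := W_le_pow.
have [Lf _ _ _ _] := Qf; have [mf f2] := Lf.
have l20 : 0 < `|l| / 2 by rewrite divr_gt0 ?normr_gt0.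
pose K := `|l| / 2 / C.
have K0 : 0 < K by rewrite /K divr_gt0.
pose g x := Num.sg l * f x + K / alpha * x `^ (- alpha).
pose dg x := Num.sg l * (qdII f x / pII x) + K / alpha * (- alpha * x `^ (- alpha - 1)).
have dG x : 0 < x -> is_derive x 1 g (dg x).
  by move=> x0; apply: dD; apply: dZ; [exact: (Qmax_d pII_gt0 Qf x0)|exact: dPow].
have a0 : alpha != 0 by rewrite gt_eqF//; lra.
have dg0 x : 0 < x < d -> 0 <= dg x.
  move=> xd; have := Hd x xd; case/andP: xd => x0 _ h1.
  have [_ h2] := HC x x0; have p1 := pII_gt0 x0.
  have x1 := powR_gt0 (alpha + 1) x0.
  have -> : dg x = Num.sg l * qdII f x / pII x - K * x `^ (- alpha - 1).
    by rewrite /dg mulrA; congr (_ + _); rewrite mulrA mulrN divfK// mulNr.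
  rewrite subr_ge0; apply: (@le_trans _ _ (`|l| / 2 / pII x)); last first.
    by rewrite ler_wpM2r// invr_ge0 ltW.
  have -> : - alpha - 1 = - (alpha + 1) by ring.
  by rewrite powRN /K -mulrA -invfM ler_wpM2l ?(ltW l20)// lef_pV2 ?posrE ?(mulr_gt0 C0 x1).
pose e := d / 2.
have e0 : 0 < e by rewrite /e; lra.
have mono x : 0 < x < e -> g x <= g e.
  move=> /andP[x0 xe]; have [|c /andP[xc ce] E] := @mvt _ g dg x e xe.
    by move=> y /andP[Xy _]; apply: dG; lra.
  by rewrite -subr_ge0 E mulr_ge0 ?dg0// ?subr_ge0 ?(ltW xe)//; apply/andP; rewrite /e in ce; split; lra.

have low x : 0 < x < e -> K / alpha * x `^ (- alpha) - `|g e| <= `|f x|.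
  move=> xe; have h := mono x xe; have := ler_norm (g e).
  have : - (Num.sg l * f x) <= `|f x|.
    by rewrite -mulNr; apply: le_trans (ler_norm _) _; rewrite normrM normrN normr_sg l0 mul1r.
  move: h; rewrite [g x]/g; lra.
have Ka : 0 < K / alpha / 2 by rewrite !divr_gt0//; lra.
have [cW cW0 HW] := W_lower01.
pose d' := K / alpha / 2 / (`|g e| + 1).
have ge1 : 0 < `|g e| + 1 by have := normr_ge0 (g e); lra.
have d'0 : 0 < d' by rewrite /d' divr_gt0.
pose c := (K / alpha / 2) ^+ 2 * cW.
apply: (@intD_not_inv R _ c (Num.min e (Num.min d' 1)) _ _ f2).
- by rewrite /c mulr_gt0// exprn_gt0.
- by rewrite !lt_min e0 d'0 ltr01.
- by move=> x x0; rewrite mulr_ge0 ?sqr_ge0// ltW// W_gt0.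
move=> x; rewrite !lt_min => /andP[x0 /and3P[xe xd' x1]].
have h1 := low x; rewrite x0 xe in h1; have {h1}h1 := h1 isT.
have h2 := HW x; rewrite x0 x1 in h2; have {h2}h2 := h2 isT.
have xV : x^-1 <= x `^ (- alpha).
  by rewrite -powR_inv1 ?(ltW x0)//; apply: powR_le01 => //; [exact: ltW|lra].
have h3 : `|g e| <= K / alpha / 2 * x^-1.
  move: xd'; rewrite /d' ltr_pdivlMr// => h.
  rewrite -ler_pdivrMr ?invr_gt0// invrK; have := mulrDr x `|g e| 1; lra.
have h4 := ler_wpM2l (ltW Ka) xV.
have h5 : K / alpha / 2 * x `^ (- alpha) <= `|f x| by lra.
have h6 : (K / alpha / 2 * x `^ (- alpha)) ^+ 2 <= f x ^+ 2.
  rewrite -[X in _ <= X]real_normK ?num_real//.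
  by rewrite lerXn2r// nnegrE// mulr_ge0 ?powR_ge0// ltW.
apply: le_trans (ler_pM _ _ h6 h2); [|exact: sqr_ge0|by rewrite mulr_ge0 ?powR_ge0// ltW].
have -> : (K / alpha / 2 * x `^ (- alpha)) ^+ 2 * (cW * x `^ alpha) =
  c * (x `^ (- alpha) * (x `^ (- alpha) * x `^ alpha)) by rewrite /c; ring.
rewrite -powRDx// [- alpha + _]addrC subrr powRr0 mulr1 ler_wpM2l//.
by rewrite /c mulr_ge0 ?sqr_ge0// ltW.
Qed.

Lemma dxi_bound : exists C, forall x, 0 < x -> `|(xi^`()).[x] / xi.[x]| <= C.
Proof.
have [C C0 HC] := poly_exp_bound xi^`() ltr01.
have [c c0 Hc] := xi_lower ham.
exists (Num.max m%:R (C * expR 1 / c)) => x x0; rewrite le_max.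
have [x1|x1] := leP x 1.
  apply/orP; right; rewrite normrM normfV; apply: ler_pM => //.
    apply: le_trans (HC x (ltW x0)) _.
    by rewrite ler_wpM2l ?(ltW C0)// ler_expR mul1r.
  by rewrite lef_pV2 ?posrE ?normr_gt0 ?xi_gt0_neq0// Hc// ltW.
apply/orP; left; have := xdxi_bound x0; rewrite -mulrA; move: (_ / _) => r /andP[r0 rm].
have r0' : 0 <= r by rewrite pmulr_rge0 in r0.
by rewrite ger0_norm//; apply: le_trans rm; rewrite ler_peMl// ltW.
Qed.

(** For alpha < 1 the second Frobenius solution at 0 is in L^2 there. An
    antiderivative of x^(-alpha-1) behaves like x^(-alpha), or like ln x when
    alpha = 0; bounding it by x^(-be) with max(alpha, 0) <= be and 2 be < alpha + 1
    treats all cases at once. *)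
Lemma boundary_function : alpha < 1 ->
  exists phi w l, [/\ QmaxII phi w, l != 0 & qdII phi x @[x --> 0^'+] --> l].
Proof.
move=> a1; have a0 := alpha_gtN1 ham.
have [phi dphi] := antiderivative (@pow_continuous R (- alpha - 1)).
pose be := (1 + alpha) ^+ 2 / 4.
have be0 : 0 < be by rewrite /be divr_gt0// exprn_gt0//; lra.
have bea : alpha <= be.
  have := sqr_ge0 (1 - alpha); rewrite /be !expr2; lra.
have be2 : be * 2 < alpha + 1.
  have h : (1 + alpha) * (1 + alpha) < (1 + alpha) * 2 by rewrite ltr_pM2l; lra.
  rewrite /be expr2; lra.
have inc x y : 0 < x -> x <= y -> phi x <= phi y.
  move=> x0; rewrite le_eqVlt => /predU1P[->//|xy].
  have [|c _ E] := @mvt _ phi (fun t => t `^ (- alpha - 1)) x y xy.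
    by move=> t /andP[xt _]; apply: dphi; exact: lt_le_trans xt.
  by rewrite -subr_ge0 E mulr_ge0 ?powR_ge0// subr_ge0 ltW.
have phi_small x : 0 < x -> x <= 1 -> phi 1 + be^-1 - be^-1 * x `^ (- be) <= phi x.
  move=> x0; rewrite le_eqVlt => /predU1P[->|x1]; first by rewrite powR1; lra.
  have [|c /andP[xc c1] E] := @mvt _ (fun t => phi t + be^-1 * t `^ (- be))
      (fun t => t `^ (- alpha - 1) + be^-1 * (- be * t `^ (- be - 1))) x 1 x1.
    move=> t /andP[xt _]; have t0 : 0 < t by exact: lt_le_trans xt.
    by apply: dD; [exact: dphi|apply: dZ; exact: dPow].
  have : phi 1 + be^-1 * 1 `^ (- be) - (phi x + be^-1 * x `^ (- be)) <= 0.
    rewrite E mulr_le0_ge0 ?subr_ge0 ?(ltW x1)//.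
    rewrite mulrA mulrN mulVf ?gt_eqF// mulN1r subr_le0.
    apply: powR_le01; lra.
  rewrite powR1; lra.
have phi_large x : 1 <= x -> phi x <= phi 1 + x.
  rewrite le_eqVlt => /predU1P[<-|x1]; first lra.
  have [|c /andP[c1 cx] E] := @mvt _ phi (fun t => t `^ (- alpha - 1)) 1 x x1.
    by move=> t /andP[xt _]; apply: dphi; lra.
  have : c `^ (- alpha - 1) <= 1.
    rewrite -[X in _ <= X](powRr0 c); apply: ler_powR; [exact: ltW|lra].
  move/(ler_wpM2r (_ : 0 <= x - 1)) => h; have := h (ltac:(lra)); lra.
pose C := `|phi 1| + be^-1 + 1.
have beV : 0 < be^-1 by rewrite invr_gt0.
have C1 : 1 <= C by have := normr_ge0 (phi 1); rewrite /C; lra.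
have phi_bound x : 0 < x -> `|phi x| <= C * (x `^ (- be) + x).
  move=> x0; have xb := powR_ge0 x (- be).
  have n1 := ler_norm (phi 1); have n2 := ler_norm (- phi 1); rewrite normrN in n2.
  have n3 := normr_ge0 (phi 1).
  have [x1|x1] := leP x 1.
    have h1 : 1 <= x `^ (- be).
      by rewrite -[X in X <= _](powRr0 x); apply: powR_le01 => //; rewrite oppr_le0 ltW.
    have h2 := phi_small x x0 x1; have h3 := inc x 1 x0 x1.
    have h4 : C * x `^ (- be) <= C * (x `^ (- be) + x) by rewrite ler_wpM2l; lra.
    apply: le_trans h4.
    have h5 : `|phi 1| <= `|phi 1| * x `^ (- be) by rewrite ler_peMr.
    rewrite /C ler_norml; apply/andP; split; lra.
  have h2 := phi_large x (ltW x1); have h3 := inc 1 x ltr01 (ltW x1).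
  have h4 : C * x <= C * (x `^ (- be) + x) by rewrite ler_wpM2l; lra.
  apply: le_trans h4.
  have h5 : `|phi 1| <= `|phi 1| * x by rewrite ler_peMr// ltW.
  have h6 : 0 <= be^-1 * x by rewrite mulr_ge0// ltW.
  rewrite /C ler_norml; apply/andP; split; lra.
have cphi : {in D, continuous phi}.
  by move=> x; rewrite inE => /inD x0; exact: d_continuous (dphi x x0).
have mphi := continuousD_meas cphi.
have Lphi : L2 phi.
  split=> //.
  have i1 : intD (fun x => x `^ (- be + - be) * W x) by apply: intD_W_pow; lra.
  have i2 : intD (fun x => x `^ 2 * W x) by apply: intD_W_pow; lra.
  apply: intD_le (intD_scale (2 * C ^+ 2) (intD_add i1 i2)).
    by apply: measurable_funM => //; exact: measurable_funX.
  move=> x x0; have w0 := W_gt0 x0.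
  rewrite normrM (gtr0_norm w0) ger0_norm ?sqr_ge0//.
  rewrite -mulrDl mulrA; apply: ler_wpM2r; first exact: ltW.
  have h1 : phi x ^+ 2 <= (C * (x `^ (- be) + x)) ^+ 2.
    rewrite -[X in X <= _]real_normK ?num_real// lerXn2r ?nnegrE// ?phi_bound//.
    by apply: le_trans (phi_bound x x0).
  apply: le_trans h1 _; rewrite exprMn.
  rewrite powRDx// powR_mulrn ?(ltW x0)//.
  have := sqr_ge0 (x `^ (- be) - x); move: (x `^ (- be)) => z hz.
  have h2 : (z + x) ^+ 2 <= 2 * (z * z + x ^+ 2) by move: hz; rewrite !expr2; lra.
  have := ler_wpM2l (sqr_ge0 C) h2; lra.
have d1phi x : 0 < x -> derive1 phi x = x `^ (- alpha - 1).
  by move=> x0; rewrite (d_derive1 (dphi x x0)).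
have d2phi x : 0 < x -> is_derive x 1 (derive1 phi) ((- alpha - 1) * x `^ (- alpha - 1 - 1)).
  move=> x0; apply: near_eq_is_derive (dPow (- alpha - 1) x0).
  by near=> y; rewrite d1phi//; near: y; exact: lt_nbhsr.
have [K HK] := dxi_bound.
pose w x := (1 + 2 * ((xi^`()).[x] / xi.[x])) * x `^ (- alpha) + qII x * phi x.
have Lw : L2 w.
  have Lp : L2 (fun x => x `^ (- alpha)) by apply: L2_pow; lra.
  apply: (L2r_add mW W_gt0); last first.
    exact: (L2_q W_continuous W_gt0 qII_continuous qII_bound Lphi).
  apply: (@L2_bounded _ _ W_continuous W_gt0 _ (1 + 2 * K)) => //.
    apply: continuousD_meas => x Dx.
    by apply: cvgD; [exact: cvg_cst|apply: cvgM; [exact: cvg_cst|exact: dxi_continuous]].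
  move=> x x0; apply: le_trans (ler_normD _ _) _; rewrite normr1 lerD2l normrM ger0_norm//.
  by rewrite ler_wpM2l// HK.
exists phi, w, (expR (- 0) / xi.[0] ^+ 2); split.
- apply: Qmax_ellr => //.
  + by move=> x x0; exact: d_derivable (dphi x x0).
  + move=> a b a0' ab; apply: (@abs_cont_ext _ (fun x => x `^ (- alpha - 1))).
      by move=> x /andP[ax _]; rewrite d1phi// (lt_le_trans a0').
    apply: (@C1_abs_cont _ _ (fun x => (- alpha - 1) * x `^ (- alpha - 1 - 1))) => //.
      by move=> x Dx; apply: cvgM; [exact: cvg_cst|exact: pow_continuous].
  + apply: aeD_all => x x0; have n0 := xi_gt0_neq0 x0.
    rewrite /w /ellr (d_derive1 (d2phi x x0)) d1phi// /qII.
    have -> : x `^ (- alpha) = x * x `^ (- alpha - 1) by rewrite -powRS// subrK.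
    have -> : x `^ (- alpha - 1) = x * x `^ (- alpha - 1 - 1) by rewrite -powRS// subrK.
    by move: (m%:R : R) => M; field.
- by apply: mulf_neq0; [rewrite gt_eqF// expR_gt0|rewrite invr_neq0// expf_neq0// (xi_neq0 ham)].
have h : expR (- x) / xi.[x] ^+ 2 @[x --> (0 : R)] --> expR (- 0) / xi.[0] ^+ 2.
  apply: cvgM; first exact: d_continuous (dExp (dN (dId (0 : R)))).
  apply: cvgV; first by rewrite expf_neq0// (xi_neq0 ham).
  under eq_fun do rewrite expr2.
  by rewrite expr2; apply: cvgM; exact: d_continuous (dPoly _ _).
have {}h := cvg_at_right_filter h; apply: cvg_trans h; apply: near_eq_cvg; near=> x.
have x0 : 0 < x by near: x; exact: nbhs_right_gt.
have E : x `^ (alpha + 1) * x `^ (- alpha - 1) = 1.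
  by rewrite -powRDx// (_ : alpha + 1 + _ = 0) ?powRr0//; ring.
by rewrite /qd d1phi// /pII -[LHS]mul1r -[X in X * _ = _]E; ring.
Unshelve. all: by end_near. Qed.
End exceptional_weight.

(** * Completeness of the exceptional polynomials *)

Section completeness.
Context {R : realType}.
Notation mu := (@lebesgue_measure R).
Notation D := (`]0%R, +oo[%classic : set R).
Notation "'I' f" := (\int[mu]_(x in D) (f : R -> R) x) (at level 10, f at level 8).
Implicit Types (f g u v w : R -> R) (a b c s t x : R) (y z P : {poly R}).
Let mD := @measD R.
Variables (m : nat) (alpha : R).
Hypothesis ham : m%:R - 1 < alpha.
Notation xi := (xiII m alpha).
Notation W := (weightII m alpha).
Notation L2 := (L2r W).
Notation "<< f , g >>" := (ip W f g).
Notation Pk k := (darboux m alpha (clag alpha k)).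
Notation QbcII := (Qbc W (pII m alpha) (qII m alpha)).
Let W0 := @W_gt0 R m alpha ham.
Let cW := @W_continuous R m alpha ham.
Let mW : measurable_fun D W. Proof. exact: (continuousD_meas (W_continuous ham)). Qed.

Let mexp c : measurable_fun D (fun x : R => expR (c * x)).
Proof.
apply: continuousD_meas => x _; exact: d_continuous (dExp (dZ c (dId x))).
Qed.

Lemma L2_poly_exp P : L2 (fun x => P.[x] * expR (4^-1 * x)).
Proof.
have [C C0 HC] := W_upper ham.
have h4 : (0 : R) < 4^-1 by lra.
have [K K0 HK] := poly_exp_bound (P ^+ 2) h4.
have mP : measurable_fun D (fun x => P.[x]) by apply: continuousD_meas; exact: poly_continuous.
have mPe : measurable_fun D (fun x => P.[x] * expR (4^-1 * x)).
  by apply: measurable_funM => //; exact: mexp.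
split => //.
apply: (@intD_bound R _ alpha 4^-1 (K * C)) => //; first exact: (alpha_gtN1 ham).
  by apply: measurable_funM => //; exact: measurable_funX.
move=> x x0; rewrite normrM (gtr0_norm (W0 x0)) ger0_norm ?sqr_ge0// exprMn.
have h1 := HK x (ltW x0); rewrite horner_exp ger0_norm ?sqr_ge0// in h1.
have h2 := HC x x0; have e0 := expR_ge0 (4^-1 * x).
have h3 : P.[x] ^+ 2 * expR (4^-1 * x) ^+ 2 <= K * expR (4^-1 * x) * expR (4^-1 * x) ^+ 2.
  by rewrite ler_wpM2r ?sqr_ge0.
apply: le_trans (ler_pM _ _ h3 h2) _.
- by rewrite mulr_ge0 ?sqr_ge0.
- by rewrite ltW// W0.
have -> : expR (- x) = expR (- (4^-1 * x)) * expR (- (4^-1 * x)) * expR (- (4^-1 * x)) * expR (- (4^-1 * x)).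
  by rewrite -!expRD; congr expR; field.
rewrite expRN; have E0 : expR (4^-1 * x) != 0 by rewrite gt_eqF ?expR_gt0.
move: (expR _) E0 => E E0.
by rewrite le_eqVlt; apply/orP; left; apply/eqP; field.
Qed.

Lemma intD_poly_exp g P : L2 g -> intD (fun x => `|g x * P.[x] * W x| * expR (4^-1 * x)).
Proof.
move=> Lg; have i := intD_norm (L2r_mul mW W0 Lg (L2_poly_exp P)).
apply: intD_eq i => x x0.
rewrite -[in RHS](gtr0_norm (expR_gt0 (4^-1 * x))) -normrM; congr `|_|; ring.
Qed.

Lemma intD_poly g P : L2 g -> intD (fun x => g x * P.[x] * W x).
Proof. by move=> Lg; exact: (L2r_mul mW W0 Lg (L2_poly ham P)). Qed.

Lemma size_clag k : size (clag alpha k) = k.+1.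
Proof. exact: size_lag. Qed.

Lemma darboux_scaleD (c : R) y z : darboux m alpha (c *: y + z) = c *: darboux m alpha y + darboux m alpha z.
Proof. by rewrite /darboux derivD derivZ -!mul_polyC; ring. Qed.

Lemma orth_darboux g : L2 g -> (forall k, << g, (fun x => (Pk k).[x]) >> = 0) ->
  forall y, << g, (fun x => (darboux m alpha y).[x]) >> = 0.
Proof.
move=> Lg H y; have [N [c ->]] := poly_basis size_clag y.
elim: N => [|N IH].
  rewrite big_ord0 ipC (_ : (fun x => _) = fun=> 0) ?ip0l//.
  by apply/funext => x; rewrite /darboux deriv0 !mulr0 oppr0 add0r horner0.
rewrite big_ord_recr/= addrC darboux_scaleD ipC.
rewrite (_ : (fun x => _) = fun x => c N * (Pk N).[x] + (darboux m alpha (\sum_(k < N) c k *: clag alpha k)).[x]).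
  rewrite (ipDl mW W0 (L2r_scale _ (L2_poly ham _)) (L2_poly ham _) Lg).
  by rewrite (ipZl mW W0 _ (L2_poly ham _) Lg) ![<< _, g >>]ipC H IH mulr0 addr0.
by apply/funext => x; rewrite hornerD hornerZ.
Qed.

Lemma poly_primitive P : exists y, y^`() = P.
Proof.
exists (\poly_(i < (size P).+1) (P`_i.-1 / i%:R)).
apply/polyP => i; rewrite coef_deriv_natr coef_poly ltnS /=.
case: ltnP => h; last by rewrite mul0r nth_default.
by rewrite divfK// pnatr_eq0.
Qed.

Section orthogonal.
Variable g : R -> R.
Hypothesis Lg : L2 g.
Hypothesis g_orth : forall k, << g, (fun x => (Pk k).[x]) >> = 0.

Let theta : {poly R} := 'X * xi^`() - (alpha + 1)%:P * xi.
Let G x := g x * ('X * xi).[x] * W x.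
Let B x := g x * theta.[x] * W x.
Let H := J B 0.

Let iB : intD B. Proof. exact: intD_poly. Qed.
Let iG : intD G. Proof. exact: intD_poly. Qed.

Let By_Gdy y : I (fun x => B x * y.[x]) = I (fun x => G x * y^`().[x]).
Proof.
have i1 : intD (fun x => B x * y.[x]).
  by apply: intD_eq (intD_poly (theta * y) Lg) => x _; rewrite /B hornerM; ring.
have i2 : intD (fun x => G x * y^`().[x]).
  by apply: intD_eq (intD_poly ('X * xi * y^`()) Lg) => x _; rewrite /G [(_ * y^`()).[x]]hornerM; ring.
apply/eqP; rewrite -subr_eq0 -I_sub//; apply/eqP.
apply: etrans (orth_darboux Lg g_orth y); apply: I_eq => x _.
by rewrite /B /G /darboux !hornerE /=; ring.
Qed.

Let IB0 : I B = 0.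
Proof.
rewrite (_ : I B = I (fun x => B x * (1 : {poly R}).[x])).
  by rewrite By_Gdy; apply: etrans (I0 (R := R)); apply: I_eq => x _; rewrite derivC horner0 mulr0.
by apply: I_eq => x _; rewrite hornerC mulr1.
Qed.

Let iBe : intD (fun x => `|B x| * expR (4^-1 * x)). Proof. exact: intD_poly_exp. Qed.

(* H x is minus the tail of the integral of B *)
Let H_bound : exists2 C, 0 < C & forall x, 0 < x -> `|H x| <= C * expR (- (4^-1 * x)).
Proof.
have C0 : 0 <= I (fun x => `|B x| * expR (4^-1 * x)).
  by apply: I_ge0 => x x0; rewrite mulr_ge0 ?expR_ge0.
exists (I (fun x => `|B x| * expR (4^-1 * x)) + 1); first lra.
move=> x x0.
have E : H x = I (fun t => (if t <= x then B t else 0) - B t).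
  by rewrite I_sub//; [rewrite IB0 subr0 /H J_indic|exact: intD_cut].
have ic : intD (fun t => (if t <= x then B t else 0) - B t).
  by apply: intD_sub => //; exact: intD_cut.
rewrite E; apply: le_trans (le_normr_integral mD ic) _.
apply: (@le_trans _ _ (I (fun t => expR (- (4^-1 * x)) * (`|B t| * expR (4^-1 * t))))).
  apply: I_le; [exact: intD_norm|exact: intD_scale|].
  move=> t t0; case: ifPn => tx.
    by rewrite subrr normr0 !mulr_ge0 ?expR_ge0.
  rewrite sub0r normrN mulrCA ler_peMr// -expRD.
  rewrite -ltNge in tx; apply: le_trans (expR_ge1Dx _); lra.
rewrite I_scale// mulrC ler_wpM2r ?expR_ge0//; lra.
Qed.

Let H_continuous : {in D, continuous H}.
Proof.
move=> x; rewrite inE => /inD x0.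
apply: (@abs_cont_continuous _ _ (x / 2) (x * 2)); first by apply/andP; split; lra.
by apply: abs_cont_J => //; lra.
Qed.

Let mH : measurable_fun D H. Proof. exact: continuousD_meas. Qed.

Let mP P : measurable_fun D (fun x => P.[x]).
Proof. by apply: continuousD_meas; exact: poly_continuous. Qed.

Let iHe P : intD (fun x => `|H x * P.[x]| * expR (8^-1 * x)).
Proof.
have [C C0 HC] := H_bound.
have h : (0 : R) < 16^-1 by lra.
have [K K0 HK] := poly_exp_bound P h.
apply: (@intD_bound R _ 0 16^-1 (C * K)) => //.
  apply: measurable_funM; last exact: mexp.
  by apply: measurableT_comp => //; exact: measurable_funM.
move=> x x0; rewrite powRr0 mul1r normrM normr_id (gtr0_norm (expR_gt0 _)) normrM.
have h1 := ler_pM (normr_ge0 _) (normr_ge0 _) (HC x x0) (HK x (ltW x0)).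
apply: le_trans (ler_wpM2r (expR_ge0 _) h1) _.
have -> : expR (- (4^-1 * x)) = expR (- (16^-1 * x)) * expR (- (16^-1 * x)) * expR (- (8^-1 * x)).
  by rewrite -!expRD; congr expR; field.
rewrite !expRN; have E1 : expR (16^-1 * x) != 0 by rewrite gt_eqF ?expR_gt0.
have E2 : expR (8^-1 * x) != 0 by rewrite gt_eqF ?expR_gt0.
move: (expR _) (expR _) E1 E2 => E F E1 E2.
by rewrite le_eqVlt; apply/orP; left; apply/eqP; field; rewrite E1.
Qed.

Let iHP P : intD (fun x => H x * P.[x]).
Proof.
apply: intD_le (iHe P); first exact: measurable_funM.
move=> x x0; rewrite ler_peMr//; apply: le_trans (expR_ge1Dx _); lra.
Qed.

Let moment y : I (fun x => (G x + H x) * y^`().[x]) = 0.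
Proof.
have i1 : intD (fun x => B x * y.[x]).
  by apply: intD_eq (intD_poly (theta * y) Lg) => x _; rewrite /B hornerM; ring.
have i2 : intD (fun x => G x * y^`().[x]).
  by apply: intD_eq (intD_poly ('X * xi * y^`()) Lg) => x _; rewrite /G [(_ * y^`()).[x]]hornerM; ring.
have ik := intD_add i1 (iHP y^`()).
have [a b a0 ab|c Fc] := @J_of_itv _ (fun x => H x * y.[x]) _ ik.
  apply: (@abs_cont_FTC_ae _ (fun x => H x * y.[x])) => //.
  - apply: abs_cont_mul => //; first by apply: abs_cont_J => //; exact: ltW.
    by apply: C1_abs_cont a0 ab _ (fun x _ => dPoly y x); exact: poly_continuous.
  - by apply: intD_itv => //; exact: cc_D.
  apply: (ae_itv b a0); apply: aeD_filter (J_derive_ae iB) => x x0 d _.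
  by rewrite (d_derive1 (dM d (dPoly y x))).
have [c0 c1] := cvgD_J ik Fc.
have z0 : H x * y.[x] @[x --> 0^'+] --> 0 * y.[0].
  by apply: cvgM; [exact: J_cvg0|exact: poly_cvg0].
have z1 : H x * y.[x] @[x --> +oo] --> (0 : R).
  have [C C0 HC] := H_bound.
  have h : (0 : R) < 8^-1 by lra.
  have [K K0 HK] := poly_exp_bound y h.
  apply/cvgrPdist_le => e e0; near=> x.
  have x0 : 0 < x by near: x; exact: nbhs_pinfty_gt.
  rewrite sub0r normrN normrM.
  have h1 := ler_pM (normr_ge0 _) (normr_ge0 _) (HC x x0) (HK x (ltW x0)).
  apply: le_trans h1 _.
  have -> : C * expR (- (4^-1 * x)) * (K * expR (8^-1 * x)) = C * K * expR (- (8^-1 * x)).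
    have -> : - (4^-1 * x) = - (8^-1 * x) + - (8^-1 * x) by field.
    rewrite expRD expRN; have E2 : expR (8^-1 * x) != 0 by rewrite gt_eqF ?expR_gt0.
    by field.
  rewrite expRN ler_pdivrMr ?expR_gt0//.
  have h2 := expR_ge1Dx (8^-1 * x).
  have h3 : C * K <= e * (8^-1 * x).
    have : C * K / (e * 8^-1) <= x by near: x; apply: nbhs_pinfty_ge; rewrite num_real.
    by rewrite ler_pdivrMr ?mulr_gt0//; lra.
  by apply: le_trans h3 _; rewrite ler_wpM2l ?(ltW e0)//; lra.
have E0 := cvg_unique (@Rhausdorff R) c0 z0.
have E1 := cvg_unique (@Rhausdorff R) c1 z1.
rewrite E0 mul0r add0r I_add// By_Gdy -I_add// in E1.
by apply: etrans (E1 _); apply: I_eq => x _; rewrite mulrDl.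
Unshelve. all: by end_near. Qed.

Let GH0 : aeD (fun x => G x + H x = 0).
Proof.
have h8 : (0 : R) < 8^-1 by lra.
apply: (@moments_zero R (fun x => G x + H x) 8^-1) => //.
- by apply: measurable_funD => //; exact: intD_meas iG.
- have i2 := iHe 1; have i1 := intD_poly_exp ('X * xi) Lg.
  apply: intD_le (intD_add i1 i2).
    apply: measurable_funM; last exact: mexp.
    by apply: measurableT_comp => //; apply: measurable_funD => //; exact: intD_meas iG.
  move=> x x0; rewrite hornerC mulr1 normrM normr_id (gtr0_norm (expR_gt0 _)).
  apply: (@le_trans _ _ ((`|G x| + `|H x|) * expR (8^-1 * x))).
    by rewrite ler_wpM2r ?expR_ge0// ler_normD.
  rewrite mulrDl lerD2r /G ler_wpM2l// ler_expR; lra.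
- by move=> p; have [y <-] := poly_primitive p; exact: moment.
Qed.

Let HODE x : 0 < x -> is_derive x 1 H (- H x * theta.[x] / (x * xi.[x])).
Proof.
pose b x := - H x * theta.[x] / (x * xi.[x]).
have cb : {in D, continuous b}.
  move=> z Dz; have z0 : 0 < z by move: Dz; rewrite inE => /inD.
  apply: cvgM.
    by apply: cvgM; [apply: cvgN; exact: H_continuous|exact: poly_continuous].
  apply: cvgV; first by apply: mulf_neq0; [rewrite gt_eqF|exact: xi_gt0_neq0].
  by apply: cvgM; [exact: cvg_id|exact: poly_continuous].
have Bb : aeD (fun x => B x = b x).
  apply: aeD_filter GH0 => z z0 /eqP; rewrite addr_eq0 => /eqP E.
  have n0 := xi_gt0_neq0 ham z0.
  rewrite /b -E /B /G hornerM hornerX; field.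
  by rewrite n0 gt_eqF.
have ib : intD b by apply: intD_ae iB => //; exact: continuousD_meas.
move=> x0; have HE t : H t = J b 0 t by exact: J_ae.
have nE : \forall z \near x, J b 0 z = H z by near=> z.
by apply: near_eq_is_derive (J_derive ib x0 _) => //; apply: cb; rewrite inE; exact/inD.
Unshelve. all: by end_near. Qed.

Let H_solution : exists K, forall x, 0 < x -> H x = K * (x `^ (alpha + 1) / xi.[x]).
Proof.
pose F x := H x * (xi.[x] * x `^ (- (alpha + 1))).
have dF x : 0 < x -> is_derive x 1 F 0.
  move=> x0; have n0 := xi_gt0_neq0 ham x0.
  apply: dEq (dM (HODE x0) (dM (dPoly xi x) (dPow (- (alpha + 1)) x0))) _.
  have -> : x `^ (- (alpha + 1)) = x * x `^ (- (alpha + 1) - 1) by rewrite -powRS// subrK.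
  rewrite /theta !hornerE /=; field.
  by rewrite n0 gt_eqF.
have Fc x : 0 < x -> F x = F 1.
  move=> x0; have main s t : 0 < s -> s < t -> F t = F s.
    move=> s0 st; have [|c _ E] := @mvt _ F (fun=> 0) s t st.
      by move=> z /andP[sz _]; apply: dF; lra.
    by apply/eqP; rewrite -subr_eq0 E mul0r.
  by have [x1|x1|->//] := ltgtP x 1; [rewrite (main x 1)|rewrite (main 1 x)].
exists (F 1) => x x0; have n0 := xi_gt0_neq0 ham x0.
rewrite -(Fc x x0) /F powRN; field.
by rewrite n0 gt_eqF// powR_gt0.
Qed.

(** With G = g W x xi and H the indefinite integral of B = g W (x xi' - (alpha + 1) xi),
    orthogonality to A y reads I (B y) = I (G y'), and integrating the left-hand side
    by parts gives I ((G + H) y') = 0 for every polynomial y. So G = - H almost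
    everywhere, which is a differential equation for H; its solutions are
    multiples of x^(alpha+1) / xi and correspond to g = - K e^x. *)
Lemma orthogonal_eq0 : aeD (fun x => g x = 0).
Proof.
have [K HK] := H_solution.
have gE : aeD (fun x => g x = - K * expR x).
  apply: aeD_filter GH0 => x x0 /eqP; rewrite addr_eq0 => /eqP E.
  have n0 := xi_gt0_neq0 ham x0; move: E; rewrite HK// /G hornerM hornerX /weightII powRS//.
  have a0 := powR_gt0 alpha x0; have e0 := expR_gt0 x.
  rewrite expRN => E.
  apply: (mulfI (_ : x * x `^ alpha / (expR x * xi.[x]) != 0)).
    by rewrite !mulf_neq0 ?invr_neq0 ?mulf_neq0// gt_eqF.
  transitivity (g x * (x * xi.[x]) * (x `^ alpha / expR x / xi.[x] ^+ 2)).
    by field; rewrite n0 gt_eqF.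
  by rewrite E; field; rewrite n0 gt_eqF.
suff K0 : K = 0 by apply: aeD_filter gE => x _ ->; rewrite K0 oppr0 mul0r.
apply/eqP; apply: contraT => Kn; exfalso.
have m1 : measurable_fun D (fun x => - K * expR x).
  apply: measurable_funM => //; apply: eq_measurable_fun (mexp 1) => x _.
  by rewrite mul1r.
have [_ i2] := L2r_ae mW m1 gE Lg.
have [c c0 Hc] := W_lowery ham.
have K2 : 0 < K ^+ 2 by rewrite exprn_even_gt0.
apply: (@intD_not_cst R _ (K ^+ 2 * c) 1 _ _ i2) => //.
- exact: mulr_gt0.
- by move=> x x0; rewrite mulr_ge0 ?sqr_ge0// ltW// W0.
move=> x x1; have h := Hc x x1.
have -> : (- K * expR x) ^+ 2 * W x = K ^+ 2 * (expR x ^+ 2 * W x) by rewrite [(- K * _) ^+ 2]exprMn sqrrN mulrA.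
rewrite ler_wpM2l ?(ltW K2)//.
have h2 := ler_wpM2l (sqr_ge0 (expR x)) h; apply: le_trans h2.
rewrite mulrCA ler_peMr ?(ltW c0)// expr2 -!expRD.
by apply: le_trans (expR_ge1Dx _); lra.
Qed.

End orthogonal.

Lemma Pk_orth j k : j != k -> << (fun x => (Pk j).[x]), (fun x => (Pk k).[x]) >> = 0.
Proof.
move=> jk; have := Qbc_Pk_sym ham k (Qbc_Pk ham j).
rewrite (ipZl mW W0 _ (L2_poly ham _) (L2_poly ham _)) => /eqP.
rewrite -subr_eq0 -mulrBl mulf_eq0 => /orP[|/eqP//].
by rewrite subr_eq0 eqr_nat (negbTE jk).
Qed.

Lemma Pk_nrm_gt0 k : 0 < << (fun x => (Pk k).[x]), (fun x => (Pk k).[x]) >>.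
Proof.
rewrite lt_neqAle nrm_ge0// andbT eq_sym; apply/eqP => /(nrm_eq0 W0 (L2_poly ham _)) H.
have [X [c [X0 c0 Hc]]] := poly_lower (Pk_neq0 ham k).
have E := @aeD_eq_continuous R _ (fun=> 0) (@poly_continuous R (Pk k)) (fun x _ => cvg_cst _) H X X0.
by have := Hc X (lexx _); rewrite E normr0 leNgt c0.
Qed.

(** The normalized exceptional polynomials. *)
Definition efun k x : R := (Num.sqrt << (fun x => (Pk k).[x]), (fun x => (Pk k).[x]) >>)^-1 * (Pk k).[x].

Lemma efun_L2 k : L2 (efun k).
Proof. by apply: L2r_scale; exact: L2_poly. Qed.

Lemma efun_orth j k : << efun j, efun k >> = (j == k)%:R.
Proof.
have Lp i := L2_poly ham (Pk i).
rewrite (ipZl mW W0 _ (Lp j) (efun_L2 k)) ipC (ipZl mW W0 _ (Lp k) (Lp j)).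
have [->|jk] := eqVneq j k; last by rewrite eq_sym in jk; rewrite (Pk_orth jk) !mulr0.
have := Pk_nrm_gt0 k; move: (<< _, _ >>) => n n0.
rewrite -[X in _ * (_ * X) = _](sqr_sqrtr (ltW n0)).
have : Num.sqrt n != 0 by rewrite gt_eqF// sqrtr_gt0.
by move: (Num.sqrt n) => r r0; rewrite /=; field.
Qed.

Lemma efun_complete f : L2 f -> (forall k, << f, efun k >> = 0) -> aeD (fun x => f x = 0).
Proof.
move=> Lf H; apply: (orthogonal_eq0 Lf) => k.
have := H k; rewrite ipC (ipZl mW W0 _ (L2_poly ham _) Lf) ipC => /eqP.
rewrite mulf_eq0 invr_eq0 => /orP[|/eqP//].
by rewrite gt_eqF// sqrtr_gt0 Pk_nrm_gt0.
Qed.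

Lemma Qbc_efun k : QbcII (efun k) (fun x => k%:R * efun k x).
Proof.
have := Qbc_lin cW W0 (@pII_gt0 _ _ _ ham) (qII_continuous ham) (qII_bound ham) (intD_WII ham)
  (Num.sqrt << (fun x => (Pk k).[x]), (fun x => (Pk k).[x]) >>)^-1 0 (Qbc_Pk ham k) (Qbc_Pk ham k).
by apply: Qbc_ext => x; rewrite /efun; ring.
Qed.

(** Membership in the graph is a condition on the coefficients alone. One
    direction is the symmetry with respect to the P_k, the other the closedness
    applied to the partial sums of the expansions of u and v. *)
Theorem Qbc_coefP u v : L2 u -> L2 v ->
  ((exists2 f, QbcII f v & aeD (fun x => u x = f x)) <->
   forall k, << v, efun k >> = k%:R * << u, efun k >>).
Proof.
move=> Lu Lv; split.
  move=> [f Qf uf] k; have [[Lf _ _ _ _] _] := Qf.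
  rewrite ipC (ipZl mW W0 _ (L2_poly ham _) Lv) ipC (Qbc_Pk_sym ham k Qf).
  rewrite (ip_ae mW W0 Lu Lf (efun_L2 k) uf) [in RHS]ipC (ipZl mW W0 _ (L2_poly ham _) Lf).
  by rewrite [in RHS]ipC; ring.
move=> H.
pose S N := psum efun (fun n => << u, efun n >>) N.
pose V N := psum efun (fun n => << v, efun n >>) N.
have QS N : QbcII (S N) (V N).
  have := Qbc_psum cW W0 (@pII_gt0 _ _ _ ham) (qII_continuous ham) (qII_bound ham) (intD_WII ham)
    (fun n => << u, efun n >>) N Qbc_efun.
  apply: Qbc_ext => // x; rewrite /V /psum; apply: eq_bigr => i _; by rewrite H.
have cE w : L2 w -> << (fun x => w x - psum efun (fun n => << w, efun n >>) n x),
     (fun x => w x - psum efun (fun n => << w, efun n >>) n x) >> @[n --> \oo] --> 0.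
  move=> Lw; apply/cvgrPdist_le => e e0.
  have [N HN] := expansion mW W0 efun_L2 efun_orth efun_complete Lw e0.
  near=> n; rewrite sub0r normrN ger0_norm ?nrm_ge0//; apply: HN.
  by near: n; exact: nbhs_infty_ge.
exact: (Qbc_closed cW W0 (@pII_gt0 _ _ _ ham) (@pII_d _ _ _ ham) (qII_continuous ham)
  (qII_bound ham) (intD_WII ham) Lu Lv QS (cE u Lu) (cE v Lv)).
Unshelve. all: by end_near. Qed.
End completeness.

(** * Complex functions as pairs of real functions *)

Section complex_L2.
Context {R : realType}.
Notation D := (`]0%R, +oo[%classic : set R).
Implicit Types (f g h u v w : R -> R[i]) (x : R) (z c : R[i]).

Lemma cplx_eq (y z : R[i]) : complex.Re y = complex.Re z -> complex.Im y = complex.Im z -> y = z.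
Proof. by case: y z => [a b] [c d] /= -> ->. Qed.

Lemma ReM (y z : R[i]) : complex.Re (y * z) =
  complex.Re y * complex.Re z - complex.Im y * complex.Im z.
Proof. by case: y z => [a b] [c d]. Qed.

Lemma ImM (y z : R[i]) : complex.Im (y * z) =
  complex.Re y * complex.Im z + complex.Im y * complex.Re z.
Proof. by case: y z => [a b] [c d]. Qed.

Lemma ReD (y z : R[i]) : complex.Re (y + z) = complex.Re y + complex.Re z.
Proof. by case: y z => [a b] [c d]. Qed.

Lemma ImD (y z : R[i]) : complex.Im (y + z) = complex.Im y + complex.Im z.
Proof. by case: y z => [a b] [c d]. Qed.

Lemma ReN (y : R[i]) : complex.Re (- y) = - complex.Re y.
Proof. by case: y => [a b]. Qed.

Lemma ImN (y : R[i]) : complex.Im (- y) = - complex.Im y.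
Proof. by case: y => [a b]. Qed.

Lemma ReJ (y : R[i]) : complex.Re (conjc y) = complex.Re y.
Proof. by case: y => [a b]. Qed.

Lemma ImJ (y : R[i]) : complex.Im (conjc y) = - complex.Im y.
Proof. by case: y => [a b]. Qed.

Definition ReImE := (ReM, ImM, ReD, ImD, ReN, ImN, ReJ, ImJ).

Lemma Re_sum n (F : 'I_n -> R[i]) : complex.Re (\sum_(i < n) F i) = \sum_(i < n) complex.Re (F i).
Proof. by apply: (big_morph _ ReD). Qed.

Lemma Im_sum n (F : 'I_n -> R[i]) : complex.Im (\sum_(i < n) F i) = \sum_(i < n) complex.Im (F i).
Proof. by apply: (big_morph _ ImD). Qed.

Lemma Re_nat n : complex.Re (n%:R : R[i]) = n%:R.
Proof. by elim: n => // n IH; rewrite -!natr1 ReD IH. Qed.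

Lemma Im_nat n : complex.Im (n%:R : R[i]) = 0.
Proof. by elim: n => // n IH; rewrite -!natr1 ImD IH addr0. Qed.

Lemma aeqP f g : aeq f g <-> aeD (fun x => Refun f x = Refun g x) /\ aeD (fun x => Imfun f x = Imfun g x).
Proof.
split=> [H|[H1 H2]].
  by split; apply: aeD_filter H => x _ ->.
by apply: aeD_filter2 H1 H2 => x _; exact: cplx_eq.
Qed.

Lemma aeq_sym f g : aeq f g -> aeq g f.
Proof. by apply: aeD_filter => x _ ->. Qed.

Lemma aeq_all f g : (forall x, 0 < x -> f x = g x) -> aeq f g.
Proof. exact: aeD_all. Qed.

Variable W : R -> R.
Hypothesis mW : measurable_fun D W.
Hypothesis W0 : forall x, 0 < x -> 0 < W x.
Notation "<< f , g >>" := (ip W f g).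

Lemma L2P f : L2 W f <-> L2r W (Refun f) /\ L2r W (Imfun f).
Proof.
have sE x : ((Refun f x) ^+ 2 + (Imfun f x) ^+ 2) * W x =
   (Refun f x) ^+ 2 * W x + (Imfun f x) ^+ 2 * W x by rewrite mulrDl.
split=> [[mr mi fin]|[[mr ir] [mi ii]]].
  have m1 : measurable_fun D (fun x => (Refun f x) ^+ 2 * W x).
    by apply: measurable_funM => //; exact: measurable_funX.
  have m2 : measurable_fun D (fun x => (Imfun f x) ^+ 2 * W x).
    by apply: measurable_funM => //; exact: measurable_funX.
  have i : intD (fun x => ((Refun f x) ^+ 2 + (Imfun f x) ^+ 2) * W x).
    apply: intD_ge0 => //.
      by apply: eq_measurable_fun (measurable_funD m1 m2) => x _; rewrite sE.
    by move=> x x0; rewrite mulr_ge0 ?addr_ge0 ?sqr_ge0// ltW// W0.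
  split; split=> //; apply: intD_le i => // x x0; have w0 := ltW (W0 x0);
    have p1 := sqr_ge0 (Refun f x); have p2 := sqr_ge0 (Imfun f x);
    rewrite normrM (ger0_norm w0) ger0_norm//; apply: ler_wpM2r => //; lra.
split => //; rewrite /normsq.
have i := intD_eq (fun x _ => esym (sE x)) (intD_add ir ii).
by rewrite (IE i) ltry.
Qed.

Lemma normsqE f : L2 W f -> normsq W f = (<< Refun f, Refun f >> + << Imfun f, Imfun f >>)%:E.
Proof.
move=> /L2P[[mr ir] [mi ii]].
have sE x : ((Refun f x) ^+ 2 + (Imfun f x) ^+ 2) * W x =
   (Refun f x) ^+ 2 * W x + (Imfun f x) ^+ 2 * W x by rewrite mulrDl.
have i := intD_eq (fun x _ => esym (sE x)) (intD_add ir ii).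
rewrite /normsq (IE i) !ipE -I_add//; congr EFin; exact: I_eq.
Qed.

Lemma L2_ReIm f : L2 W f -> L2r W (Refun f) * L2r W (Imfun f).
Proof. by move=> /L2P[]. Qed.

Lemma innerE f g : L2 W f -> L2 W g -> inner W f g =
  (<< Refun f, Refun g >> + << Imfun f, Imfun g >>) +i*
  (<< Imfun f, Refun g >> - << Refun f, Imfun g >>).
Proof.
move=> /L2_ReIm[fr fi] /L2_ReIm[gr gi]; rewrite /inner /ip.
rewrite -I_add; [|exact: (L2r_mul mW W0)..].
rewrite -I_sub; [|exact: (L2r_mul mW W0)..].
by congr (_ +i* _); apply: I_eq => x _; rewrite !ReImE; ring.
Qed.

Lemma L2_lin a b f g : L2 W f -> L2 W g -> L2 W (fun x => a * f x + b * g x).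
Proof.
move=> /L2_ReIm[fr fi] /L2_ReIm[gr gi]; apply/L2P; split.
  apply: (@L2r_ext _ _ (fun x => (complex.Re a * Refun f x + - complex.Im a * Imfun f x) +
    (complex.Re b * Refun g x + - complex.Im b * Imfun g x))).
    by move=> x _; rewrite !ReImE; ring.
  by do !(apply: (L2r_add mW W0)); apply: L2r_scale.
apply: (@L2r_ext _ _ (fun x => (complex.Re a * Imfun f x + complex.Im a * Refun f x) +
    (complex.Re b * Imfun g x + complex.Im b * Refun g x))).
  by move=> x _; rewrite !ReImE; ring.
by do !(apply: (L2r_add mW W0)); apply: L2r_scale.
Qed.

Lemma ip_lin2 (a b : R) (f g h : R -> R) : L2r W f -> L2r W g -> L2r W h ->
  << (fun x => a * f x + b * g x), h >> = a * << f, h >> + b * << g, h >>.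
Proof.
move=> Lf Lg Lh; rewrite (ipDl mW W0 (L2r_scale a Lf) (L2r_scale b Lg) Lh).
by rewrite (ipZl mW W0 a Lf Lh) (ipZl mW W0 b Lg Lh).
Qed.

Lemma inner_linl a b f g h : L2 W f -> L2 W g -> L2 W h ->
  inner W (fun x => a * f x + b * g x) h = a * inner W f h + b * inner W g h.
Proof.
move=> Lf Lg Lh; rewrite !innerE//; last exact: L2_lin.
move: Lf Lg Lh => /L2_ReIm[fr fi] /L2_ReIm[gr gi] /L2_ReIm[hr hi].
have ER k : L2r W k -> << Refun (fun x => a * f x + b * g x), k >> =
   1 * (complex.Re a * << Refun f, k >> + - complex.Im a * << Imfun f, k >>) +
   1 * (complex.Re b * << Refun g, k >> + - complex.Im b * << Imfun g, k >>).
  move=> Lk; rewrite -!ip_lin2//; first last.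
  - by apply: (L2r_add mW W0); apply: L2r_scale.
  - by apply: (L2r_add mW W0); apply: L2r_scale.
  by apply: ip_ext => // x _; rewrite !ReImE; ring.
have EI k : L2r W k -> << Imfun (fun x => a * f x + b * g x), k >> =
   1 * (complex.Re a * << Imfun f, k >> + complex.Im a * << Refun f, k >>) +
   1 * (complex.Re b * << Imfun g, k >> + complex.Im b * << Refun g, k >>).
  move=> Lk; rewrite -!ip_lin2//; first last.
  - by apply: (L2r_add mW W0); apply: L2r_scale.
  - by apply: (L2r_add mW W0); apply: L2r_scale.
  by apply: ip_ext => // x _; rewrite !ReImE; ring.
rewrite !ER// !EI//.
by apply: cplx_eq; rewrite !ReImE /=; ring.
Qed.

Lemma innerC f g : L2 W f -> L2 W g -> inner W f g = conjc (inner W g f).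
Proof.
move=> Lf Lg; rewrite !innerE//=; apply: cplx_eq => /=.
  by rewrite ![<< Refun f, _ >>]ipC ![<< Imfun f, _ >>]ipC.
by rewrite [<< Imfun f, _ >>]ipC [<< Refun f, _ >>]ipC opprB.
Qed.

Lemma inner_linr a b f g h : L2 W f -> L2 W g -> L2 W h ->
  inner W h (fun x => a * f x + b * g x) = conjc a * inner W h f + conjc b * inner W h g.
Proof.
move=> Lf Lg Lh; rewrite innerC//; last exact: L2_lin.
rewrite inner_linl// ![inner W h _]innerC//.
by apply: cplx_eq; rewrite !ReImE; ring.
Qed.

Lemma inner_aeql f g h : L2 W f -> L2 W g -> L2 W h -> aeq f g -> inner W f h = inner W g h.
Proof.
move=> Lf Lg Lh /aeqP[e1 e2]; rewrite !innerE//.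
move: Lf Lg Lh => /L2_ReIm[fr fi] /L2_ReIm[gr gi] /L2_ReIm[hr hi].
by rewrite !(ip_ae mW W0 fr gr _ e1)// !(ip_ae mW W0 fi gi _ e2).
Qed.

Lemma inner_aeqr f g h : L2 W f -> L2 W g -> L2 W h -> aeq f g -> inner W h f = inner W h g.
Proof. by move=> Lf Lg Lh fg; rewrite innerC// (inner_aeql _ _ _ fg)// -innerC. Qed.

Lemma inner_eq0 f : L2 W f -> inner W f f = 0 -> aeq f (fun=> 0).
Proof.
move=> Lf; rewrite innerE// => /(congr1 (fun z => complex.Re z)) /= /eqP.
have /L2_ReIm[fr fi] := Lf.
rewrite paddr_eq0 ?nrm_ge0// => /andP[/eqP h1 /eqP h2].
by apply/aeqP; split; [exact: (nrm_eq0 W0 fr h1)|exact: (nrm_eq0 W0 fi h2)].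
Qed.

Lemma L2_real (f : R -> R) : L2r W f -> L2 W (fun x => (f x)%:C).
Proof. by move=> Lf; apply/L2P; split => //=; exact: L2r0. Qed.

Lemma L2_aeq f g : measurable_fun D (Refun g) -> measurable_fun D (Imfun g) ->
  aeq f g -> L2 W f -> L2 W g.
Proof.
move=> m1 m2 /aeqP[e1 e2] /L2_ReIm[fr fi]; apply/L2P; split.
  exact: L2r_ae fr.
exact: L2r_ae fi.
Qed.
End complex_L2.

(** * The differential operators on complex functions *)

Section complex_operator.
Context {R : realType}.
Notation D := (`]0%R, +oo[%classic : set R).
Implicit Types (f g h u v w : R -> R[i]) (a b : R -> R) (x : R) (z c : R[i]).
Variables (m : nat) (alpha : R).
Hypothesis ham : m%:R - 1 < alpha.
Notation xi := (xiII m alpha).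
Notation W := (weightII m alpha).
Notation "<< f , g >>" := (ip W f g).
Notation pI := (pII m alpha).
Notation QmaxII := (Qmax W pI (qII m alpha)).
Notation QbcII := (Qbc W pI (qII m alpha)).
Notation ell := (ellII m alpha).
Notation ek := (efun m alpha).
Let W0 := @W_gt0 R m alpha ham.
Let cW := @W_continuous R m alpha ham.
Let p0 := @pII_gt0 R m alpha ham.
Let pd := @pII_d R m alpha ham.
Let cq := @qII_continuous R m alpha ham.
Let qb := @qII_bound R m alpha ham.
Let iW := @intD_WII R m alpha ham.
Let mW : measurable_fun D W. Proof. exact: (continuousD_meas (W_continuous ham)). Qed.

Definition cQmax f v : Prop := QmaxII (Refun f) (Refun v) /\ QmaxII (Imfun f) (Imfun v).
Definition cQbc f v : Prop := QbcII (Refun f) (Refun v) /\ QbcII (Imfun f) (Imfun v).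

Lemma Re_ellII f x : complex.Re (ell f x) = ellr m alpha (Refun f) x.
Proof. by rewrite /ellII /ellr !ReImE /= ?oppr0 !mul0r !subr0. Qed.

Lemma Im_ellII f x : complex.Im (ell f x) = ellr m alpha (Imfun f) x.
Proof. by rewrite /ellII /ellr !ReImE /= ?oppr0 !mul0r !addr0. Qed.

Lemma cQmax_L2 f v : cQmax f v -> L2 W f /\ L2 W v.
Proof. by move=> [[? ? _ _ _] [? ? _ _ _]]; split; apply/(L2P mW W0). Qed.

Lemma derivable_meas a : (forall x, 0 < x -> derivable a x 1) -> measurable_fun D a.
Proof.
move=> da; apply: continuousD_meas => x; rewrite inE => /inD x0.
exact: d_continuous (derivable_d (da x x0)).
Qed.

(** For a given representative v of l[f], the maximal domain is the graph of the
    real maximal operator on real and imaginary parts. *)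
Lemma DeltaP f v : L2 W v -> (DeltaII m alpha f /\ aeq v (ell f)) <-> cQmax f v.
Proof.
move=> Lv; have [vr vi] := L2_ReIm mW W0 Lv; split.
  move=> [[df acf acdf [g Lg gf] _] /aeqP[e1 e2]].
  have dr x : 0 < x -> derivable (Refun f) x 1 by move=> /df[].
  have di x : 0 < x -> derivable (Imfun f) x 1 by move=> /df[].
  have mr := derivable_meas dr; have mi := derivable_meas di.
  have Lf := L2_aeq mW W0 mr mi (aeq_sym gf) Lg; have [fr fi] := L2_ReIm mW W0 Lf.
  split; apply: (Qmax_ellr ham) => //.
  - by move=> s t s0 st; have [] := acdf s t s0 st.
  - by apply: aeD_filter e1 => x _ ->; rewrite Re_ellII.
  - by move=> s t s0 st; have [] := acdf s t s0 st.
  - by apply: aeD_filter e2 => x _ ->; rewrite Im_ellII.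
move=> [Qr Qi]; have [Lf _] := cQmax_L2 (conj Qr Qi).
have [acr er] := Qmax_ellr_inv ham Qr; have [aci ei] := Qmax_ellr_inv ham Qi.
have vf : aeq v (ell f).
  apply/aeqP; split; [apply: aeD_filter er|apply: aeD_filter ei] => x _ ->.
    by rewrite Re_ellII.
  by rewrite Im_ellII.
split => //; have [_ _ dr _ _] := Qr; have [_ _ di _ _] := Qi; split.
- by move=> x x0; split; [exact: dr|exact: di].
- by move=> s t s0 st; split; [have [] := acr s t s0 st|have [] := aci s t s0 st].
- by move=> s t s0 st; split; [have [] := acr s t s0 st|have [] := aci s t s0 st].
- by exists f => //; exact: aeq_all.
- by exists v; [exact: Lv|exact: aeq_sym vf].
Qed.

Lemma Delta_cQmax f : DeltaII m alpha f -> exists2 v, aeq v (ell f) & cQmax f v.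
Proof. by move=> Df; have [_ _ _ _ [v Lv /aeq_sym vf]] := Df; exists v => //; apply/(DeltaP _ Lv). Qed.

Definition rII x : R := expR (- x) / xi.[x] ^+ 2.

Lemma rII_cvg : rII x @[x --> 0^'+] --> rII 0.
Proof.
have h : rII x @[x --> (0 : R)] --> rII 0.
  apply: cvgM; first exact: d_continuous (dExp (dN (dId (0 : R)))).
  apply: cvgV; first by rewrite expf_neq0// (xi_neq0 ham).
  under eq_fun do rewrite expr2.
  by rewrite expr2; apply: cvgM; exact: d_continuous (dPoly _ _).
exact: cvg_at_right_filter h.
Qed.

Lemma rII_neq0 x : 0 <= x -> rII x != 0.
Proof.
move=> x0; apply: mulf_neq0; first by rewrite gt_eqF// expR_gt0.
by rewrite invr_neq0// expf_neq0// (xi_neq0 ham).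
Qed.

(** The factor e^(- x) / xi^2 between p and x^(alpha+1) has a nonzero limit at 0. *)
Lemma bc_qd a : (x `^ (alpha + 1) * derive1 a x @[x --> 0^'+] --> 0) <->
  (qd pI a x @[x --> 0^'+] --> 0).
Proof.
split=> h.
  have h2 : rII x * (x `^ (alpha + 1) * derive1 a x) @[x --> 0^'+] --> rII 0 * 0.
    by apply: cvgM => //; exact: rII_cvg.
  rewrite mulr0 in h2; apply: cvg_trans h2; apply: near_eq_cvg; apply: nearW => x.
  by rewrite /qd /pII /rII; ring.
have h2 : (rII x)^-1 * qd pI a x @[x --> 0^'+] --> (rII 0)^-1 * 0.
  apply: cvgM => //; apply: cvgV; last exact: rII_cvg.
  exact: rII_neq0.
rewrite mulr0 in h2; apply: cvg_trans h2; apply: near_eq_cvg; near=> x.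
have x0 : 0 < x by near: x; exact: nbhs_right_gt.
have -> : qd pI a x = rII x * (x `^ (alpha + 1) * derive1 a x) by rewrite /qd /pII /rII; ring.
by rewrite mulKf// rII_neq0// ltW.
Unshelve. all: by end_near. Qed.

Lemma dom_bcP f v : L2 W v -> (dom_bcII m alpha f /\ aeq v (ell f)) <-> cQbc f v.
Proof.
move=> Lv.
have E1 : (fun x => complex.Re ((x `^ (alpha + 1))%:C * cderive f x)) =
   (fun x => x `^ (alpha + 1) * derive1 (Refun f) x).
  by apply/funext => x; rewrite ReM /= mul0r subr0.
have E2 : (fun x => complex.Im ((x `^ (alpha + 1))%:C * cderive f x)) =
   (fun x => x `^ (alpha + 1) * derive1 (Imfun f) x).
  by apply/funext => x; rewrite ImM /= mul0r addr0.
rewrite /dom_bcII /ccvg /= E1 E2; split.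
  move=> [[Df [/bc_qd c1 /bc_qd c2]] vf].
  by have [Qr Qi] := (DeltaP f Lv).1 (conj Df vf).
move=> [[Qr /bc_qd c1] [Qi /bc_qd c2]].
by have [Df vf] := (DeltaP f Lv).2 (conj Qr Qi).
Qed.

Lemma cQbc_cQmax f v : cQbc f v -> cQmax f v.
Proof. by move=> [[? _] [? _]]. Qed.

Lemma Qmax_ext (a b a' b' : R -> R) : (forall x, a x = a' x) -> (forall x, b x = b' x) ->
  QmaxII a b -> QmaxII a' b'.
Proof. by move=> /funext -> /funext ->. Qed.

Lemma cQmax_lin (k l : R[i]) f v g w : cQmax f v -> cQmax g w ->
  cQmax (fun x => k * f x + l * g x) (fun x => k * v x + l * w x).
Proof.
move=> [fr fi] [gr gi].
have lin (s t : R) (a b a' b' : R -> R) : QmaxII a b -> QmaxII a' b' ->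
    QmaxII (fun x => s * a x + t * a' x) (fun x => s * b x + t * b' x).
  exact: (Qmax_lin cW W0 p0 cq qb iW).
split.
  have h := lin 1 1 _ _ _ _ (lin (complex.Re k) (- complex.Im k) _ _ _ _ fr fi)
    (lin (complex.Re l) (- complex.Im l) _ _ _ _ gr gi).
  by apply: Qmax_ext h => x /=; rewrite !ReImE; ring.
have h := lin 1 1 _ _ _ _ (lin (complex.Re k) (complex.Im k) _ _ _ _ fi fr)
    (lin (complex.Re l) (complex.Im l) _ _ _ _ gi gr).
by apply: Qmax_ext h => x /=; rewrite !ReImE; ring.
Qed.

(** Green's formula for the sesquilinear boundary form: the limits exist and their
    difference is the defect of symmetry. *)
Lemma cgreen f v g w : cQmax f v -> cQmax g w -> exists l1 l0,
  [/\ ccvg +oo (formII m alpha f g) l1, ccvg 0^'+ (formII m alpha f g) l0 &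
      l1 - l0 = inner W v g - inner W f w].
Proof.
move=> Qf Qg; have [Lf Lv] := cQmax_L2 Qf; have [Lg Lw] := cQmax_L2 Qg.
have [fr fi] := Qf; have [gr gi] := Qg.
have [l0 [l1 [c0 c1 E]]] := green_cvg cW W0 p0 pd fr gr.
have [k0 [k1 [d0 d1 F]]] := green_cvg cW W0 p0 pd fi gi.
have [l0' [l1' [c0' c1' E']]] := green_cvg cW W0 p0 pd fi gr.
have [k0' [k1' [d0' d1' F']]] := green_cvg cW W0 p0 pd fr gi.
have [_ _ dg _ _] := gi.
have RE x : 0 < x -> complex.Re (formII m alpha f g x) =
    wronsk pI (Refun f) (Refun g) x + wronsk pI (Imfun f) (Imfun g) x /\
    complex.Im (formII m alpha f g x) =
    wronsk pI (Imfun f) (Refun g) x - wronsk pI (Refun f) (Imfun g) x.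
  move=> x0; rewrite /formII /cderive !ReImE /=.
  have -> : (fun t => complex.Re (conjc (g t))) = Refun g by apply/funext => t; rewrite ReJ.
  have -> : (fun t => complex.Im (conjc (g t))) = (fun t => - complex.Im (g t)).
    by apply/funext => t; rewrite ImJ.
  rewrite (d_derive1 (dN (derivable_d (dg x x0)))) /wronsk /qd -/(pI x).
  by split; ring.
exists ((l1 + k1) +i* (l1' - k1')), ((l0 + k0) +i* (l0' - k0')); split.
- split => /=.
    apply: (@cvg_trans _ (wronsk pI (Refun f) (Refun g) x + wronsk pI (Imfun f) (Imfun g) x @[x --> +oo])).
      apply: near_eq_cvg; near=> x; have x0 : 0 < x by near: x; exact: nbhs_pinfty_gt.
      by have [-> _] := RE x x0.
    exact: cvgD.
  apply: (@cvg_trans _ (wronsk pI (Imfun f) (Refun g) x - wronsk pI (Refun f) (Imfun g) x @[x --> +oo])).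
    apply: near_eq_cvg; near=> x; have x0 : 0 < x by near: x; exact: nbhs_pinfty_gt.
    by have [_ ->] := RE x x0.
  exact: cvgB.
- split => /=.
    apply: (@cvg_trans _ (wronsk pI (Refun f) (Refun g) x + wronsk pI (Imfun f) (Imfun g) x @[x --> 0^'+])).
      apply: near_eq_cvg; near=> x; have x0 : 0 < x by near: x; exact: nbhs_right_gt.
      by have [-> _] := RE x x0.
    exact: cvgD.
  apply: (@cvg_trans _ (wronsk pI (Imfun f) (Refun g) x - wronsk pI (Refun f) (Imfun g) x @[x --> 0^'+])).
    apply: near_eq_cvg; near=> x; have x0 : 0 < x by near: x; exact: nbhs_right_gt.
    by have [_ ->] := RE x x0.
  exact: cvgB.
rewrite !(innerE mW W0)//; apply: cplx_eq; rewrite !ReImE /=; lra.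
Unshelve. all: by end_near. Qed.

Lemma ccvg_unique (F : set_system R) {FF : ProperFilter F} (f : R -> R[i]) l l' :
  ccvg F f l -> ccvg F f l' -> l = l'.
Proof.
move=> [a b] [a' b']; apply: cplx_eq.
  exact: (cvg_unique (@Rhausdorff R) a a').
exact: (cvg_unique (@Rhausdorff R) b b').
Qed.

(** By Green's formula the minimal domain is the part of the maximal one on which
    the maximal operator is symmetric with respect to all of it. *)
Lemma dom_minP f v : DeltaII m alpha f -> cQmax f v ->
  (dom_minII m alpha f <-> forall g w, cQmax g w -> inner W v g = inner W f w).
Proof.
move=> Df Qf; split.
  move=> [_ H] g w Qg; have [_ Lw] := cQmax_L2 Qg.
  have [Dg _] := (DeltaP g Lw).2 Qg.
  have [l1 [l0 [c1 c0 E]]] := H g Dg.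
  have [k1 [k0 [d1 d0 F]]] := cgreen Qf Qg.
  move: E; rewrite (ccvg_unique c1 d1) (ccvg_unique c0 d0) F => /eqP.
  by rewrite subr_eq0 => /eqP.
move=> H; split => // g Dg; have [w wg Qg] := Delta_cQmax Dg.
have [k1 [k0 [d1 d0 F]]] := cgreen Qf Qg.
by exists k1, k0; split => //; rewrite F (H g w Qg) subrr.
Qed.

(** The Fourier coefficients with respect to the exceptional polynomials. *)
Definition ck u k : R[i] := << Refun u, ek k >> +i* << Imfun u, ek k >>.

Definition diag u v : Prop := forall k, ck v k = k%:R * ck u k.

Lemma diagP u v : diag u v <-> (forall k, << Refun v, ek k >> = k%:R * << Refun u, ek k >>) /\
  (forall k, << Imfun v, ek k >> = k%:R * << Imfun u, ek k >>).
Proof.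
split=> [H|[H1 H2] k].
  split=> k; [have := congr1 (fun z => complex.Re z) (H k)|have := congr1 (fun z => complex.Im z) (H k)];
  by rewrite /ck !ReImE Re_nat Im_nat /= => ->; ring.
by apply: cplx_eq; rewrite /ck !ReImE Re_nat Im_nat /= ?H1 ?H2; ring.
Qed.

Notation Tbc := (op W (dom_bcII m alpha) ell).

(** The operator with the boundary condition is multiplication by k in the
    coordinates given by the exceptional polynomials. *)
Lemma Tbc_diag u v : Tbc u v <-> [/\ L2 W u, L2 W v & diag u v].
Proof.
split.
  move=> [Lu Lv [f [Df uf vf]]]; split => //.
  have [Qr Qi] := (dom_bcP f Lv).1 (conj Df vf).
  have [ur ui] := L2_ReIm mW W0 Lu; have [vr vi] := L2_ReIm mW W0 Lv.
  have [e1 e2] := (aeqP _ _).1 uf.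
  apply/diagP; split; apply/(Qbc_coefP ham) => //.
    by exists (Refun f).
  by exists (Imfun f).
move=> [Lu Lv /diagP[H1 H2]]; split => //.
have [ur ui] := L2_ReIm mW W0 Lu; have [vr vi] := L2_ReIm mW W0 Lv.
have [f1 Q1 e1] := (Qbc_coefP ham ur vr).2 H1.
have [f2 Q2 e2] := (Qbc_coefP ham ui vi).2 H2.
pose f x := f1 x +i* f2 x.
have [Df vf] := (dom_bcP f Lv).2 (conj Q1 Q2).
by exists f; split => //; apply/aeqP.
Qed.
End complex_operator.

(** * Self-adjointness and spectrum *)

Section spectral.
Context {R : realType}.
Notation D := (`]0%R, +oo[%classic : set R).
Implicit Types (f g h u v w : R -> R[i]) (a b : R -> R) (x : R) (z c : R[i]).
Variables (m : nat) (alpha : R).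
Hypothesis ham : m%:R - 1 < alpha.
Notation W := (weightII m alpha).
Notation "<< f , g >>" := (ip W f g).
Notation ell := (ellII m alpha).
Notation ek := (efun m alpha).
Let W0 := @W_gt0 R m alpha ham.
Let mW : measurable_fun D W. Proof. exact: (continuousD_meas (W_continuous ham)). Qed.
Let eL := @efun_L2 R m alpha ham.
Let eO := @efun_orth R m alpha ham.
Let eC := @efun_complete R m alpha ham.


Notation diag := (diag m alpha).
Notation ck := (ck m alpha).
Notation Tbc := (op W (dom_bcII m alpha) ell).

Lemma ck_inner u k : L2 W u -> ck u k = inner W u (fun x => (ek k x)%:C).
Proof.
move=> Lu; have Le := L2_real mW W0 (eL k).
rewrite (innerE mW W0)//= /ck.
have z a : << a, (fun=> 0) >> = 0 by rewrite ipC ip0l.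
by rewrite !z addr0 subr0.
Qed.

Lemma ck_lin (k l : R[i]) u v n : L2 W u -> L2 W v ->
  ck (fun x => k * u x + l * v x) n = k * ck u n + l * ck v n.
Proof.
move=> Lu Lv; have Le := L2_real mW W0 (eL n).
by rewrite !ck_inner//; [rewrite (inner_linl mW W0)|exact: (L2_lin mW W0)].
Qed.

Lemma ck_inj u : L2 W u -> (forall k, ck u k = 0) -> aeq u (fun=> 0).
Proof.
move=> Lu H; have [ur ui] := L2_ReIm mW W0 Lu; apply/aeqP; split.
  by apply: (eC ur) => k; exact: (congr1 (fun z => complex.Re z) (H k)).
by apply: (eC ui) => k; exact: (congr1 (fun z => complex.Im z) (H k)).
Qed.

Lemma ck_aeq u v k : L2 W u -> L2 W v -> aeq u v -> ck u k = ck v k.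
Proof.
move=> Lu Lv uv; rewrite !ck_inner//; apply: (inner_aeql mW W0) => //.
exact: (L2_real mW W0 (eL k)).
Qed.

Lemma ip_diag a b a' b' : L2r W a -> L2r W b -> L2r W a' -> L2r W b' ->
  (forall k, << b, ek k >> = k%:R * << a, ek k >>) ->
  (forall k, << b', ek k >> = k%:R * << a', ek k >>) -> << b, a' >> = << a, b' >>.
Proof.
move=> La Lb La' Lb' H H'.
have c1 := parseval mW W0 eL eO eC Lb La'.
have c2 := parseval mW W0 eL eO eC La Lb'.
have E : (fun N => \sum_(n < N) << b, ek n >> * << a', ek n >>) =
         (fun N => \sum_(n < N) << a, ek n >> * << b', ek n >>).
  by apply/funext => N; apply: eq_bigr => n _; rewrite H H'; ring.
rewrite E in c1; exact: (cvg_unique (@Rhausdorff R) c1 c2).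
Qed.

Lemma diag_sym u v u' v' : L2 W u -> L2 W v -> L2 W u' -> L2 W v' ->
  diag u v -> diag u' v' -> inner W v u' = inner W u v'.
Proof.
move=> Lu Lv Lu' Lv' /diagP[h1 h2] /diagP[k1 k2].
rewrite !(innerE mW W0)//.
move: Lu Lv Lu' Lv' => /(L2_ReIm mW W0)[ur ui] /(L2_ReIm mW W0)[vr vi]
  /(L2_ReIm mW W0)[ur' ui'] /(L2_ReIm mW W0)[vr' vi'].
rewrite (ip_diag ur vr ur' vr' h1 k1) (ip_diag ui vi ui' vi' h2 k2).
by rewrite (ip_diag ui vi ur' vr' h2 k1) (ip_diag ur vr ui' vi' h1 k2).
Qed.

Definition cpsum u N x : R[i] :=
  psum ek (fun k => << Refun u, ek k >>) N x +i* psum ek (fun k => << Imfun u, ek k >>) N x.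

Lemma cpsum_approx u e : L2 W u -> 0 < e ->
  exists N, (normsq W (fun x => u x - cpsum u N x)%R < e%:E)%E.
Proof.
move=> Lu e0; have [ur ui] := L2_ReIm mW W0 Lu.
have e3e : e / 3 + e / 3 < e by lra.
have e30 : 0 < e / 3 by rewrite divr_gt0.
have [N1 H1] := expansion mW W0 eL eO eC ur e30.
have [N2 H2] := expansion mW W0 eL eO eC ui e30.
exists (maxn N1 N2).
have {}H1 := H1 (maxn N1 N2) (leq_maxl _ _); have {}H2 := H2 (maxn N1 N2) (leq_maxr _ _).
have ER : Refun (fun x => u x - cpsum u (maxn N1 N2) x) = (fun x => Refun u x -
     psum ek (fun k => << Refun u, ek k >>) (maxn N1 N2) x).
  by apply/funext => x; rewrite !ReImE.
have EI : Imfun (fun x => u x - cpsum u (maxn N1 N2) x) = (fun x => Imfun u x -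
     psum ek (fun k => << Imfun u, ek k >>) (maxn N1 N2) x).
  by apply/funext => x; rewrite !ReImE.
rewrite (normsqE mW W0).
  rewrite ER EI lte_fin; apply: le_lt_trans (lerD H1 H2) e3e.
apply/(L2P mW W0); rewrite ER EI; split; apply: (L2r_sub mW W0) => //;
  exact: (psum_L2 mW W0 eL).
Qed.

Lemma cpsum_dom u N : op_dom Tbc (cpsum u N).
Proof.
have Lp (s : nat -> R) : L2r W (psum ek s N) by exact: (psum_L2 mW W0 eL).
exists (fun x => psum ek (fun k => k%:R * << Refun u, ek k >>) N x +i*
   psum ek (fun k => k%:R * << Imfun u, ek k >>) N x).
apply/(Tbc_diag ham); split; [by apply/(L2P mW W0); split; exact: Lp|by apply/(L2P mW W0); split; exact: Lp|].
apply/diagP; split=> k /=; rewrite !(ip_psum_e mW W0 eL eO); by case: ifP => // _; rewrite mulr0.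
Qed.

Lemma Tbc_dense : dense_L2 W (op_dom Tbc).
Proof.
move=> f Lf e e0; have [N HN] := cpsum_approx Lf e0.
by exists (cpsum f N) => //; exact: cpsum_dom.
Qed.

(** Testing the adjoint against the eigenfunctions shows that it acts diagonally as
    well, hence is not larger. *)
Lemma Tbc_self_adjoint : self_adjoint W Tbc.
Proof.
split; first exact: Tbc_dense.
move=> g h; split.
  move=> [Lg Lh H]; apply/(Tbc_diag ham); split => // k.
  have Le := L2_real mW W0 (eL k).
  have z : L2r W (fun=> 0) by exact: L2r0.
  have Lke : L2 W (fun x => (k%:R * ek k x)%:C).
    by apply: (L2_real mW W0); apply: L2r_scale.
  have Tk : Tbc (fun x => (ek k x)%:C) (fun x => (k%:R * ek k x)%:C).
    apply/(Tbc_diag ham); split => //; apply/diagP; split => j /=; last by rewrite ip0l mulr0.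
    rewrite (ipZl mW W0 _ (eL k) (eL j)) eO.
    by have [->//|_] := eqVneq k j; rewrite !mulr0.
  have := H _ _ Tk.
  rewrite (innerC mW W0 Lke Lg) (innerC mW W0 Le Lh) => /(congr1 conjc).
  rewrite !conjcK -ck_inner// => <-.
  have -> : (fun x => (k%:R * ek k x)%:C) = (fun x => k%:R * (ek k x)%:C + 0 * (ek k x)%:C).
    by apply/funext => x; apply: cplx_eq; rewrite !ReImE Re_nat Im_nat /=; ring.
  have c0 : conjc (0 : R[i]) = 0 by apply: cplx_eq; rewrite !ReImE//= oppr0.
  rewrite (inner_linr mW W0)// c0 mul0r addr0 -ck_inner//; congr (_ * _).
  by apply: cplx_eq; rewrite !ReImE ?Im_nat ?oppr0.
move=> /(Tbc_diag ham)[Lg Lh dgh]; split => // u v /(Tbc_diag ham)[Lu Lv duv].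
exact: diag_sym.
Qed.

Lemma Tbc_complete :
  complete_system W (fun k x => ((laguerreII m alpha (m + k)).[x])%:C).
Proof.
move=> f Lf e e0; have [N HN] := cpsum_approx Lf e0.
exists (cpsum f N) => //=; exists N.
pose nr k : R := (Num.sqrt << (fun x => (darboux m alpha (clag alpha k)).[x]), (fun x => (darboux m alpha (clag alpha k)).[x]) >>)^-1.
exists (fun k => ck f k * (nr k)%:C); apply/funext => x.
rewrite /lincomb; apply: cplx_eq; rewrite ?Re_sum ?Im_sum /=; apply: eq_bigr => k _;
  by rewrite laguerreII_darboux /= /efun -/(nr k); ring.
Qed.

Definition sqm (z : R[i]) : R := complex.Re z ^+ 2 + complex.Im z ^+ 2.

Lemma sqmM (y z : R[i]) : sqm (y * z) = sqm y * sqm z.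
Proof. by rewrite /sqm !ReImE; ring. Qed.

Lemma sqm_gt0 (z : R[i]) : z != 0 -> 0 < sqm z.
Proof.
move=> z0; rewrite lt_neqAle addr_ge0 ?sqr_ge0// andbT eq_sym; apply: contra z0.
rewrite paddr_eq0 ?sqr_ge0// !sqrf_eq0 => /andP[/eqP h1 /eqP h2].
by apply/eqP; exact: cplx_eq.
Qed.

(** The distance is at least 1 from the k beyond the modulus of the real part of lam
    plus 1, and only finitely many k remain. *)
Lemma nat_distance (lam : R[i]) : (forall n : nat, lam <> n%:R) ->
  exists2 d : R, 0 < d & forall k : nat, d <= sqm (k%:R - lam).
Proof.
move=> H.
have fin n : exists2 d : R, 0 < d & forall k, (k < n)%N -> d <= sqm (k%:R - lam).
  elim: n => [|n [d d0 Hd]]; first by exists 1.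
  have n0 : 0 < sqm (n%:R - lam).
    by apply: sqm_gt0; rewrite subr_eq0; apply/eqP => E; exact: (H n).
  exists (Num.min d (sqm (n%:R - lam))); first by rewrite lt_min d0.
  move=> k; rewrite ltnS leq_eqVlt => /predU1P[->|kn]; first by rewrite ge_min lexx orbT.
  by rewrite ge_min Hd.
have a0 : 0 <= `|complex.Re lam| + 1 by rewrite addr_ge0.
have [d d0 Hd] := fin (Num.bound (`|complex.Re lam| + 1)).
exists (Num.min d 1); first by rewrite lt_min d0 ltr01.
move=> k; rewrite ge_min; have [kn|kn] := ltnP k (Num.bound (`|complex.Re lam| + 1)).
  by rewrite Hd.
apply/orP; right; rewrite /sqm !ReImE Re_nat.
have h1 : `|complex.Re lam| + 1 < k%:R.
  by apply: lt_le_trans (archi_boundP a0) _; rewrite ler_nat.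
have h2 := ler_norm (complex.Re lam).
have h3 : 1 <= (k%:R - complex.Re lam) ^+ 2.
  by rewrite expr_ge1//; lra.
by rewrite (le_trans h3)// lerDl sqr_ge0.
Qed.

Lemma ip_cvg_sqr a : L2r W a -> \sum_(n < N) << a, ek n >> ^+ 2 @[N --> \oo] --> << a, a >>.
Proof. by move=> La; exact: (parseval mW W0 eL eO eC La La). Qed.

Lemma sum_sqm u : L2 W u -> \sum_(n < N) sqm (ck u n) @[N --> \oo] -->
  << Refun u, Refun u >> + << Imfun u, Imfun u >>.
Proof.
move=> /(L2_ReIm mW W0)[ur ui].
under eq_fun do rewrite big_split/=.
by apply: cvgD; exact: ip_cvg_sqr.
Qed.

(** The coefficients c_k = h_k / (k - lam) are square summable; taking v = h + lam u
    spares a second summation. *)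
Lemma resolvent_solve (lam : R[i]) h : (forall n : nat, lam <> n%:R) -> L2 W h ->
  exists2 u, L2 W u & Tbc u (fun x => 1 * h x + lam * u x).
Proof.
move=> Hl Lh; have [d d0 Hd] := nat_distance Hl; have [hr hi] := L2_ReIm mW W0 Lh.
pose c k := ck h k / (k%:R - lam).
have cE k : c k * (k%:R - lam) = ck h k.
  by rewrite /c divfK// subr_eq0; apply/eqP => E; exact: (Hl k).
have cb k : sqm (c k) <= d^-1 * sqm (ck h k).
  rewrite -cE sqmM ler_pdivlMl// mulrC ler_wpM2l ?Hd//.
  by rewrite addr_ge0 ?sqr_ge0.
pose M := d^-1 * (<< Refun h, Refun h >> + << Imfun h, Imfun h >>).
have sb N : \sum_(k < N) sqm (c k) <= M.
  apply: (@le_trans _ _ (d^-1 * \sum_(k < N) sqm (ck h k))).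
    by rewrite big_distrr/=; apply: ler_sum => k _; exact: cb.
  rewrite ler_wpM2l ?invr_ge0 ?(ltW d0)// big_split/=.
  by apply: lerD; apply: (bessel mW W0 eL eO).
have [|f1 L1 H1] := @riesz_fischer R W mW W0 ek eL eO (fun k => complex.Re (c k)) M.
  move=> N; apply: le_trans (sb N); apply: ler_sum => k _; by rewrite lerDl sqr_ge0.
have [|f2 L2' H2] := @riesz_fischer R W mW W0 ek eL eO (fun k => complex.Im (c k)) M.
  move=> N; apply: le_trans (sb N); apply: ler_sum => k _; by rewrite lerDr sqr_ge0.
pose u x := f1 x +i* f2 x.
have Lu : L2 W u by apply/(L2P mW W0); split.
have cu k : ck u k = c k.
  apply: cplx_eq => /=.
    exact: (riesz_fischer_coef mW W0 eL eO L1 H1).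
  exact: (riesz_fischer_coef mW W0 eL eO L2' H2).
exists u => //; apply/(Tbc_diag ham); split => //; first exact: (L2_lin mW W0).
by move=> k; rewrite ck_lin// -cE cu; ring.
Qed.

(** Parseval, term by term. *)
Lemma resolvent_bound (lam : R[i]) d u v : 0 < d ->
  (forall k : nat, d <= sqm (k%:R - lam)) -> Tbc u v ->
  (normsq W u <= (d^-1)%:E * normsq W (fun x => v x - lam * u x)%R)%E.
Proof.
move=> d0 Hd /(Tbc_diag ham)[Lu Lv duv].
have -> : (fun x => v x - lam * u x) = (fun x => 1 * v x + (- lam) * u x).
  by apply/funext => x; ring.
have Lw := L2_lin mW W0 1 (- lam) Lv Lu.
rewrite !(normsqE mW W0)// -EFinM lee_fin.
have c1 := sum_sqm Lu; have c2 := sum_sqm Lw.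
set A := (X in _ --> X) in c1; set B := (X in _ --> X) in c2.
have c3 : d^-1 * \sum_(n < N) sqm (ck (fun x => 1 * v x + - lam * u x) n) @[N --> \oo] --> d^-1 * B.
  exact: cvgMr.
apply: (@ler_cvg_to _ _ _ _ _ _ _ _ c1 c3).
apply: nearW => N; rewrite big_distrr/=; apply: ler_sum => k _.
rewrite ck_lin// duv.
have -> : 1 * (k%:R * ck u k) + - lam * ck u k = ck u k * (k%:R - lam) by ring.
rewrite ler_pdivlMl// mulrC sqmM ler_wpM2l ?Hd//.
by rewrite addr_ge0 ?sqr_ge0.
Qed.

Notation Pn k := (fun x => ((laguerreII m alpha (m + k)).[x])%:C).

Lemma eigenfunction_Pn k : op_eigenfunction Tbc k%:R (Pn k).
Proof.
have LP := L2_poly ham (darboux m alpha (clag alpha k)).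
have EP : Pn k = (fun x => ((darboux m alpha (clag alpha k)).[x])%:C).
  by apply/funext => x; rewrite laguerreII_darboux.
rewrite EP; split.
  exists (fun x => (k%:R * (darboux m alpha (clag alpha k)).[x])%:C).
    apply/(Tbc_diag ham); split.
    - exact: (L2_real mW W0 LP).
    - by apply: (L2_real mW W0); exact: L2r_scale.
    apply/diagP; split=> j /=; last by rewrite ip0l mulr0.
    apply: (Qbc_coefP ham LP (L2r_scale k%:R LP)).1.
    by exists (fun x => (darboux m alpha (clag alpha k)).[x]); [exact: (Qbc_Pk ham)|exact: aeD_all].
  apply: aeq_all => x _; apply: cplx_eq; rewrite !ReImE ?Re_nat ?Im_nat /=; ring.
move=> /aeqP[e1 _]; have := Pk_nrm_gt0 ham k.
by rewrite (ip_ae mW W0 LP (L2r0 W) LP e1) ip0l ltxx.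
Qed.

(** At lam = n the eigenfunction contradicts the norm estimate. *)
Lemma Tbc_spectrum : spectrum W Tbc = [set lam | exists n : nat, lam = n%:R].
Proof.
apply/seteqP; split=> lam /=.
  move=> S; apply: contrapT => H; apply: S.
  have Hl (n : nat) : lam <> n%:R by move=> E; apply: H; exists n.
  have [d d0 Hd] := nat_distance Hl; split.
    move=> h Lh; have [u Lu Tu] := resolvent_solve Hl Lh.
    exists u, (fun x => 1 * h x + lam * u x); split => //.
    by apply: aeq_all => x _; ring.
  by exists d^-1; [rewrite invr_ge0 ltW|move=> u v; exact: resolvent_bound].
move=> [n ->] [_ [M M0 HM]].
have [[v Tv ve] nz] := eigenfunction_Pn n; apply: nz.
have /(Tbc_diag ham)[Lu Lv _] := Tv.
have := HM _ _ Tv.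
have -> : normsq W (fun x => v x - n%:R * (Pn n) x) = 0%E.
  have -> : (fun x => v x - n%:R * (Pn n) x) = (fun x => 1 * v x + - n%:R * (Pn n) x).
    by apply/funext => x; rewrite mul1r mulNr.
  have Lw := L2_lin mW W0 1 (- n%:R) Lv Lu.
  rewrite (normsqE mW W0)//.
  have /aeqP[e1 e2] : aeq (fun x => 1 * v x + - n%:R * (Pn n) x) (fun=> 0).
    by apply: aeD_filter ve => x _ ->; ring.
  have [wr wi] := L2_ReIm mW W0 Lw.
  rewrite (ip_ae mW W0 wr (L2r0 W) wr e1) (ip_ae mW W0 wi (L2r0 W) wi e2).
  by rewrite !ip0l addr0.
rewrite mule0 (normsqE mW W0)// lee_fin => h.
have [ur ui] := L2_ReIm mW W0 Lu.
have h1 := nrm_ge0 W0 (Refun (Pn n)); have h2 := nrm_ge0 W0 (Imfun (Pn n)).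
apply/aeqP; split; [apply: (nrm_eq0 W0 ur)|apply: (nrm_eq0 W0 ui)]; apply/eqP; rewrite eq_le;
  [rewrite h1 andbT|rewrite h2 andbT]; apply: le_trans h; [rewrite lerDl|rewrite lerDr]; by [].
Qed.
End spectral.

(** * Deficiency indices *)

Section deficiency.
Context {R : realType}.
Notation D := (`]0%R, +oo[%classic : set R).
Implicit Types (f g h u v w : R -> R[i]) (a b : R -> R) (x : R) (z c : R[i]).
Variables (m : nat) (alpha : R).
Hypothesis ham : m%:R - 1 < alpha.
Notation W := (weightII m alpha).
Notation "<< f , g >>" := (ip W f g).
Notation pI := (pII m alpha).
Notation QmaxII := (Qmax W pI (qII m alpha)).
Let W0 := @W_gt0 R m alpha ham.
Let cW := @W_continuous R m alpha ham.
Let p0 := @pII_gt0 R m alpha ham.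
Let cq := @qII_continuous R m alpha ham.
Let qb := @qII_bound R m alpha ham.
Let iW := @intD_WII R m alpha ham.
Let mW : measurable_fun D W. Proof. exact: (continuousD_meas (W_continuous ham)). Qed.


Notation T0 := (T0II m alpha).
Notation cQmax := (cQmax m alpha).
Notation cQbc := (cQbc m alpha).

Let linl := fun k l f g h => @inner_linl R W mW W0 k l f g h.
Let linr := fun k l f g h => @inner_linr R W mW W0 k l f g h.

Lemma cQbc_sym f v g w : cQbc f v -> cQbc g w -> inner W v g = inner W f w.
Proof.
move=> [f1 f2] [g1 g2].
have [Lf Lv] := cQmax_L2 ham (cQbc_cQmax (conj f1 f2)).
have [Lg Lw] := cQmax_L2 ham (cQbc_cQmax (conj g1 g2)).
have [fr fi] := L2_ReIm mW W0 Lf; have [vr vi] := L2_ReIm mW W0 Lv.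
have [gr gi] := L2_ReIm mW W0 Lg; have [wr wi] := L2_ReIm mW W0 Lw.
apply: (diag_sym ham) => //; apply/diagP; split; apply/(Qbc_coefP ham) => //.
- by exists (Refun f) => //; exact: aeD_all.
- by exists (Imfun f) => //; exact: aeD_all.
- by exists (Refun g) => //; exact: aeD_all.
- by exists (Imfun g) => //; exact: aeD_all.
Qed.

Lemma Delta_bc : 1 <= alpha -> DeltaII m alpha = dom_bcII m alpha.
Proof.
move=> a1; apply/seteqP; split=> f; last by case.
move=> Df; have [v vf [Qr Qi]] := Delta_cQmax ham Df.
have [_ Lv] := cQmax_L2 ham (conj Qr Qi).
by have [] := (dom_bcP ham f Lv).2 (conj (Qmax_Qbc ham a1 Qr) (Qmax_Qbc ham a1 Qi)).
Qed.

Lemma dom_min_bc : 1 <= alpha -> dom_minII m alpha = dom_bcII m alpha.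
Proof.
move=> a1; rewrite -Delta_bc//; apply/seteqP; split=> f; first by case.
move=> Df; have [v vf Qf] := Delta_cQmax ham Df.
apply/(dom_minP ham Df Qf) => g w [Qr Qi].
by case: Qf => fr fi; apply: cQbc_sym; split; exact: (Qmax_Qbc ham a1).
Qed.

Lemma nonreal_neq_nat (lam : R[i]) : complex.Im lam != 0 -> forall n : nat, lam <> n%:R.
Proof. by move=> l0 n E; rewrite E Im_nat eqxx in l0. Qed.

(** The minimal operator is self-adjoint, and its eigenvalues are real. *)
Lemma deficiency0 (lam : R[i]) : 1 <= alpha -> complex.Im lam != 0 ->
  has_dim (op_eigenspace (adjoint W T0) lam) 0.
Proof.
move=> a1 l0; rewrite /T0II dom_min_bc//.
exists (fun _ => fun=> 0); split; [by case|by move=> c _; case|].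
move=> u [v Tv vu]; exists (fun=> 0).
have [_ sa] := Tbc_self_adjoint ham.
have /(Tbc_diag ham)[Lu Lv duv] := (sa u v).1 Tv.
have vu' : aeq v (fun x => lam * u x + 0 * u x).
  by apply: aeD_filter vu => x _ ->; ring.
have u0 : aeq u (fun=> 0).
  apply: (ck_inj ham Lu) => k.
  have := duv k; rewrite (ck_aeq ham _ Lv (L2_lin mW W0 lam 0 Lu Lu) vu') (ck_lin ham _ _ _ Lu Lu).
  rewrite mul0r addr0 => /eqP; rewrite -subr_eq0 -mulrBl mulf_eq0 => /orP[|/eqP//].
  by rewrite subr_eq0 => /eqP /(nonreal_neq_nat l0).
by apply: aeD_filter u0 => x _ ->; rewrite /lincomb big_ord0.
Qed.

Section limit_circle.
Variables (phi w0 : R -> R) (l : R).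
Hypothesis Qphi : QmaxII phi w0.
Hypothesis l0 : l != 0.
Hypothesis cphi : qd pI phi x @[x --> 0^'+] --> l.
Variable lam : R[i].
Hypothesis lam_nonreal : complex.Im lam != 0.

Let Phi x : R[i] := (phi x)%:C.
Let Omega x : R[i] := (w0 x)%:C.

Let QPhi : cQmax Phi Omega.
Proof. split; [exact: Qphi|exact: (Qbc0 pI cW W0 cq qb iW).1]. Qed.

Let LPhi : L2 W Phi. Proof. by have [] := cQmax_L2 ham QPhi. Qed.
Let LOmega : L2 W Omega. Proof. by have [] := cQmax_L2 ham QPhi. Qed.

(* modulo a multiple of Phi, every function satisfies the boundary condition *)
Let reduce g w : cQmax g w -> exists c : R[i],
  cQbc (fun x => 1 * g x + c * Phi x) (fun x => 1 * w x + c * Omega x).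
Proof.
move=> Qg; have [Qr Qi] := Qg.
have [kr [_ cr]] := qd_cvg cW W0 cq qb iW Qr.
have [ki [_ ci]] := qd_cvg cW W0 cq qb iW Qi.
exists ((- (kr / l)) +i* (- (ki / l))).
have [Q1 Q2] := cQmax_lin ham 1 ((- (kr / l)) +i* (- (ki / l))) Qg QPhi.
split; split => //.
  have -> : Refun (fun x => 1 * g x + ((- (kr / l)) +i* (- (ki / l))) * Phi x) =
    (fun x => 1 * Refun g x + - (kr / l) * phi x).
    by apply/funext => x; rewrite !ReImE /=; ring.
  have h := @qd_lin_cvg R W pI _ p0 1 (- (kr / l)) _ _ _ _ _ _ Qr Qphi cr cphi.
  by rewrite mulNr divfK// mul1r subrr in h.
have -> : Imfun (fun x => 1 * g x + ((- (kr / l)) +i* (- (ki / l))) * Phi x) =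
    (fun x => 1 * Imfun g x + - (ki / l) * phi x).
  by apply/funext => x; rewrite !ReImE /=; ring.
have h := @qd_lin_cvg R W pI _ p0 1 (- (ki / l)) _ _ _ _ _ _ Qi Qphi ci cphi.
  by rewrite mulNr divfK// mul1r subrr in h.
Qed.

(** The maximal domain is spanned by Phi and the domain with the boundary
    condition, where symmetry holds; so symmetry only has to be checked
    against Phi. *)
Let T0_of_bc u v f : cQbc f v -> L2 W u -> aeq u f ->
  inner W v Phi = inner W f Omega -> T0 u v.
Proof.
move=> Qf Lu uf H; have Qm := cQbc_cQmax Qf; have [Lf Lv] := cQmax_L2 ham Qm.
have [Df vf] := (DeltaP ham f Lv).2 Qm.
split => //; exists f; split => //; apply/(dom_minP ham Df Qm) => g w Qg.
have [Lg Lw] := cQmax_L2 ham Qg.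
have [c Qc] := reduce Qg; have := cQbc_sym Qf Qc.
by rewrite !linr// H => /addIr; rewrite conjc1 !mul1r.
Qed.

(** Let y solve (T - lam) y = (l - lam) Phi; then psi = Phi - y is in the maximal
    domain, l[psi] = lam psi, and psi does not vanish because y satisfies the
    boundary condition and Phi does not. If h is orthogonal to psi, the solution of
    (T - conj lam) u = h is in the minimal domain, so every element k of the
    deficiency space is orthogonal to h. Taking for h the component of k
    orthogonal to psi shows that k is a multiple of psi. *)
Lemma deficiency1_aux : has_dim (op_eigenspace (adjoint W T0) lam) 1.
Proof.
have Lh : L2 W (fun x => 1 * Omega x + (- lam) * Phi x) by exact: (L2_lin mW W0).
have [y Ly Ty] := resolvent_solve ham (nonreal_neq_nat lam_nonreal) Lh.
set z := (fun x => _) in Ty.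
have [_ Lz [fy [Dy yfy zfy]]] := Ty.
have Qy := (dom_bcP ham fy Lz).1 (conj Dy zfy).
have Qym := cQbc_cQmax Qy; have [Lfy _] := cQmax_L2 ham Qym.
pose psi x := 1 * Phi x + (-1) * fy x.
pose sig x := 1 * Omega x + (-1) * z x.
have Qpsi : cQmax psi sig by exact: (cQmax_lin ham).
have [Lpsi Lsig] := cQmax_L2 ham Qpsi.
have sigE : aeq sig (fun x => lam * psi x).
  by apply: aeD_filter yfy => x _ E; rewrite /sig /psi /z -E; ring.
have psi_n0 : ~ aeq psi (fun=> 0).
  move=> /aeqP[e1 _].
  have [[Qr qr0] _] := Qy; have [_ _ dr _ _] := Qr; have [_ _ dp _ _] := Qphi.
  have E : forall x, 0 < x -> phi x = Refun fy x.
    apply: aeD_eq_continuous.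
    - by move=> x; rewrite inE => /inD x0; exact: d_continuous (derivable_d (dp x x0)).
    - by move=> x; rewrite inE => /inD x0; exact: d_continuous (derivable_d (dr x x0)).
    by apply: aeD_filter e1 => x _; rewrite /psi !ReImE /=; lra.
  have qE : \forall x \near 0^'+, qd pI (Refun fy) x = qd pI phi x.
    near=> x; have x0 : 0 < x by near: x; exact: nbhs_right_gt.
    have nE : \forall t \near x, phi t = Refun fy t.
      by near=> t; apply: E; near: t; exact: lt_nbhsr.
    by rewrite /qd (d_derive1 (near_eq_is_derive nE (derivable_d (dp x x0)))).
  have c2 : qd pI phi x @[x --> 0^'+] --> 0.
    by apply: cvg_trans qr0; apply: near_eq_cvg; exact: qE.
  have El : l = 0 by exact: (cvg_unique (@Rhausdorff R) cphi c2).
  by move: l0; rewrite El eqxx.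
have npsi : inner W psi psi != 0.
  by apply/eqP => /(inner_eq0 mW W0 Lpsi).
have psi_adj : adjoint W T0 psi sig.
  split => // u v [Lu Lv [f [Df uf vf]]].
  have [Df' _] := Df.
  have Qf := (DeltaP ham f Lv).1 (conj Df' vf); have [Lf _] := cQmax_L2 ham Qf.
  rewrite ((dom_minP ham Df' Qf).1 Df psi sig Qpsi).
  by rewrite (inner_aeql mW W0 Lf Lu Lsig (aeq_sym uf)).
exists (fun=> psi); split; first by move=> _; exists sig.
  move=> c H i; rewrite (ord1 i); apply/eqP; apply: contraT => c0; exfalso; apply: psi_n0.
  apply: aeD_filter H => x _; rewrite /lincomb big_ord_recl big_ord0 addr0 => /eqP.
  by rewrite mulf_eq0 (negbTE c0) => /eqP.
move=> k [ka [Lk Lka Hk] kae].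
pose c := inner W k psi / inner W psi psi.
exists (fun=> c).
pose h x := 1 * k x + (- c) * psi x.
have Lh' : L2 W h by exact: (L2_lin mW W0).
have hpsi : inner W h psi = 0.
  by rewrite linl// /c; field.
have lam_conj : complex.Im (conjc lam) != 0 by rewrite ImJ oppr_eq0.
have [u Lu Tu] := resolvent_solve ham (nonreal_neq_nat lam_conj) Lh'.
set v := (fun x => _) in Tu.
have [_ Lv [fu [Du ufu vfu]]] := Tu.
have Qu := (dom_bcP ham fu Lv).1 (conj Du vfu).
have [Lfu _] := cQmax_L2 ham (cQbc_cQmax Qu).
have LLpsi : L2 W (fun x => lam * psi x + 0 * psi x) by exact: (L2_lin mW W0).
have sigE' : aeq sig (fun x => lam * psi x + 0 * psi x).
  by apply: aeD_filter sigE => x _ ->; ring.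
have conj0 : conjc (0 : R[i]) = 0 by apply: cplx_eq; rewrite !ReImE//= oppr0.
have T0u : T0 u v.
  apply: (T0_of_bc Qu Lu ufu).
  have EPhi : Phi = (fun x => 1 * psi x + 1 * fy x).
    by apply/funext => x; rewrite /psi; ring.
  have EOm : Omega = (fun x => 1 * sig x + 1 * z x).
    by apply/funext => x; rewrite /sig; ring.
  have i1 : inner W v Phi = conjc 1 * inner W v psi + conjc 1 * inner W v fy.
    by rewrite {1}EPhi; exact: linr.
  have i2 : inner W fu Omega = conjc 1 * inner W fu sig + conjc 1 * inner W fu z.
    by rewrite {1}EOm; exact: linr.
  have i3 : inner W v psi = conjc lam * inner W u psi.
    have -> : inner W v psi = 1 * inner W h psi + conjc lam * inner W u psi by exact: linl.
    by rewrite hpsi mulr0 add0r.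
  have i4 : inner W fu sig = conjc lam * inner W u psi.
    rewrite -(inner_aeql mW W0 Lu Lfu Lsig ufu) (inner_aeqr mW W0 Lsig LLpsi Lu sigE').
    have -> : inner W u (fun x => lam * psi x + 0 * psi x) =
      conjc lam * inner W u psi + conjc 0 * inner W u psi by exact: linr.
    by rewrite conj0 mul0r addr0.
  by rewrite i1 i2 i3 i4 (cQbc_sym Qu Qy).
have LLk : L2 W (fun x => lam * k x + 0 * k x) by exact: (L2_lin mW W0).
have kae' : aeq ka (fun x => lam * k x + 0 * k x).
  by apply: aeD_filter kae => x _ ->; ring.
have hk : inner W h k = 0.
  have := Hk _ _ T0u; rewrite (inner_aeqr mW W0 Lka LLk Lu kae').
  have -> : inner W u (fun x => lam * k x + 0 * k x) =
      conjc lam * inner W u k + conjc 0 * inner W u k by exact: linr.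
  have -> : inner W v k = 1 * inner W h k + conjc lam * inner W u k by exact: linl.
  by rewrite conj0 mul0r addr0 mul1r => /eqP; rewrite -subr_eq0 addrK => /eqP.
have hh : inner W h h = 0.
  have -> : inner W h h = conjc 1 * inner W h k + conjc (- c) * inner W h psi by exact: linr.
  by rewrite hk hpsi !mulr0 addr0.
apply: aeD_filter (inner_eq0 mW W0 Lh' hh) => x _; rewrite /h /lincomb big_ord_recl big_ord0 addr0.
by rewrite mul1r mulNr => /eqP; rewrite subr_eq0 => /eqP.
Unshelve. all: by end_near. Qed.

End limit_circle.

Lemma deficiency1 (lam : R[i]) : alpha < 1 -> complex.Im lam != 0 ->
  has_dim (op_eigenspace (adjoint W T0) lam) 1.
Proof.
move=> a1 ln; have [phi [w [l [Q l0 c]]]] := boundary_function ham a1.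
exact: (deficiency1_aux Q l0 c ln).
Qed.

(** The deficiency index determines which of the two boundary conditions is meant. *)
Lemma has_dim_01 (S : set (R -> R[i])) : has_dim S 0 -> has_dim S 1 -> False.
Proof.
move=> [e0 [_ _ H0]] [e [Se He _]]; have [c Hc] := H0 _ (Se ord0).
have : (1 : R[i]) = 0.
  apply: (He (fun=> 1)) => //; last exact: ord0.
  apply: aeD_filter Hc => x _; rewrite /lincomb big_ord0 big_ord_recl big_ord0 addr0 mul1r; exact.
by move/eqP; rewrite oner_eq0.
Qed.
End deficiency.

(** * The operator in each case *)

Theorem theorem4p3 (R : realType) (m : nat) (alpha : R)
    (halpha : m%:R - 1 < alpha) :
  let W := weightII m alpha in
  let T0 := T0II m alpha in
  [/\ (((m = 0%N /\ -1 < alpha < 1) \/ (m = 1%N /\ 0 < alpha < 1)) ->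
         deficiency_index W T0 (1, 1)%N),
      (((m = 0%N /\ 1 <= alpha) \/ (m = 1%N /\ 1 <= alpha) \/ (2 <= m)%N) ->
         deficiency_index W T0 (0, 0)%N) &
      forall D : set (R -> R[i]),
        ((deficiency_index W T0 (1, 1)%N /\ D = dom_bcII m alpha) \/
         (deficiency_index W T0 (0, 0)%N /\ D = DeltaII m alpha)) ->
        let T := op W D (ellII m alpha) in
        [/\ self_adjoint W T,
            forall n : nat, (m <= n)%N -> exists lam : R[i],
              op_eigenfunction T lam (fun x => ((laguerreII m alpha n).[x])%:C),
            complete_system W (fun k x => ((laguerreII m alpha (m + k)).[x])%:C),
            forall lam : R[i], spectrum W T lam -> op_eigenvalue T lam &
            spectrum W T = [set lam | exists n : nat, lam = n%:R]]].
Proof.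
move=> W T0.
have i_nonreal : complex.Im (0 +i* 1 : R[i]) != 0 by rewrite oner_eq0.
have Ni_nonreal : complex.Im (0 -i* 1 : R[i]) != 0 by rewrite oppr_eq0 oner_eq0.
have def1 : alpha < 1 -> deficiency_index W T0 (1, 1)%N.
  by move=> a1; split; exact: deficiency1.
have def0 : 1 <= alpha -> deficiency_index W T0 (0, 0)%N.
  by move=> a1; split; exact: deficiency0.
split.
- by move=> [[_ /andP[_ a1]]|[_ /andP[_ a1]]]; exact: def1.
- move=> [[_ a1]|[[_ a1]|m2]]; apply: def0 => //.
  apply: le_trans (ltW halpha); rewrite lerBrDr.
  by rewrite (_ : 1 + 1 = 2%:R)// ler_nat.
move=> D HD T.
have -> : T = op W (dom_bcII m alpha) (ellII m alpha).
  rewrite /T; case: HD => [[_ ->//]|[[d0 _] ->]].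
  have [a1|a1] := leP 1 alpha; first by rewrite Delta_bc.
  (* for alpha < 1 the index is (1, 1), so this case does not occur *)
  by have [d1 _] := def1 a1; have := has_dim_01 d0 d1.
split.
- exact: Tbc_self_adjoint.
- move=> n mn; exists (n - m)%:R.
  by have := eigenfunction_Pn halpha (n - m); rewrite subnKC.
- exact: Tbc_complete.
- move=> lam; rewrite Tbc_spectrum// => -[n ->].
  by eexists; exact: eigenfunction_Pn.
- exact: Tbc_spectrum.
Qed.
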